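(* Let $G$ be the group given by the presentation $$\langle a,t,s\,|\,a^2=1,\ [t,s]=1,\ [t^{-1}at,a]=1,\ s^{-1}as=at^{-1}at\rangle.$$ Then the set $\mathcal C(G^3)$ of $l^2$-Betti numbers arising from the threefold direct product $G^3$ contains $$\frac1{64}- \frac18\sum_{k=1}^\infty \frac1{2^{k^2+4k+6}}.$$
   Context: For a countable discrete group $G$, the rational group ring $\mathbb Q G$ acts on $l^2G$ by convolution, and $M_k(\mathbb Q G)$ acts correspondingly on $(l^2G)^k$. The trace $\tau_G$ on $\mathbb Q G$ is $\tau_G(T)=\langle T\zeta_e,\zeta_e\rangle$, where $\zeta_e\in l^2G$ is the basis vector of the neutral element; the induced trace on $M_k(\mathbb Q G)\cong M_k(\mathbb Q)\otimes \mathbb Q G$ is $\operatorname{tr}\otimes\tau_G$ (with $\operatorname{tr}$ the non-normalized matrix trace), also denoted $\tau_G$, and extended to the weak closure. For self-adjoint $T\in M_k(\mathbb Q G)$, $\dim_{vN}\ker T$ is $\tau_G$ of the orthogonal projection onto $\ker T$. For general $T$, $\dim_{vN}\ker T:=\dim_{vN}\ker T^*T$. A real number $r$ is an $l^2$-Betti number arising from $G$ if there are $k$ and $T\in M_k(\mathbb Q G)$ with $\dim_{vN}\ker T=r$; the set of all such $r$ is $\mathcal C(G)$. Brackets $[x,y]$ denote commutators. *)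

(* Defs.v *)
From HB Require Import structures.
From mathcomp Require Import all_boot all_order all_algebra.
From mathcomp Require Import finmap generic_quotient complex.
From mathcomp Require Import all_classical all_reals all_analysis.

Set Implicit Arguments.
Unset Strict Implicit.
Unset Printing Implicit Defensive.

Import Order.TTheory GRing.Theory Num.Theory.

Local Open Scope ring_scope.
Local Open Scope classical_set_scope.

(** * Groups given by generators and relations *)

Section Presentation.
Variable X : choiceType.

(** The letter [(x, false)] stands for the generator [x] and [(x, true)] for
    its inverse; the product of words is concatenation. *)
Definition word := seq (X * bool).

Definition wgen (x : X) : word := [:: (x, false)].

Definition winv (w : word) : word := rev [seq (l.1, ~~ l.2) | l <- w].

Definition wcomm (u v : word) : word := winv u ++ winv v ++ u ++ v.

Variable rels : seq (word * word).

(** The least congruence on words that contains the relations [u = v] for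
    [(u, v)] in [rels] and makes [(x, true)] the inverse of [(x, false)]. *)
Inductive pres_eq : word -> word -> Prop :=
| pres_refl u : pres_eq u u
| pres_sym u v : pres_eq u v -> pres_eq v u
| pres_trans v u w : pres_eq u v -> pres_eq v w -> pres_eq u w
| pres_cat u u' v v' : pres_eq u u' -> pres_eq v v' ->
    pres_eq (u ++ v) (u' ++ v')
| pres_cancel x b : pres_eq [:: (x, b); (x, ~~ b)] [::]
| pres_rel u v : (u, v) \in rels -> pres_eq u v.

Definition pres_eqb : rel word := fun u v => `[< pres_eq u v >].

Lemma pres_eqb_refl : reflexive pres_eqb.
Proof. by move=> u; apply/asboolP; exact: pres_refl. Qed.

Lemma pres_eqb_sym : symmetric pres_eqb.
Proof. by move=> u v; apply/asboolP/asboolP; exact: pres_sym. Qed.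

Lemma pres_eqb_trans : transitive pres_eqb.
Proof. by move=> v u w /asboolP uv /asboolP vw; apply/asboolP; exact: pres_trans uv vw. Qed.

Canonical pres_equiv := EquivRel pres_eqb pres_eqb_refl pres_eqb_sym pres_eqb_trans.

Definition presented := {eq_quot pres_equiv}%qT.

HB.instance Definition _ := Choice.on presented.

Definition pcls (w : word) : presented := (\pi_({eq_quot pres_equiv}) w)%qT.

Definition pone : presented := pcls [::].
Definition pmul (x y : presented) : presented := pcls (repr x ++ repr y).
Definition pinv (x : presented) : presented := pcls (winv (repr x)).

Lemma pclsP u v : pcls u = pcls v <-> pres_eq u v.
Proof.
split=> [/eqP|uv]; first by rewrite /pcls eqmodE => /asboolP.
by apply/eqP; rewrite /pcls eqmodE; apply/asboolP.
Qed.

Lemma pclsK (x : presented) : pcls (repr x) = x.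
Proof. exact: reprK. Qed.

Lemma repr_pcls w : pres_eq (repr (pcls w)) w.
Proof. by apply/pclsP; rewrite pclsK. Qed.

Lemma pmul_cls u v : pmul (pcls u) (pcls v) = pcls (u ++ v).
Proof. by apply/pclsP/pres_cat; exact: repr_pcls. Qed.

Lemma winv_cat u v : winv (u ++ v) = winv v ++ winv u.
Proof. by rewrite /winv map_cat rev_cat. Qed.

Lemma winvK : involutive winv.
Proof.
move=> w; rewrite /winv map_rev revK -map_comp.
by rewrite -[RHS]map_id; apply: eq_map => -[x b] /=; rewrite negbK.
Qed.

Lemma pres_winvr w : pres_eq (w ++ winv w) [::].
Proof.
elim: w => [|[x b] w IH]; first exact: pres_refl.
rewrite -cat1s winv_cat -catA (catA w).
apply: (@pres_trans ([:: (x, b)] ++ ([::] ++ winv [:: (x, b)]))).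
  by apply: pres_cat; [exact: pres_refl|apply: pres_cat => //; exact: pres_refl].
exact: pres_cancel.
Qed.

Lemma pres_winvl w : pres_eq (winv w ++ w) [::].
Proof. by rewrite -{2}(winvK w); exact: pres_winvr. Qed.

Lemma pmulA : associative pmul.
Proof.
by move=> x y z; rewrite -(pclsK x) -(pclsK y) -(pclsK z) !pmul_cls catA.
Qed.

Lemma pmul1 : left_id pone pmul.
Proof. by move=> x; rewrite -(pclsK x) pmul_cls. Qed.

Lemma pmulr1 : right_id pone pmul.
Proof. by move=> x; rewrite -(pclsK x) pmul_cls cats0. Qed.

Lemma pmulV : left_inverse pone pinv pmul.
Proof.
by move=> x; rewrite -{2}(pclsK x) pmul_cls; apply/pclsP; exact: pres_winvl.
Qed.

Lemma pmulVr : right_inverse pone pinv pmul.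
Proof.
by move=> x; rewrite -{1}(pclsK x) pmul_cls; apply/pclsP; exact: pres_winvr.
Qed.

HB.instance Definition _ :=
  isGroup.Build presented pmulA pmul1 pmulr1 pmulV pmulVr.

End Presentation.

Definition grp_a : word 'I_3 := wgen (inord 0).
Definition grp_t : word 'I_3 := wgen (inord 1).
Definition grp_s : word 'I_3 := wgen (inord 2).

Definition grp_rels : seq (word 'I_3 * word 'I_3) :=
  let a := grp_a in let t := grp_t in let s := grp_s in
  [:: (a ++ a, [::]);
      (wcomm t s, [::]);
      (wcomm (winv t ++ a ++ t) a, [::]);
      (winv s ++ a ++ s, a ++ winv t ++ a ++ t)].

Definition grp : groupType := presented grp_rels.

(** * The rational group ring *)

Section GroupRing.
Variable G : groupType.
Implicit Types (f g h : {fsfun G -> rat with 0}).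

Definition QG := {fsfun G -> rat with 0}.

HB.instance Definition _ := Choice.on QG.

Definition qg_zero : QG := [fsfun].

Definition qg_opp (f : QG) : QG := [fsfun x in finsupp f => - f x].

Definition qg_add (f g : QG) : QG :=
  [fsfun x in (finsupp f `|` finsupp g)%fset => f x + g x].

Definition qg_one : QG := [fsfun x in [fset (1%g : G)]%fset => 1].

Definition qg_mul (f g : QG) : QG :=
  [fsfun x in [fset (y * z)%g | y in finsupp f, z in finsupp g]%fset =>
     \sum_(y <- finsupp f) f y * g (y^-1 * x)%g].

Lemma qg_oppE (f : QG) x : qg_opp f x = - f x.
Proof. by rewrite fsfunE; case: finsuppP => // _; rewrite oppr0. Qed.

Lemma qg_addE (f g : QG) x : qg_add f g x = f x + g x.
Proof.
rewrite fsfunE inE; case: ifPn => // /norP[xf xg].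
by rewrite !fsfun_dflt ?addr0.
Qed.

Lemma qg_oneE x : qg_one x = (x == 1%g)%:R.
Proof. by rewrite fsfunE inE; case: eqP. Qed.

Lemma qg_mulE (f g : QG) x :
  qg_mul f g x = \sum_(y <- finsupp f) f y * g (y^-1 * x)%g.
Proof.
rewrite fsfunE; case: ifPn => // xS.
rewrite big_seq big1// => y yf; rewrite [g _]fsfun_dflt ?mulr0//.
apply: contra xS => zg; apply/imfset2P; exists y => //.
by exists (y^-1 * x)%g => //; rewrite mulgA mulgV mul1g.
Qed.

Lemma qg_sum_incl (f : QG) (F : G -> rat) (S : {fset G}) :
  (finsupp f `<=` S)%fset ->
  \sum_(y <- finsupp f) f y * F y = \sum_(y <- S) f y * F y.
Proof.
move=> fS; apply: big_fset_incl => // y yS yf.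
by rewrite fsfun_dflt ?mul0r.
Qed.

Lemma qg_addA : associative qg_add.
Proof. by move=> f g h; apply/fsfunP => x; rewrite !qg_addE addrA. Qed.

Lemma qg_addC : commutative qg_add.
Proof. by move=> f g; apply/fsfunP => x; rewrite !qg_addE addrC. Qed.

Lemma qg_add0 : left_id qg_zero qg_add.
Proof. by move=> f; apply/fsfunP => x; rewrite qg_addE fsfun0E add0r. Qed.

Lemma qg_addN : left_inverse qg_zero qg_opp qg_add.
Proof.
by move=> f; apply/fsfunP => x; rewrite qg_addE qg_oppE fsfun0E addNr.
Qed.

HB.instance Definition _ :=
  GRing.isZmodule.Build QG qg_addA qg_addC qg_add0 qg_addN.

Lemma qg_mul_translate (g : QG) (F : G -> rat) (y : G) (S : {fset G}) :
  (forall w, w \in finsupp g -> (y * w)%g \in S) ->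
  \sum_(z <- S) g (y^-1 * z)%g * F z = \sum_(w <- finsupp g) g w * F (y * w)%g.
Proof.
move=> gS; pose S' := [fset (y^-1 * z)%g | z in S]%fset.
rewrite (@qg_sum_incl g (fun w => F (y * w)%g) S'); last first.
  apply/fsubsetP => w /gS ywS; apply/imfsetP; exists (y * w)%g => //.
  by rewrite mulgA mulVg mul1g.
rewrite /S' big_imfset/=; last by move=> z z' _ _; exact: mulgI.
by apply: eq_bigr => z _; rewrite mulgA mulgV mul1g.
Qed.

Lemma qg_mulA : associative qg_mul.
Proof.
move=> f g h; apply/fsfunP => x.
pose S := [fset (y * z)%g | y in finsupp f, z in finsupp g]%fset.
have sS : (finsupp (qg_mul f g) `<=` S)%fset by exact: finsupp_sub.
rewrite [RHS]qg_mulE (qg_sum_incl _ sS) qg_mulE.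
under [RHS]eq_bigr do rewrite qg_mulE mulr_suml.
rewrite exchange_big/= !big_seq; apply: eq_bigr => y yf.
under eq_bigr do rewrite -mulrA.
rewrite -mulr_sumr qg_mulE; congr (_ * _).
rewrite (@qg_mul_translate g (fun z => h (z^-1 * x)%g)); last first.
  by move=> w wg; apply/imfset2P; exists y => //; exists w.
by apply: eq_bigr => w _; rewrite invgM !mulgA.
Qed.

Lemma qg_mul1 : left_id qg_one qg_mul.
Proof.
move=> f; apply/fsfunP => x.
have sS : (finsupp qg_one `<=` [fset (1%g : G)])%fset by exact: finsupp_sub.
by rewrite qg_mulE (qg_sum_incl _ sS) big_seq_fset1 qg_oneE eqxx mul1r invg1 mul1g.
Qed.

Lemma qg_mulr1 : right_id qg_one qg_mul.
Proof.
move=> f; apply/fsfunP => x; rewrite qg_mulE.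
have sS : (finsupp f `<=` x |` finsupp f)%fset by exact: fsubsetUr.
rewrite (qg_sum_incl _ sS) (big_fsetD1 x)/= ?fset1U1//.
rewrite mulVg qg_oneE eqxx mulr1 big_seq big1 ?addr0// => y.
rewrite !inE => /andP[yx _]; rewrite qg_oneE; case: eqP => [|_]; last by rewrite mulr0.
by move=> yx1; case/eqP: yx; apply/esym; rewrite -[RHS]mulg1 -yx1 mulgA mulgV mul1g.
Qed.

Lemma qg_mulDl : left_distributive qg_mul qg_add.
Proof.
move=> f g h; apply/fsfunP => x; rewrite qg_addE !qg_mulE.
pose S := (finsupp f `|` finsupp g)%fset.
have s1 : (finsupp (qg_add f g) `<=` S)%fset by exact: finsupp_sub.
rewrite (qg_sum_incl _ s1) (qg_sum_incl _ (fsubsetUl _ (finsupp g))).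
rewrite (qg_sum_incl _ (fsubsetUr (finsupp f) _)) -big_split/=.
by apply: eq_bigr => y _; rewrite qg_addE mulrDl.
Qed.

Lemma qg_mulDr : right_distributive qg_mul qg_add.
Proof.
move=> f g h; apply/fsfunP => x; rewrite qg_addE !qg_mulE -big_split/=.
by apply: eq_bigr => y _; rewrite qg_addE mulrDr.
Qed.

Lemma qg_one_neq0 : qg_one != qg_zero.
Proof.
apply/eqP => /fsfunP /(_ 1%g); rewrite qg_oneE fsfun0E eqxx => /eqP.
by rewrite oner_eq0.
Qed.

HB.instance Definition _ := GRing.Zmodule_isNzRing.Build QG
  qg_mulA qg_mul1 qg_mulr1 qg_mulDl qg_mulDr qg_one_neq0.

Definition qg_star (f : QG) : QG :=
  [fsfun x in [fset y^-1%g | y in finsupp f]%fset => f x^-1%g].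

Lemma qg_starE (f : QG) x : qg_star f x = f x^-1%g.
Proof.
rewrite fsfunE; case: ifPn => // xf; rewrite fsfun_dflt//.
by apply: contra xf => xf; apply/imfsetP; exists x^-1%g => //; rewrite invgK.
Qed.

Definition mx_star (k : nat) (T : 'M[QG]_k) : 'M[QG]_k := map_mx qg_star T^T.

End GroupRing.

(** * Von Neumann dimension of kernels *)

Section VonNeumann.
Variables (R : realType) (G : groupType).

(** The sum of an absolutely summable family, as positive part minus negative
    part; it is only used for inner products, where absolute summability holds
    by Cauchy-Schwarz. *)
Definition rsum (f : G -> R) : R :=
  fine (\esum_(x in [set: G]) (Order.max (f x) 0)%:E) -
  fine (\esum_(x in [set: G]) (Order.max (- f x) 0)%:E).

Definition csum (f : G -> R[i]) : R[i] :=
  (rsum (fun x => complex.Re (f x)) +i* rsum (fun x => complex.Im (f x)))%C.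

Definition l2 : set (G -> R[i]) :=
  [set f | summable [set: G] (fun x => (ComplexField.Normc.normc (f x) ^+ 2)%:E)].

(** The elements of the k-th power of [l2] are families [f] indexed by ['I_k];
    [l2n_dot] is linear in its first argument. *)
Definition l2n (k : nat) : set ('I_k -> G -> R[i]) :=
  [set f | forall i, l2 (f i)].

Definition l2n_dot (k : nat) (f h : 'I_k -> G -> R[i]) : R[i] :=
  \sum_(i < k) csum (fun x => f i x * (h i x)^*).

Definition zeta (k : nat) (i : 'I_k) : 'I_k -> G -> R[i] :=
  fun j x => ((j == i) && (x == 1%g))%:R.

Definition qg_act (a : QG G) (f : G -> R[i]) : G -> R[i] :=
  fun x => \sum_(y <- finsupp a) ratr (a y) * f (y^-1 * x)%g.

Definition mx_act (k : nat) (T : 'M[QG G]_k) (f : 'I_k -> G -> R[i]) :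
    'I_k -> G -> R[i] :=
  fun i x => \sum_(j < k) qg_act (T i j) (f j) x.

Definition mx_ker (k : nat) (T : 'M[QG G]_k) : set ('I_k -> G -> R[i]) :=
  [set f | l2n f /\ forall i x, mx_act T f i x = 0].

Definition is_orth_proj (k : nat) (V : set ('I_k -> G -> R[i]))
    (P : ('I_k -> G -> R[i]) -> ('I_k -> G -> R[i])) : Prop :=
  forall f, l2n f ->
    V (P f) /\ forall h, V h -> l2n_dot (fun i x => f i x - P f i x) h = 0.

(** The trace [tr \otimes tau_G] of an operator on the k-th power of [l2]. *)
Definition vN_trace (k : nat)
    (A : ('I_k -> G -> R[i]) -> ('I_k -> G -> R[i])) : R[i] :=
  \sum_(i < k) l2n_dot (A (zeta i)) (zeta i).

(** [r] is the von Neumann dimension of the kernel of the self-adjoint [S]: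
    the projection [P] is unique on [l2n], so [r] is determined by [S]. *)
Definition dim_ker_sa (k : nat) (S : 'M[QG G]_k) (r : R) : Prop :=
  exists2 P, is_orth_proj (mx_ker S) P & vN_trace P = r%:C%C.

Definition dim_ker (k : nat) (T : 'M[QG G]_k) (r : R) : Prop :=
  dim_ker_sa (mx_star T *m T) r.

Definition l2_betti : set R :=
  [set r | exists k (T : 'M[QG G]_k), dim_ker T r].

End VonNeumann.

(* Main.v *)
(** In [G] the conjugates of [a] by powers of [t] commute: conjugating the relation
    [a, t^-1 a t] commute by [s] yields, inductively, the relations for the other
    powers. They are moreover independent, as one sees from the affine action of [G]
    on the field F_2(x) with [a], [t], [s] acting by y + 1, y / x, y / (1 + x). So
    <a, t> is a lamplighter group, and the group algebra of G^3 contains the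
    functions on three independent random bit tapes together with the shifts of the
    three heads. Cut each tape at its blanks: the maximal runs of n1, n2, n3 marks
    on the three tapes form a box on whose cells a finitary operator acts as a
    finite matrix, and the trace weighs such a box by 2^-(n1+n2+n3+6).

    The operator propagates a walk deterministically through the box: it runs along
    the diagonal of the base n1 x n2, which reaches the opposite corner if and only
    if n1 = n2, and from there it sweeps the base row by row, back and forth, while
    the third head advances by one at each step. A solution of the walk equations is
    determined by its value at the start, so the kernel is one-dimensional, unless
    the walk is accepted: when the sweep and the run of the third tape end at the
    same time, a further equation makes the solution vanish. This happens exactly for
    n1 = n2 = n > 1 and n3 = n^2, so that the dimension is
    1/64 - \sum_(n > 1) 2^-(n^2+2n+6).

    Only finitely many boxes are handled at a time, with rational matrices: this
    gives U + W A = 1 - E in the group algebra, with A U = 0, U symmetric and E a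
    projection of small trace, and the trace of U tends to the dimension. *)

Require Import Defs.
From HB Require Import structures.
From mathcomp Require Import all_boot all_order all_algebra.
From mathcomp Require Import finmap generic_quotient complex.
From mathcomp Require Import zify ring lra.
From mathcomp Require Import all_classical all_reals all_analysis.

Set Implicit Arguments.
Unset Strict Implicit.
Unset Printing Implicit Defensive.

Import Order.TTheory GRing.Theory Num.Theory.
Import numFieldNormedType.Exports.

Local Open Scope ring_scope.

(** * Kernels of rational matrices *)

(** The dimension is reached without computing in the von Neumann algebra. If [U + W A = 1 - E] with
    [U] and [E] self-adjoint, then [W A] is self-adjoint as well; it kills the kernel of [A], so its
    range is orthogonal to that kernel. Hence the projection of a basis vector [zeta] is [U zeta]
    plus the projection of [E zeta], and the squared norm of this error is at most the trace of
    [E * E]. As [A U = 0] and [U + W A] are additive over boxes, finite rational linear algebra on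
    each box suffices. The constants: a blank is an eigenprojection of a lamp and has trace 1/2, so
    a run of [n] marks with its two blanks has weight 2^-(n+2). These weights sum to 1/4, whence
    1/64 for three tapes; weighted by the [n] cells of the run they sum to 1/2, the probability that
    a head is on a mark, which is why the trace of [E] tends to 0. The box with all sides 1 would be
    accepted too, but the series starts at [k = 1], that is at [n = k + 1 = 2]; testing that the
    first run is longer than one cell excludes it. The substitution turns n^2+2n+6 into k^2+4k+9,
    whence the factor 1/8. *)

Lemma sum_enum_val (V : nmodType) (J : finType) (h : J -> V) :
  \sum_(k < #|J|) h (enum_val k) = \sum_j h j.
Proof. by rewrite -(big_enum_val h). Qed.

(** The matrix [u] is [v v^T] divided by the sum of squares of [v]: the orthogonal projection onto
    the kernel, obtained without square roots. As [1 - u] vanishes on the kernel, its rows lie in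
    the row space of [A], and their coefficients form [w]. For [v = 0] the division by zero is
    harmless. *)
Lemma kernel_split (F : realFieldType) (I J : finType) (A : I -> J -> F)
    (v : J -> F) :
  (forall i, \sum_j A i j * v j = 0) ->
  (forall f : J -> F, (forall i, \sum_j A i j * f j = 0) ->
     exists c, forall j, f j = c * v j) ->
  exists (u : J -> J -> F) (w : J -> I -> F),
    [/\ forall i k, \sum_j A i j * u j k = 0,
        forall j k, u j k = u k j,
        forall j k, u j k + \sum_i w j i * A i k = (j == k)%:R
      & \sum_j u j j = [exists j, v j != 0]%:R].
Proof.
move=> Av kerA.
pose s := \sum_j v j ^+ 2.
have s0 : s = 0 -> forall j, v j = 0.
  move/eqP; rewrite psumr_eq0 => [/allP s0 j|j _]; last exact: sqr_ge0.
  by apply/eqP; rewrite -sqrf_eq0; apply: s0; rewrite mem_index_enum.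
pose u j k := v j * v k / s.
have uv k : \sum_j u k j * v j = v k.
  have uvE j : u k j * v j = v k / s * v j ^+ 2.
    by rewrite /u -!mulrA expr2 (mulrCA (v j)).
  rewrite (eq_bigr _ (fun j _ => uvE j)).
  rewrite -mulr_sumr -/s.
  have [s00|s00] := eqVneq s 0; last by rewrite divfK.
  by rewrite s00 mulr0 (s0 s00).
pose mA := \matrix_(i < #|I|, j < #|J|) A (enum_val i) (enum_val j).
pose mB := \matrix_(j < #|J|, k < #|J|) ((j == k)%:R - u (enum_val j) (enum_val k)).
(* Inclusion of row spaces is tested on [cokermx mA]: its columns solve the system, hence are
   multiples of [v], and [1 - u] kills [v]. *)
have sub : (mB <= mA)%MS.
  rewrite submxE; apply/eqP/matrixP => j l; rewrite !mxE.
  pose f x := cokermx mA (enum_rank x) l.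
  have [c fc] : exists c, forall j, f j = c * v j.
    apply: kerA => i; have := mulmx_coker mA => /matrixP /(_ (enum_rank i) l).
    rewrite !mxE => kA; apply: etrans kA.
    apply: etrans (esym (sum_enum_val (fun j => A i j * f j))) _.
    apply: eq_bigr => k _.
    by rewrite /f enum_valK [mA _ _]mxE enum_rankK.
  have fcE k : cokermx mA k l = c * v (enum_val k) by rewrite -fc /f enum_valK.
  under eq_bigr => k _ do rewrite [mB _ _]mxE fcE mulrBl.
  rewrite big_split/= sumrN (sum_enum_val (fun k => u (enum_val j) k * (c * v k))).
  rewrite (bigD1 j)//= eqxx mul1r big1 ?addr0; last first.
    by move=> k kj; rewrite eq_sym (negPf kj) mul0r.
  under eq_bigr do rewrite mulrCA.
  by rewrite -mulr_sumr uv subrr.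
have [W WE] := submxP sub.
exists u, (fun j i => W (enum_rank j) (enum_rank i)); split.
- move=> i k; under eq_bigr => j _ do rewrite /u -mulrA mulrA.
  by rewrite -mulr_suml Av mul0r.
- by move=> j k; rewrite /u (mulrC (v j)).
- move=> j k; have /matrixP /(_ (enum_rank j) (enum_rank k)) := WE.
  rewrite !mxE !enum_rankK (inj_eq enum_rank_inj) => /eqP.
  rewrite subr_eq eq_sym addrC => /eqP <-; congr (_ + _).
  apply: etrans (esym (sum_enum_val (fun i => W (enum_rank j) (enum_rank i) * A i k))) _.
  apply: eq_bigr => i _.
  by rewrite !mxE enum_rankK enum_valK.
- have -> : \sum_j u j j = s / s.
    by rewrite /u -mulr_suml; congr (_ / _); apply: eq_bigr => j _; rewrite expr2.
  have [s00|s00] := eqVneq s 0.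
    rewrite s00 mul0r; case: existsP => // -[j]; by rewrite s0 ?eqxx.
  rewrite divff//; case: existsP => // nv; case/eqP: s00.
  by rewrite /s big1// => j _; case: (eqVneq (v j) 0) => [->|vj];
    [rewrite expr0n|case: nv; exists j].
Qed.

(** * Matrix units on one tape *)

Section Tape.
Variables (Q : algType rat) (t t' z : Q).

(* [t] and [t'] move the head, [z] projects on the event that the head is on a blank
   and [zat j] on a blank [j] cells further; [blk n] describes the pattern blank,
   [n] marks, blank, and [unt n p q] is the matrix unit from the mark [q] to the
   mark [p] of such a run. The locks keep unification from unfolding powers. *)
Definition zat (j : nat) : Q := locked (t' ^+ j * z * t ^+ j).
Definition oat (j : nat) : Q := 1 - zat j.
Definition blk (n : nat) : Q := locked (zat 0 * \prod_(j < n) oat j.+1 * zat n.+1).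
Definition unt (n p q : nat) : Q := locked (t ^+ p.+1 * blk n * t' ^+ q.+1).

Lemma comm_unt (y : Q) n p q : GRing.comm y t -> GRing.comm y t' ->
  GRing.comm y z -> GRing.comm y (unt n p q).
Proof.
move=> yt yt' yz.
have yzj j : GRing.comm y (zat j).
  by rewrite /zat -!lock; apply: commrM; [apply: commrM => //|]; apply: commrX.
have yb : GRing.comm y (blk n).
  rewrite /blk -!lock; apply: commrM => //; apply: commrM => //.
  by apply: commr_prod => j _; apply: commrB => //; exact: commr1.
by rewrite /unt -!lock; apply: commrM; [apply: commrM => //|]; apply: commrX.
Qed.

Hypotheses (tt' : t * t' = 1) (t't : t' * t = 1) (zid : z * z = z).
Hypothesis zatC : forall j k, zat j * zat k = zat k * zat j.

Lemma ttX j : t ^+ j * t' ^+ j = 1.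
Proof.
by elim: j => [|j IH]; rewrite ?mulr1// exprSr exprS mulrA -(mulrA _ t) tt' mulr1.
Qed.

Lemma ttXV j : t' ^+ j * t ^+ j = 1.
Proof.
by elim: j => [|j IH]; rewrite ?mulr1// exprSr exprS mulrA -(mulrA _ t') t't mulr1.
Qed.

Lemma zat0 : zat 0 = z. Proof. by rewrite /zat -!lock mul1r mulr1. Qed.

Lemma zatE j : t ^+ j * zat j = z * t ^+ j.
Proof. by rewrite /zat -!lock !mulrA ttX mul1r. Qed.

Lemma zatE' j : zat j * t' ^+ j = t' ^+ j * z.
Proof. by rewrite /zat -!lock -!mulrA ttX mulr1. Qed.

Lemma zat_id j : zat j * zat j = zat j.
Proof.
by rewrite /zat -!lock -!mulrA (mulrA (t ^+ j)) ttX mul1r (mulrA z) zid.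
Qed.

Lemma zat_blkC j n : zat j * blk n = blk n * zat j.
Proof.
have cz k : GRing.comm (zat j) (zat k) by exact: zatC.
rewrite /blk -!lock; apply: commrM => //; apply: commrM => //.
by apply: commr_prod => k _; apply: commrB => //; exact: commr1.
Qed.

Lemma zat_blk0 n : zat 0 * blk n = blk n.
Proof. by rewrite /blk -!lock !mulrA zat_id. Qed.

Lemma zat_blkS n : zat n.+1 * blk n = blk n.
Proof. by rewrite zat_blkC /blk -!lock -mulrA zat_id. Qed.

Lemma zat_oats j n : (0 < j <= n)%N -> zat j * \prod_(k < n) oat k.+1 = 0.
Proof.
elim: n => [|n IH] jn; first by lia.
rewrite big_ord_recr/= mulrA.
have [jn'|jn'] := leqP j n; first by rewrite IH ?mul0r//; lia.
have {jn jn'}-> : j = n.+1 by lia.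
have -> : zat n.+1 * (\prod_(k < n) oat k.+1) = (\prod_(k < n) oat k.+1) * zat n.+1.
  by apply: commr_prod => k _; apply: commrB; [exact: commr1|exact: zatC].
by rewrite -mulrA /oat mulrBr mulr1 zat_id subrr mulr0.
Qed.

Lemma zat_blk j n : (0 < j <= n)%N -> zat j * blk n = 0.
Proof.
by move=> jn; rewrite /blk -!lock !mulrA zatC -(mulrA (zat 0)) zat_oats// mulr0 mul0r.
Qed.

Lemma zat_blkE j n : (j <= n.+1)%N ->
  zat j * blk n = ((j == 0) || (j == n.+1))%N%:R *: blk n.
Proof.
have [->|j0] := eqVneq j 0%N; first by rewrite scale1r zat_blk0.
have [->|jn] := eqVneq j n.+1; first by rewrite scale1r zat_blkS.
by move=> jn'; rewrite scale0r zat_blk//; lia.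
Qed.

Lemma blk_zatE j n : (j <= n.+1)%N ->
  blk n * zat j = ((j == 0) || (j == n.+1))%N%:R *: blk n.
Proof. by rewrite -zat_blkC; exact: zat_blkE. Qed.

Lemma blk_id n : blk n * blk n = blk n.
Proof.
rewrite [in X in X * _]/blk -!lock -mulrA zat_blkS -mulrA.
suff -> : \prod_(j < n) oat j.+1 * blk n = blk n by exact: zat_blk0.
have : forall m, (m <= n)%N -> \prod_(j < m) oat j.+1 * blk n = blk n; last exact.
elim=> [|m IH] mn; first by rewrite big_ord0 mul1r.
by rewrite big_ord_recr/= -mulrA {2}/oat mulrBl mul1r zat_blk ?subr0 ?IH// ltnW.
Qed.

(** The closing blank of the shorter run falls on a mark of the longer one. *)
Lemma blk_neq m n : m != n -> blk m * blk n = 0.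
Proof.
wlog mn : m n / (m < n)%N => [H|_].
  rewrite neq_ltn => /orP[mn|nm]; first by apply: H => //; rewrite ltn_eqF.
  have -> : blk m * blk n = blk n * blk m; last by apply: H => //; rewrite ltn_eqF.
  rewrite -/(GRing.comm _ _) [blk n]/blk -!lock.
  apply: commrM; [apply: commrM|]; try exact/commr_sym/zat_blkC.
  by apply: commr_prod => j _; apply: commrB;
    [exact: commr1|exact/commr_sym/zat_blkC].
by rewrite -(zat_blkS m) zat_blkC -mulrA zat_blk ?mulr0//; lia.
Qed.

(** Carried through [t ^+ d], the opening blank of the left pattern falls on the [d]-th mark of the
    right one; [shr_blk] exchanges the roles. *)
Lemma shl_blk d m n : (0 < d <= n)%N -> blk m * t ^+ d * blk n = 0.
Proof.
move=> dn; rewrite -(zat_blk0 m) zat_blkC zat0 -!mulrA (mulrA z) -zatE.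
by rewrite -mulrA zat_blk// !mulr0.
Qed.

Lemma shr_blk d m n : (0 < d <= m)%N -> blk m * t' ^+ d * blk n = 0.
Proof.
move=> dm; rewrite -(zat_blk0 n) zat0 -!mulrA (mulrA _ z) -zatE' !mulrA.
by rewrite -zat_blkC zat_blk// !mul0r.
Qed.

(** Between the two patterns the shifts leave a displacement by the difference of [q] and [r]. If it
    is nonzero, it is short enough to put the opening blank of one pattern on a mark of the other;
    if it is zero, the patterns themselves are multiplied. *)
Lemma untM m n p q r s : (p < m)%N -> (q < m)%N -> (r < n)%N -> (s < n)%N ->
  unt m p q * unt n r s = ((m == n) && (q == r))%:R *: unt m p s.
Proof.
move=> pm qm rn sn.
have -> : unt m p q * unt n r s =
  t ^+ p.+1 * (blk m * (t' ^+ q.+1 * t ^+ r.+1) * blk n) * t' ^+ s.+1.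
  by rewrite /unt -!lock !mulrA.
case: (ltngtP q r) => qr; rewrite ?andbF ?scale0r ?andbT.
- have -> : r.+1 = (q.+1 + (r - q))%N by lia.
  rewrite (exprD t q.+1) (mulrA (t' ^+ _)) ttXV mul1r; rewrite shl_blk ?mulr0 ?mul0r//; lia.
- have -> : q.+1 = (q - r + r.+1)%N by lia.
  rewrite (exprD t' (q - r)) -(mulrA (t' ^+ _)) ttXV mulr1; rewrite shr_blk ?mulr0 ?mul0r//; lia.
- rewrite qr ttXV mulr1; have [<-|mn] := eqVneq m n; last first.
    by rewrite blk_neq// mulr0 mul0r scale0r.
  by rewrite blk_id scale1r /unt -!lock.
Qed.

(** On the runs of length [n] the element [x] is the matrix [M n], in which [r] is the row and [p]
    the column. Both multiplications are recorded: the left one serves for [A U = 0], the right one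
    for [W A]. *)
Definition loc1 (x : Q) (M : nat -> nat -> nat -> rat) :=
  forall n p q, (p < n)%N -> (q < n)%N ->
    x * unt n p q = \sum_(r < n) M n r p *: unt n r q /\
    unt n p q * x = \sum_(r < n) M n q r *: unt n p r.

(* [zl], [z] and [zr] test for a blank under the left neighbour of the head,
   under the head and under its right neighbour. *)
Let zl := t * z * t'.
Let zr := t' * z * t.
Let o := 1 - z.

Lemma z_unt n p q : (p < n)%N -> z * unt n p q = 0.
Proof.
move=> pn; rewrite /unt -!lock !mulrA -zatE -(mulrA _ _ (blk n)) zat_blkE; last by lia.
by rewrite (_ : _ || _ = false) ?scale0r ?mulr0 ?mul0r//; lia.
Qed.

Lemma unt_z n p q : (q < n)%N -> unt n p q * z = 0.
Proof.
move=> pn; rewrite /unt -!lock -!mulrA -zatE' (mulrA (blk n)) blk_zatE; last by lia.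
by rewrite (_ : _ || _ = false) ?scale0r ?mul0r ?mulr0//; lia.
Qed.

Lemma zl_unt n p q : (p < n)%N -> zl * unt n p q = (p == 0)%N%:R *: unt n p q.
Proof.
move=> pn; have -> : zl * unt n p q = t * (z * t ^+ p) * blk n * t' ^+ q.+1.
  by rewrite /zl /unt -!lock (exprS t p) !mulrA -(mulrA _ t' t) t't mulr1.
rewrite -zatE mulrA -exprS -(mulrA _ _ (blk n)) zat_blkE; last by lia.
rewrite (_ : _ || _ = (p == 0)%N); last by lia.
by rewrite -scalerAr -scalerAl /unt -!lock.
Qed.

Lemma unt_zl n p q : (q < n)%N -> unt n p q * zl = (q == 0)%N%:R *: unt n p q.
Proof.
move=> pn; have -> : unt n p q * zl = t ^+ p.+1 * (blk n * (t' ^+ q * z) * t').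
  by rewrite /zl /unt -!lock (exprSr t' q) !mulrA -(mulrA _ t' t) t't mulr1.
rewrite -zatE' !mulrA -(mulrA _ (blk n)) blk_zatE; last by lia.
rewrite (_ : _ || _ = (q == 0)%N); last by lia.
by rewrite -scalerAr -!scalerAl -mulrA -exprSr /unt -!lock.
Qed.

Lemma zr_unt n p q : (p < n)%N -> zr * unt n p q = (p.+1 == n)%N%:R *: unt n p q.
Proof.
move=> pn; have -> : zr * unt n p q = t' * (z * t ^+ p.+2) * blk n * t' ^+ q.+1.
  by rewrite /zr /unt -!lock (exprS t p.+1) !mulrA.
rewrite -zatE mulrA (exprS t p.+1) mulrA t't mul1r.
rewrite -(mulrA _ _ (blk n)) zat_blkE; last by lia.
rewrite (_ : _ || _ = (p.+1 == n)%N); last by lia.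
by rewrite -scalerAr -scalerAl /unt -!lock.
Qed.

Lemma unt_zr n p q : (q < n)%N -> unt n p q * zr = (q.+1 == n)%N%:R *: unt n p q.
Proof.
move=> pn; have -> : unt n p q * zr = t ^+ p.+1 * (blk n * (t' ^+ q.+2 * z) * t).
  by rewrite /zr /unt -!lock (exprSr t' q.+1) !mulrA.
rewrite -zatE' (mulrA (blk n)) blk_zatE; last by lia.
rewrite (_ : _ || _ = (q.+1 == n)%N); last by lia.
rewrite -!scalerAl -scalerAr; congr (_ *: _).
by rewrite (exprSr t' q.+1) /unt -!lock -!mulrA t't mulr1.
Qed.

Lemma o_unt n p q : (p < n)%N -> o * unt n p q = unt n p q.
Proof. by move=> pn; rewrite /o mulrBl mul1r z_unt// subr0. Qed.

Lemma unt_o n p q : (q < n)%N -> unt n p q * o = unt n p q.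
Proof. by move=> pn; rewrite /o mulrBr mulr1 unt_z// subr0. Qed.

Lemma o_blk n : o * blk n = 0.
Proof. by rewrite /o -zat0 mulrBl mul1r zat_blk0 subrr. Qed.

Lemma blk_o n : blk n * o = 0.
Proof. by rewrite /o -zat0 mulrBr mulr1 -zat_blkC zat_blk0 subrr. Qed.

Lemma o_untn n q : o * unt n n q = 0.
Proof.
rewrite /o /unt -!lock mulrBl mul1r !mulrA -zatE.
by rewrite -(mulrA _ _ (blk n)) zat_blkS subrr.
Qed.

Lemma untn_o n p : unt n p n * o = 0.
Proof.
rewrite /o /unt -!lock mulrBr mulr1 -!mulrA -zatE'.
by rewrite (mulrA (blk n)) -zat_blkC zat_blkS subrr.
Qed.

Lemma t_unt n p q : t * unt n p q = unt n p.+1 q.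
Proof. by rewrite /unt -!lock !mulrA -exprS. Qed.

Lemma unt_t' n p q : unt n p q * t' = unt n p q.+1.
Proof. by rewrite /unt -!lock -!mulrA -exprSr. Qed.

Lemma t'_unt n p q : t' * unt n p.+1 q = unt n p q.
Proof. by rewrite /unt -!lock (exprS t p.+1) !mulrA t't mul1r. Qed.

Lemma unt_t n p q : unt n p q.+1 * t = unt n p q.
Proof. by rewrite /unt -!lock (exprSr t' q.+1) -!mulrA t't mulr1. Qed.

Lemma o_t'_unt n q : o * (t' * unt n 0 q) = 0.
Proof. by rewrite /unt -!lock !mulrA expr1 -(mulrA o) t't mulr1 o_blk mul0r. Qed.

Lemma unt_t_o n p : unt n p 0 * t * o = 0.
Proof. by rewrite /unt -!lock expr1 -!mulrA (mulrA t') t't mul1r blk_o mulr0. Qed.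

(** Flanking by [o] makes each element vanish when the head is or ends up on a blank, so that moves
    never leave a run and [alive] is absorbed on the left. The primed tests also require the other
    neighbour to be a mark, which excludes runs of length one. *)
Definition alive : Q := o.
Definition at_start : Q := o * (zl * o).
Definition at_end : Q := o * (zr * o).
Definition at_start' : Q := o * ((1 - zr) * zl * o).
Definition at_end' : Q := o * ((1 - zl) * zr * o).
Definition forth : Q := o * t * o.
Definition back : Q := o * t' * o.

Lemma comm_gens (y : Q) : GRing.comm y t -> GRing.comm y t' -> GRing.comm y z ->
  [/\ GRing.comm y alive, GRing.comm y at_start, GRing.comm y at_end,
      GRing.comm y at_start' & GRing.comm y at_end'] /\
  GRing.comm y forth /\ GRing.comm y back.
Proof.
move=> yt yt' yz.
have yl : GRing.comm y zl by apply: commrM => //; apply: commrM.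
have yr : GRing.comm y zr by apply: commrM => //; apply: commrM.
have yo : GRing.comm y o by apply: commrB => //; exact: commr1.
have y1 : GRing.comm y 1 by exact: commr1.
split; [split|split] => //.
- by apply: commrM => //; apply: commrM.
- by apply: commrM => //; apply: commrM.
- by apply: commrM => //; apply: commrM => //; apply: commrM => //; apply: commrB.
- by apply: commrM => //; apply: commrM => //; apply: commrM => //; apply: commrB.
- by apply: commrM => //; apply: commrM.
- by apply: commrM => //; apply: commrM.
Qed.

Lemma sum_unit_l n (F : nat -> Q) (p : nat) : (p < n)%N ->
  \sum_(r < n) (r == p :> nat)%:R *: F r = F p.
Proof.
move=> pn; rewrite (bigD1 (Ordinal pn))//= eqxx scale1r big1 ?addr0// => i.
by rewrite -val_eqE /= => /negPf ->; rewrite scale0r.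
Qed.

Lemma loc1_diag (x : Q) (c : nat -> nat -> bool) :
  (forall n p q, (p < n)%N -> (q < n)%N -> x * unt n p q = (c n p)%:R *: unt n p q) ->
  (forall n p q, (p < n)%N -> (q < n)%N -> unt n p q * x = (c n q)%:R *: unt n p q) ->
  loc1 x (fun n r p => ((r == p) && c n p)%:R).
Proof.
move=> xl xr n p q pn qn; rewrite xl// xr//; split.
  under eq_bigr do rewrite -mulnb natrM -scalerA.
  by rewrite (sum_unit_l (fun r => (c n p)%:R *: unt n r q)).
under eq_bigr => r _.
  rewrite eq_sym (_ : _ && _ = (val r == q) && c n q); last by case: eqP => // <-.
  rewrite -mulnb natrM -scalerA; over.
by rewrite (sum_unit_l (fun r => (c n q)%:R *: unt n p r)).
Qed.

Lemma loc1_alive : loc1 alive (fun n r p => (r == p)%:R).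
Proof.
move=> n p q pn qn; rewrite o_unt// unt_o// (sum_unit_l (fun r => unt n r q))//; split => //.
under eq_bigr do rewrite eq_sym.
by rewrite (sum_unit_l (fun r => unt n p r)).
Qed.

Lemma loc1_cut (x : Q) (c : nat -> nat -> bool) :
  (forall n p q, (p < n)%N -> (q < n)%N -> x * unt n p q = (c n p)%:R *: unt n p q) ->
  (forall n p q, (p < n)%N -> (q < n)%N -> unt n p q * x = (c n q)%:R *: unt n p q) ->
  loc1 (o * (x * o)) (fun n r p => ((r == p) && c n p)%:R).
Proof.
move=> xl xr; apply: loc1_diag => n p q pn qn.
  by rewrite -!mulrA o_unt// xl// -scalerAr o_unt.
by rewrite !mulrA unt_o// xr// -scalerAl unt_o.
Qed.

Lemma loc1_start : loc1 at_start (fun n r p => ((r == p) && (p == 0))%N%:R).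
Proof. by apply: (loc1_cut (c := fun n p => p == 0%N)) =>
  n p q pn qn; [exact: zl_unt|exact: unt_zl]. Qed.

Lemma loc1_end : loc1 at_end (fun n r p => ((r == p) && (p.+1 == n))%N%:R).
Proof. by apply: (loc1_cut (c := fun n p => p.+1 == n)) =>
  n p q pn qn; [exact: zr_unt|exact: unt_zr]. Qed.

Let mul3l (x y w u : Q) : x * y * w * u = x * (y * (w * u)).
Proof. by rewrite !mulrA. Qed.

Let mul3r (x y w u : Q) : u * (x * y * w) = u * x * y * w.
Proof. by rewrite !mulrA. Qed.

Lemma loc1_start' :
  loc1 at_start' (fun n r p => ((r == p) && ((p == 0) && (p.+1 != n)))%N%:R).
Proof.
apply: (loc1_cut (c := fun n p => (p == 0%N) && (p.+1 != n))) => n p q pn qn.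
  rewrite -[LHS]mulrA zl_unt// -scalerAr mulrBl mul1r zr_unt//.
  by do 2!case: eqP => ? /=; rewrite ?scale1r ?scale0r ?subrr ?subr0 ?scaler0.
rewrite [LHS]mulrA (mulrBr _ 1 zr) mulr1 unt_zr// mulrBl -scalerAl unt_zl//.
by do 2!case: eqP => ? /=; rewrite ?scale1r ?scale0r ?subrr ?subr0 ?scaler0.
Qed.

Lemma loc1_end' :
  loc1 at_end' (fun n r p => ((r == p) && ((p.+1 == n) && (p != 0)))%N%:R).
Proof.
apply: (loc1_cut (c := fun n p => (p.+1 == n) && (p != 0%N))) => n p q pn qn.
  rewrite -[LHS]mulrA zr_unt// -scalerAr mulrBl mul1r zl_unt//.
  by do 2!case: eqP => ? /=; rewrite ?scale1r ?scale0r ?subrr ?subr0 ?scaler0.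
rewrite [LHS]mulrA (mulrBr _ 1 zl) mulr1 unt_zl// mulrBl -scalerAl unt_zr//.
by do 2!case: eqP => ? /=; rewrite ?scale1r ?scale0r ?subrr ?subr0 ?scaler0.
Qed.

Lemma sum_unit0 n (F : 'I_n -> Q) (c : 'I_n -> bool) :
  (forall r, ~~ c r) -> \sum_(r < n) (c r)%:R *: F r = 0.
Proof. by move=> c0; rewrite big1// => r _; rewrite (negPf (c0 r)) scale0r. Qed.

Lemma loc1_forth : loc1 forth (fun n r p => (r == p.+1)%:R).
Proof.
move=> n p q pn qn; rewrite /forth; split.
  rewrite mul3l o_unt// t_unt; have [pn'|pn'] := ltnP p.+1 n.
    by rewrite o_unt// (sum_unit_l (fun r => unt n r q)).
  have <- : p.+1 = n by lia.
  by rewrite o_untn sum_unit0// => r; rewrite ltn_eqF.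
rewrite mul3r unt_o//; case: q qn => [|q] qn.
  by rewrite unt_t_o sum_unit0.
rewrite unt_t unt_o ?(ltnW qn)//.
under eq_bigr do rewrite eqSS eq_sym.
by rewrite (sum_unit_l (fun r => unt n p r))// ltnW.
Qed.

Lemma loc1_back : loc1 back (fun n r p => (r.+1 == p)%:R).
Proof.
move=> n p q pn qn; rewrite /back; split.
  rewrite mul3l o_unt//; case: p pn => [|p] pn.
    by rewrite o_t'_unt sum_unit0.
  rewrite t'_unt o_unt ?(ltnW pn)//.
  by under eq_bigr do rewrite eqSS; rewrite (sum_unit_l (fun r => unt n r q))// ltnW.
rewrite mul3r unt_o// unt_t'; have [qn'|qn'] := ltnP q.+1 n.
  by rewrite unt_o//; under eq_bigr do rewrite eq_sym; rewrite (sum_unit_l (fun r => unt n p r)).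
have <- : q.+1 = n by lia.
by rewrite untn_o sum_unit0// => r; rewrite gtn_eqF.
Qed.

Lemma alive_id : alive * alive = alive.
Proof. by rewrite /alive /o mulrBl mul1r mulrBr mulr1 zid subrr subr0. Qed.

Lemma alive_gens :
  [/\ alive * at_start = at_start, alive * at_end = at_end,
      alive * at_start' = at_start' & alive * at_end' = at_end'] /\
  alive * forth = forth /\ alive * back = back.
Proof.
have oo x : alive * (o * x) = o * x by rewrite mulrA alive_id.
by split; [split|split]; rewrite ?oo// !mulrA [alive * _]alive_id.
Qed.

Lemma alive_unt n p q : (p < n)%N -> alive * unt n p q = unt n p q.
Proof. exact: o_unt. Qed.
Lemma unt_alive n p q : (q < n)%N -> unt n p q * alive = unt n p q.
Proof. exact: unt_o. Qed.

End Tape.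

(** * Three commuting tapes *)

Definition box (n : nat * nat * nat) : finType :=
  ('I_n.1.1 * 'I_n.1.2 * 'I_n.2)%type.

Section ThreeTapes.
Variables (Q : algType rat) (t t' z : 'I_3 -> Q).

Local Notation e i := (unt (t i) (t' i) (z i)).

(** A double commutant condition in place of membership in the subalgebra generated by tape [i]: it
    passes to products and sums by the commutation lemmas, and it makes elements of different tapes
    commute. *)
Definition tape_elt i (x : Q) := forall y, GRing.comm y (t i) ->
  GRing.comm y (t' i) -> GRing.comm y (z i) -> GRing.comm y x.

Definition i0 : 'I_3 := inord 0.
Definition i1 : 'I_3 := inord 1.
Definition i2 : 'I_3 := inord 2.

Lemma i01 : i0 != i1. Proof. by rewrite -val_eqE /= !inordK. Qed.
Lemma i02 : i0 != i2. Proof. by rewrite -val_eqE /= !inordK. Qed.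
Lemma i12 : i1 != i2. Proof. by rewrite -val_eqE /= !inordK. Qed.

Definition Unt n (p q : box n) : Q :=
  e i0 n.1.1 p.1.1 q.1.1 * e i1 n.1.2 p.1.2 q.1.2 * e i2 n.2 p.2 q.2.

Definition loc (x : Q) (M : forall n, box n -> box n -> rat) :=
  forall n (p q : box n),
    x * Unt p q = \sum_r M n r p *: Unt r q /\
    Unt p q * x = \sum_r M n q r *: Unt p r.

Lemma locD x y M N : loc x M -> loc y N ->
  loc (x + y) (fun n r p => M n r p + N n r p).
Proof.
move=> Mx Ny n p q; have [xl xr] := Mx n p q; have [yl yr] := Ny n p q.
rewrite mulrDl mulrDr xl xr yl yr -!big_split; split;
  by apply: eq_bigr => r _; rewrite scalerDl.
Qed.

Lemma locN x M : loc x M -> loc (- x) (fun n r p => - M n r p).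
Proof.
move=> Mx n p q; have [xl xr] := Mx n p q; rewrite mulNr mulrN xl xr -!sumrN.
by split; apply: eq_bigr => r _; rewrite scaleNr.
Qed.

Lemma loc0 : loc 0 (fun _ _ _ => 0).
Proof.
by move=> n p q; rewrite mul0r mulr0 !big1// => r _; rewrite scale0r.
Qed.

Hypothesis tt' : forall i, t i * t' i = 1.
Hypothesis t't : forall i, t' i * t i = 1.
Hypothesis zid : forall i, z i * z i = z i.
Hypothesis zatC : forall i j k, zat (t i) (t' i) (z i) j * zat (t i) (t' i) (z i) k =
  zat (t i) (t' i) (z i) k * zat (t i) (t' i) (z i) j.
Hypothesis ctt : forall i j, i != j -> GRing.comm (t i) (t j).
Hypothesis ctz : forall i j, i != j -> GRing.comm (t i) (z j).
Hypothesis czz : forall i j, i != j -> GRing.comm (z i) (z j).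

Lemma comm_t' y i : GRing.comm y (t i) -> GRing.comm y (t' i).
Proof.
move=> yt; rewrite /GRing.comm -[LHS]mul1r -(t't i) -mulrA (mulrA (t i)) -yt.
by rewrite -(mulrA y) tt' mulr1.
Qed.

Lemma tape_comm i j x y : i != j -> tape_elt i x -> tape_elt j y -> GRing.comm x y.
Proof.
move=> ij xi yj; have ji : j != i by rewrite eq_sym.
have comm_x w : GRing.comm w (t i) -> GRing.comm w (z i) -> GRing.comm x w.
  by move=> wt wz; apply/commr_sym/xi => //; exact: comm_t'.
by apply: yj; [|apply: comm_t'|]; apply: comm_x; try exact: ctt;
  try exact: ctz; try exact: czz; exact/commr_sym/ctz.
Qed.

Lemma tape_unt i n p q : tape_elt i (e i n p q).
Proof. by move=> y yt yt' yz; exact: comm_unt. Qed.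

Lemma tape_gens i :
  [/\ tape_elt i (alive (z i)), tape_elt i (at_start (t i) (t' i) (z i)),
      tape_elt i (at_end (t i) (t' i) (z i)),
      tape_elt i (at_start' (t i) (t' i) (z i)) &
      tape_elt i (at_end' (t i) (t' i) (z i))] /\
  tape_elt i (forth (t i) (z i)) /\ tape_elt i (back (t' i) (z i)).
Proof.
by split; [split|split] => y yt yt' yz; have [[]] := comm_gens yt yt' yz => ? ? ? ? ? [].
Qed.

Lemma mul3_comm (x0 x1 x2 y0 y1 y2 : Q) : GRing.comm x1 y0 -> GRing.comm x2 y0 ->
  GRing.comm x2 y1 -> x0 * x1 * x2 * (y0 * y1 * y2) = (x0 * y0) * (x1 * y1) * (x2 * y2).
Proof.
move=> c10 c20 c21; rewrite -!mulrA (mulrA x2 y0) c20 -(mulrA y0).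
by rewrite (mulrA x1 y0) c10 -!mulrA (mulrA x2 y1) c21 -!mulrA.
Qed.

Lemma tape_mul3 x0 x1 x2 y0 y1 y2 : tape_elt i1 x1 -> tape_elt i2 x2 ->
  tape_elt i0 y0 -> tape_elt i1 y1 ->
  x0 * x1 * x2 * (y0 * y1 * y2) = (x0 * y0) * (x1 * y1) * (x2 * y2).
Proof.
move=> x1T x2T y0T y1T; apply: mul3_comm.
- by apply: tape_comm x1T y0T; rewrite eq_sym i01.
- by apply: tape_comm x2T y0T; rewrite eq_sym i02.
- by apply: tape_comm x2T y1T; rewrite eq_sym i12.
Qed.

Lemma UntM n (p q r s : box n) : Unt p q * Unt r s = (q == r)%:R *: Unt p s.
Proof.
rewrite tape_mul3; try exact: tape_unt.
rewrite !untM//; try by [exact: ltn_ord].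
rewrite !eqxx /= -!scalerAr -!scalerAl !scalerA -!natrM !mulnb.
rewrite /Unt; congr (_%:R *: _); case: q r => [[q0 q1] q2] [[r0 r1] r2].
by rewrite !xpair_eqE -!val_eqE /=; do 3!case: (_ == _ :> nat).
Qed.

Lemma UntM_neq n m (p q : box n) (r s : box m) : n != m -> Unt p q * Unt r s = 0.
Proof.
move=> nm; rewrite tape_mul3; try exact: tape_unt.
rewrite !untM//; try by [exact: ltn_ord].
rewrite -!scalerAr -!scalerAl !scalerA -!natrM !mulnb.
move: nm; rewrite -[n == m]/((_ && _) && _).
rewrite !negb_and => /orP[/orP[]|] /negPf nm; rewrite nm ?andbF/= ?scale0r//.
Qed.

Lemma loc_mono x0 x1 x2 M0 M1 M2 :
  tape_elt i0 x0 -> tape_elt i1 x1 -> tape_elt i2 x2 ->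
  loc1 (t i0) (t' i0) (z i0) x0 M0 -> loc1 (t i1) (t' i1) (z i1) x1 M1 ->
  loc1 (t i2) (t' i2) (z i2) x2 M2 ->
  loc (x0 * x1 * x2) (fun n r p => M0 n.1.1 r.1.1 p.1.1 * M1 n.1.2 r.1.2 p.1.2 *
                                   M2 n.2 r.2 p.2).
Proof.
move=> x0T x1T x2T L0 L1 L2 n p q.
have [l0 r0] := L0 n.1.1 p.1.1 q.1.1 (ltn_ord _) (ltn_ord _).
have [l1 r1] := L1 n.1.2 p.1.2 q.1.2 (ltn_ord _) (ltn_ord _).
have [l2 r2] := L2 n.2 p.2 q.2 (ltn_ord _) (ltn_ord _).
split.
  rewrite tape_mul3//; try exact: tape_unt.
  rewrite l0 l1 l2 big_distrlr pair_big/= big_distrlr pair_big/=; apply: eq_bigr => i _.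
  by rewrite -!scalerAr -!scalerAl !scalerA /Unt; congr (_ *: _); ring.
rewrite tape_mul3//; try exact: tape_unt.
rewrite r0 r1 r2 big_distrlr pair_big/= big_distrlr pair_big/=; apply: eq_bigr => i _.
by rewrite -!scalerAr -!scalerAl !scalerA /Unt; congr (_ *: _); ring.
Qed.

Definition blockmx n a b (u : 'I_a * box n -> 'I_b * box n -> rat) : 'M[Q]_(a, b) :=
  \matrix_(i, j) \sum_p \sum_q u (i, p) (j, q) *: Unt p q.

(** On the units of one box the operator acts as a finite rational matrix, so rational identities
    between such matrices lift to the group algebra. *)
Lemma mul_blockmx n a b c (A : 'M[Q]_(a, b)) (M : 'I_a -> 'I_b -> forall n, box n -> box n -> rat)
    (u : 'I_b * box n -> 'I_c * box n -> rat) : (forall i j, loc (A i j) (M i j)) ->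
  A *m blockmx u = blockmx (fun i k => \sum_j M i.1 j.1 n i.2 j.2 * u j k).
Proof.
move=> AM; apply/matrixP => i k; rewrite !mxE.
under eq_bigr => j _.
  rewrite mxE mulr_sumr; under eq_bigr => p _.
    rewrite mulr_sumr; under eq_bigr => q _.
      rewrite -scalerAr (AM i j n p q).1 scaler_sumr; over.
    rewrite exchange_big; over.
  rewrite exchange_big/=; over.
rewrite exchange_big/=; apply: eq_bigr => r _.
under eq_bigr do rewrite exchange_big/=.
rewrite exchange_big/=; apply: eq_bigr => q _.
rewrite scaler_suml pair_big/=; apply: eq_bigr => -[j p] _ /=.
by rewrite scalerA mulrC.
Qed.

Lemma blockmx_mul n a b c (A : 'M[Q]_(b, c)) (M : 'I_b -> 'I_c -> forall n, box n -> box n -> rat)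
    (u : 'I_a * box n -> 'I_b * box n -> rat) : (forall i j, loc (A i j) (M i j)) ->
  blockmx u *m A = blockmx (fun i k => \sum_j u i j * M j.1 k.1 n j.2 k.2).
Proof.
move=> AM; apply/matrixP => i k; rewrite !mxE.
under eq_bigr => j _.
  rewrite mxE mulr_suml; under eq_bigr => p _.
    rewrite mulr_suml; under eq_bigr => q _.
      rewrite -scalerAl (AM j k n p q).2 scaler_sumr; over.
    rewrite exchange_big; over.
  over.
rewrite exchange_big/=; apply: eq_bigr => p _.
rewrite exchange_big/=; apply: eq_bigr => q _.
rewrite scaler_suml pair_big/=; apply: eq_bigr => -[j r] _ /=.
by rewrite scalerA.
Qed.

Lemma blockmxD n a b (u w : 'I_a * box n -> 'I_b * box n -> rat) :
  blockmx u + blockmx w = blockmx (fun i j => u i j + w i j).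
Proof.
apply/matrixP => i j; rewrite !mxE -big_split; apply: eq_bigr => p _.
by rewrite -big_split; apply: eq_bigr => q _; rewrite scalerDl.
Qed.

Lemma eq_blockmx n a b (u w : 'I_a * box n -> 'I_b * box n -> rat) :
  (forall i j, u i j = w i j) -> blockmx u = blockmx w.
Proof.
move=> uw; apply/matrixP => i j; rewrite !mxE; apply: eq_bigr => p _.
by apply: eq_bigr => q _; rewrite uw.
Qed.

(** The projection on the event that the three heads stand on marks of runs of lengths [n]. *)
Definition box_one n : Q := \sum_p Unt (p : box n) p.

Lemma blockmx1 n a : blockmx (fun i j : 'I_a * box n => (i == j)%:R) = (box_one n)%:M.
Proof.
apply/matrixP => i j; rewrite !mxE.
under eq_bigr => p _.
  rewrite (bigD1 p)//= big1 ?addr0; last first.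
    by move=> q qp; rewrite xpair_eqE (eq_sym p) (negPf qp) andbF scale0r.
  rewrite xpair_eqE eqxx andbT; over.
by case: eqP => _; rewrite ?mulr1n ?mulr0n -scaler_sumr ?scale1r ?scale0r.
Qed.

Lemma blockmx0 n a b : blockmx (fun (i : 'I_a * box n) (j : 'I_b * box n) => 0) = 0.
Proof.
apply/matrixP => i j; rewrite !mxE big1// => p _.
by rewrite big1// => q _; rewrite scale0r.
Qed.

End ThreeTapes.

(** * The walk in a box *)

Section Walk.
Variables n0 n1 n2 : nat.
Let n := (n0, n1, n2).
Hypotheses (n0_gt0 : (0 < n0)%N) (n1_gt0 : (0 < n1)%N) (n2_gt0 : (0 < n2)%N).

(** The bound [1 < n0] reflects the primed end tests, which fail on a first run of length one. *)
Definition accepts := (n0 == n1) && (1 < n0)%N && (n2 == n0 * n0)%N.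

(* The sweep is at [(a, b)] at time [c]: rows are visited from [b = n1 - 1] down to
   [b = 0], the first one from [a = n0 - 1] down to [a = 0], then alternately. *)
Definition on_left a b c := [&& a < n0, b < n1, (c + a + 1 == (n1 - b) * n0)%N
  & ~~ odd (n1 - b.+1)]%N.
Definition on_right a b c := [&& a < n0, b < n1, (c == (n1 - b.+1) * n0 + a)%N
  & odd (n1 - b.+1)]%N.

Lemma on_left0 a b : on_left a b 0 = (a.+1 == n0) && (b.+1 == n1).
Proof.
rewrite /on_left; have [bn|bn] := ltnP b n1; last first.
  by rewrite andbF; apply/esym/negbTE; lia.
have -> : ((n1 - b) * n0 = (n1 - b.+1) * n0 + n0)%N by rewrite -mulSnr; congr muln; lia.
case E: (n1 - b.+1)%N => [|k]; first by rewrite mul0n /=; lia.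
by rewrite mulSn; lia.
Qed.

Lemma on_right0 a b : on_right a b 0 = false.
Proof.
rewrite /on_right; case: (n1 - b.+1)%N => [|k]; first by rewrite !andbF.
by rewrite mulSn; lia.
Qed.

(** A cell of a leftward row is entered from its right neighbour or, at the right end, from the row
    above, which was swept rightwards. The two cases exclude each other, so the indicators add
    up. *)
Lemma on_leftS a b c : (a < n0)%N -> (b < n1)%N ->
  (on_left a b c.+1)%:R = (on_left a.+1 b c)%:R + ((a.+1 == n0) && on_right a b.+1 c)%:R :> rat.
Proof.
move=> an bn; rewrite /on_left /on_right an bn /=.
have [an'|an'] := ltnP a.+1 n0.
  by rewrite (ltn_eqF an') /= addr0 (addSnnS c a).
have -> : a.+1 == n0 by lia.
rewrite add0r /=; congr ((nat_of_bool _)%:R).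
have [bn'|bn'] := ltnP b.+1 n1; last first.
  have -> : (n1 - b = 1)%N by lia.
  by rewrite mul1n /=; apply/negbTE; lia.
have -> : ((n1 - b) * n0 = (n1 - b.+2) * n0 + n0 + n0)%N by rewrite -!mulSnr; congr muln; lia.
have -> : (n1 - b.+1 = (n1 - b.+2).+1)%N by lia.
by rewrite oddS negbK /=; congr (_ && _); lia.
Qed.

Lemma on_rightS a b c : (a < n0)%N -> (b < n1)%N ->
  (on_right a b c.+1)%:R = ((0 < a)%N && on_right a.-1 b c)%:R +
     ((a == 0%N) && on_left 0 b.+1 c)%:R :> rat.
Proof.
move=> an bn; rewrite /on_left /on_right an bn n0_gt0 /=.
case: a an => [|a] an /=.
  rewrite add0r addn0; congr ((nat_of_bool _)%:R).
  have [bn'|bn'] := ltnP b.+1 n1; last first.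
    by have -> : (n1 - b.+1 = 0)%N by lia.
  have -> : (n1 - b.+1 = (n1 - b.+2).+1)%N by lia.
  by rewrite oddS /=; congr (_ && _); lia.
by rewrite addr0 (ltnW an) /=; congr ((nat_of_bool (_ && _))%:R); lia.
Qed.

(** The sweep of a square base reaches its last cell at time [n0 * n0 - 1]; the last row is swept
    leftwards when the number of rows is odd and, as in [on_right_end], rightwards when it is
    even. *)
Lemma on_left_end c : (c < n2)%N ->
  n0 = n1 -> (0 < n1)%N -> on_left 0 0 c = (c.+1 == n0 * n0)%N && odd n0.
Proof.
move=> cn E _; rewrite /on_left -E n0_gt0 subn0 addn0 addn1 /=.
by congr (_ && _); lia.
Qed.

Lemma on_right_end c : (c < n2)%N ->
  n0 = n1 -> on_right n0.-1 0 c = (c.+1 == n0 * n0)%N && ~~ odd n0.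
Proof.
move=> cn E; rewrite /on_right -E n0_gt0 (_ : (n0.-1 < n0)%N) /=; last by lia.
have sq : (n0 <= n0 * n0)%N by rewrite leq_pmulr.
have -> : ((n0 - 1) * n0 + n0.-1 = (n0 * n0).-1)%N by rewrite mulnBl; lia.
by congr (_ && _); lia.
Qed.

(* The three states of the walk: [0] runs along the diagonal of the base, [1] and
   [2] sweep the rows leftwards and rightwards. *)
Definition walk (s a b c : nat) : rat :=
  match s with
  | 0 => ((a == b) && (c == 0%N))%:R
  | 1 => ((n0 == n1) && on_left a b c)%:R
  | _ => ((n0 == n1) && on_right a b c)%:R
  end.

Section Ext.
Variable f : 'I_3 * box n -> rat.

(** Extension by zero to all natural coordinates: predecessors outside the box then need no separate
    equations. *)
Definition ext (s a b c : nat) : rat := \sum_(p : box n)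
  ((p.1.1 == a :> nat) && (p.1.2 == b :> nat) && (p.2 == c :> nat))%:R * f (inord s, p).

Lemma ext_in (s : 'I_3) (p : box n) : ext s p.1.1 p.1.2 p.2 = f (s, p).
Proof.
rewrite /ext (bigD1 p)//= !eqxx mul1r inord_val big1 ?addr0// => q.
case: p q => [[p0 p1] p2] [[q0 q1] q2]; rewrite !xpair_eqE /= !val_eqE.
by move=> /negPf ->; rewrite mul0r.
Qed.

Lemma ext_out s a b c : ~~ [&& a < n0, b < n1 & c < n2]%N -> ext s a b c = 0.
Proof.
move=> abc; rewrite /ext big1// => -[[p0 p1] p2] _ /=.
case: andP => [[/andP[/eqP pa /eqP pb] /eqP pc]|]; last by rewrite mul0r.
by rewrite -pa -pb -pc !ltn_ord in abc.
Qed.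

Definition extg (s : nat) (o0 o1 o2 : option nat) : rat :=
  if o0 is Some a then if o1 is Some b then if o2 is Some c then ext s a b c
  else 0 else 0 else 0.

Lemma sum_ext (s : 'I_3) (o0 o1 o2 : option nat) :
  \sum_(p : box n) ((o0 == Some (p.1.1 : nat))%:R * (o1 == Some (p.1.2 : nat))%:R *
     (o2 == Some (p.2 : nat))%:R) * f (s, p) = extg s o0 o1 o2.
Proof.
rewrite /extg; case: o0 => [a|]; last by rewrite big1// => p _; rewrite !mul0r.
case: o1 => [b|]; last by rewrite big1// => p _; rewrite mulr0 !mul0r.
case: o2 => [c|]; last by rewrite big1// => p _; rewrite mulr0 !mul0r.
rewrite /ext inord_val; apply: eq_bigr => -[[p0 p1] p2] _ /=; congr (_ * _).
rewrite -!natrM !mulnb !(inj_eq Some_inj).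
by rewrite (eq_sym a) (eq_sym b) (eq_sym c).
Qed.

End Ext.

Definition walk_eqs (F : nat -> nat -> nat -> nat -> rat) :=
  forall a b c, (a < n0)%N -> (b < n1)%N -> (c < n2)%N ->
  [/\ F 0%N a b c = (if (a == 0) && (b == 0) && (c == 0) then F 0 a b c else 0%R)%N +
        (if (0 < a) && (0 < b) && (c == 0) then F 0 a.-1 b.-1 c else 0%R)%N,
      F 1%N a b c =
        (if (a.+1 == n0) && (b.+1 == n1) && (c == 0) then F 0 a b c else 0%R)%N
        + (if 0 < c then F 1 a.+1 b c.-1 else 0%R)%N
        + (if (a.+1 == n0) && (0 < c) then F 2 a b.+1 c.-1 else 0%R)%N,
      F 2%N a b c = (if (0 < a) && (0 < c) then F 2 a.-1 b c.-1 else 0%R)%N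
        + (if (a == 0) && (0 < c) then F 1 a b.+1 c.-1 else 0%R)%N
    & (if [&& a == 0, a.+1 != n0, b == 0 & c.+1 == n2] then F 1 a b c else 0%R)%N
      + (if [&& a.+1 == n0, a != 0, b == 0 & c.+1 == n2] then F 2 a b c else 0%R)%N
      = 0].

(** Every amplitude is determined by those of its predecessors: the diagonal run by induction along
    the diagonal, the sweep by induction on time. In an accepted box the fourth equation, read at
    the last cell of the sweep, is the vanishing of the start amplitude. *)
Lemma walk_eqs_sol F : (forall s a b c, ~~ [&& a < n0, b < n1 & c < n2]%N -> F s a b c = 0) ->
  walk_eqs F ->
  (accepts -> F 0%N 0%N 0%N 0%N = 0) /\
  forall s a b c, (s < 3)%N -> (a < n0)%N -> (b < n1)%N -> (c < n2)%N ->
    F s a b c = F 0%N 0%N 0%N 0%N * walk s a b c.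
Proof.
move=> F0 FE; pose C := F 0%N 0%N 0%N 0%N.
have D a b c : (a < n0)%N -> (b < n1)%N -> (c < n2)%N -> F 0%N a b c = C * walk 0 a b c.
  rewrite /walk; case: c => [|c] an bn cn; last first.
    by have [-> _ _ _] := FE a b c.+1 an bn cn; rewrite !andbF addr0 mulr0.
  elim: a b an bn => [|a IH] [|b] an bn; first by rewrite mulr1.
  - by have [-> _ _ _] := FE 0%N b.+1 0%N an bn cn; rewrite /= addr0 mulr0.
  - by have [-> _ _ _] := FE a.+1 0%N 0%N an bn cn; rewrite /= addr0 mulr0.
  - by have [-> _ _ _] := FE a.+1 b.+1 0%N an bn cn; rewrite /= add0r IH// ltnW.
(* At time 0 the sweep only receives amplitude from the diagonal run in the corner
   [(n0 - 1, n1 - 1)], which lies on the diagonal exactly when [n0 = n1]. *)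
have LR c : (c < n2)%N -> forall a b, (a < n0)%N -> (b < n1)%N ->
    F 1%N a b c = C * walk 1 a b c /\ F 2%N a b c = C * walk 2 a b c.
  elim: c => [|c IH] cn a b an bn.
    have [_ -> -> _] := FE a b 0%N an bn cn; rewrite !andbF !addr0 andbT.
    rewrite /walk on_left0 on_right0 andbF mulr0; split => //.
    have [/andP[/eqP aE /eqP bE]|] := ifPn; last by rewrite andbF mulr0.
    rewrite D// /walk eqxx !andbT; congr (C * (nat_of_bool _)%:R).
    by rewrite -aE -bE eqSS.
  have cn' := ltnW cn.
  have [_ -> -> _] := FE a b c.+1 an bn cn; rewrite !andbF !andbT /= !add0r.
  (* The predecessors [a.+1] and [b.+1] may lie outside the box, where both sides are zero; the
     induction hypothesis is extended to them. *)
  have F1 a' b' : F 1%N a' b' c = C * walk 1 a' b' c.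
    have [/andP[an' bn']|abn'] := boolP ((a' < n0) && (b' < n1))%N.
      by have [] := IH cn' a' b' an' bn'.
    rewrite F0; last by rewrite andbA (negPf abn').
    by rewrite /walk /on_left (andbA (a' < n0)%N) (negPf abn') andbF mulr0.
  have F2 a' b' : F 2%N a' b' c = C * walk 2 a' b' c.
    have [/andP[an' bn']|abn'] := boolP ((a' < n0) && (b' < n1))%N.
      by have [] := IH cn' a' b' an' bn'.
    rewrite F0; last by rewrite andbA (negPf abn').
    by rewrite /walk /on_right (andbA (a' < n0)%N) (negPf abn') andbF mulr0.
  rewrite !F1 !F2 /walk; case: eqP => /= _; last by rewrite mulr0; do !case: ifP; rewrite ?addr0.
  rewrite on_leftS// on_rightS// !mulrDr; split; congr (_ + _); case: ifP => //=; rewrite ?mulr0//.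
  by case: eqP => // ->.
have sol s a b c : (s < 3)%N -> (a < n0)%N -> (b < n1)%N -> (c < n2)%N ->
    F s a b c = F 0%N 0%N 0%N 0%N * walk s a b c.
  case: s => [|[|[|//]]] _ an bn cn; first exact: D.
    by have [] := LR c cn a b an bn.
  by have [] := LR c cn a b an bn.
split=> // /andP[/andP[/eqP n01 n0_gt1] /eqP n2E].
have n2p : (n2.-1 < n2)%N by lia.
have n0p : (n0.-1 < n0)%N by lia.
have En2 : n2.-1.+1 = (n0 * n0)%N by rewrite -n2E; lia.
(* The parity of [n0] decides at which corner, and in which state, the sweep ends, hence which of
   the two end tests is fulfilled. *)
have [oddn|oddn] := boolP (odd n0).
  have [_ _ _] := FE 0%N 0%N n2.-1 n0_gt0 n1_gt0 n2p.
  rewrite (_ : [&& _, _, _ & _] = true); last by lia.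
  rewrite (_ : [&& _, _, _ & _] = false); last by lia.
  rewrite addr0 sol// /walk on_left_end// En2 n01 -n01 oddn !eqxx mulr1.
  by [].
have [_ _ _] := FE n0.-1 0%N n2.-1 n0p n1_gt0 n2p.
rewrite (_ : [&& _, _, _ & _] = false); last by lia.
rewrite (_ : [&& _, _, _ & _] = true); last by lia.
by rewrite add0r sol// /walk on_right_end// En2 n01 -n01 oddn !eqxx mulr1.
Qed.

Lemma walk_out s a b c : ~~ [&& a < n0, b < n1 & c < n2]%N -> (c < n2)%N ->
  (0 < s)%N -> walk s a b c = 0.
Proof.
move=> abc cn; rewrite cn andbT in abc.
by case: s => [|[|s]]//= _; rewrite /on_left /on_right (andbA (a < n0)%N) (negPf abc) andbF.
Qed.

Lemma walk_walk_eqs (F : nat -> nat -> nat -> nat -> rat) : ~~ accepts ->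
  (forall s a b c, (s < 3)%N -> F s a b c = if [&& a < n0, b < n1 & c < n2]%N then walk s a b c else 0) ->
  walk_eqs F.
Proof.
move=> nacc FE a b c an bn cn.
have F0 a' b' c' : (a' < n0)%N -> (b' < n1)%N -> (c' < n2)%N -> F 0%N a' b' c' = walk 0 a' b' c'.
  by move=> an' bn' cn'; rewrite FE// an' bn' cn'.
have Fs s a' b' c' : (c' < n2)%N -> (0 < s < 3)%N -> F s a' b' c' = walk s a' b' c'.
  move=> cn' /andP[s0 s3]; rewrite FE//; case: ifPn => // abc.
  by rewrite walk_out.
split.
- rewrite F0//; case: c cn => [|c] cn; last by rewrite !andbF addr0 /= andbF.
  case: a an b bn => [|a] an [|b] bn; rewrite ?addr0 ?add0r//=.
  by rewrite F0//; exact: ltnW.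
- rewrite Fs//; case: c cn => [|c] cn.
    rewrite !andbF !addr0 andbT /walk on_left0.
    case: ifPn => [/andP[/eqP aE /eqP bE]|_]; last by rewrite andbF.
    by rewrite F0// /walk !andbT -aE -bE eqSS.
  rewrite andbF add0r andbT /= !Fs ?(ltnW cn)// /walk.
  case: eqP => /= _; last by case: ifP; rewrite addr0.
  by rewrite on_leftS//; congr (_ + _); case: ifP.
- rewrite Fs//; case: c cn => [|c] cn.
    by rewrite !andbF addr0 /walk on_right0 andbF.
  rewrite !andbT /= !Fs ?(ltnW cn)// /walk.
  case: eqP => /= _; last by do !case: ifP; rewrite addr0.
  rewrite on_rightS//; congr (_ + _); first by case: ifP.
  by case: eqP => // ->.
(* A nonzero term would need a square base of side above 1, by the primed tests, and a sweep of
   [n0 * n0] cells ending together with the third run: an accepted box. *)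
- rewrite !Fs// /walk; move: nacc; rewrite /accepts.
  case: (eqVneq n0 n1) => [n01|_] /=; last by move=> _; do !case: ifP; rewrite addr0.
  move=> nacc; case: ifPn => [/and4P[/eqP a0 an' /eqP b0 /eqP cE]|_].
    rewrite a0 b0 on_left_end//; case: ifP => [|_]; first by lia.
    have -> : (c.+1 == n0 * n0)%N = false by apply/negbTE; lia.
    by rewrite addr0.
  case: ifPn => [/and4P[/eqP aE a0 /eqP b0 /eqP cE]|_]; last by rewrite addr0.
  have -> : a = n0.-1 by lia.
  rewrite b0 on_right_end//.
  have -> : (c.+1 == n0 * n0)%N = false by apply/negbTE; lia.
  by rewrite addr0.
Qed.

End Walk.

(** * The walk equations as sums of products of head moves *)

Inductive move := Stay | Start | End | Start' | End' | Forth | Back.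

(** The cell from which cell [r] receives its amplitude, that is, the column of the nonzero entry in
    row [r] of the move. [Back] needs no guard: at the end of the run [r.+1] is no cell, and the
    extension by zero takes over. *)
Definition source (g : move) (n r : nat) : option nat :=
  match g with
  | Stay => Some r
  | Start => if r == 0%N then Some r else None
  | End => if r.+1 == n then Some r else None
  | Start' => if (r == 0%N) && (r.+1 != n) then Some r else None
  | End' => if (r.+1 == n) && (r != 0%N) then Some r else None
  | Forth => if (0 < r)%N then Some r.-1 else None
  | Back => Some r.+1
  end.

(* Rows [0], [1] and [2] express the amplitude of each state through those of its
   predecessors; in state [0] the start cell is its own predecessor, which leaves its
   amplitude free. Row [3] forces the amplitude at the end of the sweep to vanish when
   the third head is at the end of its run at the same time. *)
Definition rules (i j : nat) : seq (move * move * move) :=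
  match i, j with
  | 0, 0 => [:: (Start, Start, Start); (Forth, Forth, Start)]
  | 1, 0 => [:: (End, End, Start)]
  | 1, 1 => [:: (Back, Stay, Forth)]
  | 1, 2 => [:: (End, Back, Forth)]
  | 2, 1 => [:: (Start, Back, Forth)]
  | 2, 2 => [:: (Forth, Stay, Forth)]
  | 3, 1 => [:: (Start', Start, End)]
  | 3, 2 => [:: (End', Start, End)]
  | _, _ => [::]
  end.

Definition mono_mx (m : move * move * move) n (r p : box n) : rat :=
  (source m.1.1 n.1.1 r.1.1 == Some (p.1.1 : nat))%:R *
  (source m.1.2 n.1.2 r.1.2 == Some (p.1.2 : nat))%:R *
  (source m.2 n.2 r.2 == Some (p.2 : nat))%:R.

Definition rule_mx (i : 'I_4) (j : 'I_3) n (r p : box n) : rat :=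
  ((i == j :> nat) && (r == p))%:R - \sum_(m <- rules i j) mono_mx m r p.

Section RuleMx.
Variables n0 n1 n2 : nat.
Let n := (n0, n1, n2).
Hypotheses (n0_gt0 : (0 < n0)%N) (n1_gt0 : (0 < n1)%N) (n2_gt0 : (0 < n2)%N).

Lemma rule_mx_sum (f : 'I_3 * box n -> rat) (i : 'I_4) (r : box n) :
  \sum_j rule_mx i j.1 r j.2 * f j =
  (if (i < 3)%N then ext f i r.1.1 r.1.2 r.2 else 0) -
  \sum_(j < 3) \sum_(m <- rules i j) extg f j (source m.1.1 n0 r.1.1)
     (source m.1.2 n1 r.1.2) (source m.2 n2 r.2).
Proof.
transitivity (\sum_j \sum_p rule_mx i j r p * f (j, p)).
  by rewrite pair_bigA; apply: eq_bigr => -[].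
under eq_bigr => j _.
  under eq_bigr do rewrite mulrBl.
  rewrite big_split/= sumrN; under [X in _ - X]eq_bigr do rewrite mulr_suml.
  rewrite [X in _ - X]exchange_big/=.
  under [X in _ - X]eq_bigr do rewrite sum_ext.
  over.
rewrite big_split/= sumrN; congr (_ - _).
case: ifPn => i3; last first.
  rewrite big1// => j _; rewrite big1// => p _.
  by rewrite gtn_eqF ?mul0r// (leq_trans (ltn_ord j))// leqNgt.
rewrite (bigD1 (Ordinal i3))//= [X in _ + X]big1 ?addr0; last first.
  move=> j ji; rewrite big1// => p _; case: eqP => [ij|]; last by rewrite mul0r.
  by case/eqP: ji; apply: val_inj.
rewrite (bigD1 r)//= !eqxx mul1r [X in _ + X]big1 ?addr0; last first.
  by move=> p pr; rewrite eq_sym (negPf pr) mul0r.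
by rewrite -(ext_in f (Ordinal i3)).
Qed.

Lemma rule_mx_eqs (f : 'I_3 * box n -> rat) (r : box n) :
  let a := r.1.1 : nat in let b := r.1.2 : nat in let c := r.2 : nat in
  let F := ext f in
  let row i := \sum_j rule_mx i j.1 r j.2 * f j in
  [/\ row (inord 0) = F 0%N a b c -
        ((if (a == 0) && (b == 0) && (c == 0) then F 0 a b c else 0%R)%N +
         (if (0 < a) && (0 < b) && (c == 0) then F 0 a.-1 b.-1 c else 0%R)%N),
      row (inord 1) = F 1%N a b c -
        ((if (a.+1 == n0) && (b.+1 == n1) && (c == 0) then F 0 a b c else 0%R)%N
        + (if 0 < c then F 1 a.+1 b c.-1 else 0%R)%N
        + (if (a.+1 == n0) && (0 < c) then F 2 a b.+1 c.-1 else 0%R)%N),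
      row (inord 2) = F 2%N a b c -
        ((if (0 < a) && (0 < c) then F 2 a.-1 b c.-1 else 0%R)%N
        + (if (a == 0) && (0 < c) then F 1 a b.+1 c.-1 else 0%R)%N)
    & row (inord 3) = -
      ((if [&& a == 0, a.+1 != n0, b == 0 & c.+1 == n2] then F 1 a b c else 0%R)%N
      + (if [&& a.+1 == n0, a != 0, b == 0 & c.+1 == n2] then F 2 a b c else 0%R)%N)].
Proof.
split; rewrite rule_mx_sum inordK//= !big_ord_recl big_ord0 /= !(big_cons, big_nil)/=
  ?addr0 ?add0r; [congr (_ - _)|congr (_ - _)|congr (_ - _)|congr (- _)].
- by congr (_ + _); rewrite /extg; do !case: ifP.
- by rewrite addrA; congr (_ + _ + _); rewrite /extg; do !case: ifP.
- by rewrite addrC; congr (_ + _); rewrite /extg; do !case: ifP.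
- by congr (_ + _); rewrite /extg; do !case: eqP => //=.
Qed.

Lemma rule_mx_walk_eqs (f : 'I_3 * box n -> rat) :
  (forall (i : 'I_4) (r : box n), \sum_j rule_mx i j.1 r j.2 * f j = 0) <->
  walk_eqs n0 n1 n2 (ext f).
Proof.
split=> [f0 a b c an bn cn|fE i r].
  have [] := rule_mx_eqs f ((Ordinal an, Ordinal bn), Ordinal cn).
  rewrite !f0 /= => E0 E1 E2 E3; split.
  - by apply/eqP; rewrite -subr_eq0 -E0.
  - by apply/eqP; rewrite -subr_eq0 -E1.
  - by apply/eqP; rewrite -subr_eq0 -E2.
  - by apply/eqP; rewrite -oppr_eq0 -E3.
have [E0 E1 E2 E3] := fE _ _ _ (ltn_ord r.1.1) (ltn_ord r.1.2) (ltn_ord r.2).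
have [] := rule_mx_eqs f r; rewrite -E0 -E1 -E2 E3 !subrr oppr0.
rewrite -(inord_val i); case: i => -[|[|[|[|//]]]] ? //=.
Qed.

(** The kernel of the rule matrix is spanned by the walk, or by zero in an accepted box, so
    [kernel_split] applies and the trace counts the dimension. *)
Lemma walk_split :
  exists (u : 'I_3 * box n -> 'I_3 * box n -> rat)
    (w : 'I_3 * box n -> 'I_4 * box n -> rat),
    [/\ forall (i : 'I_4 * box n) k, \sum_j rule_mx i.1 j.1 i.2 j.2 * u j k = 0,
        forall j k, u j k = u k j,
        forall j k, u j k + \sum_i w j i * rule_mx i.1 k.1 i.2 k.2 = (j == k)%:R
      & \sum_j u j j = (~~ accepts n0 n1 n2)%:R].
Proof.
pose v (j : 'I_3 * box n) := if accepts n0 n1 n2 then 0 else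
  walk n0 n1 j.1 j.2.1.1 j.2.1.2 j.2.2.
have v_ext s a b c : (s < 3)%N -> ext v s a b c =
    if [&& a < n0, b < n1 & c < n2]%N then
      if accepts n0 n1 n2 then 0 else walk n0 n1 s a b c else 0.
  move=> s3; case: ifPn => [/and3P[an bn cn]|abc]; last exact: ext_out.
  by have /= := ext_in v (Ordinal s3) ((Ordinal an, Ordinal bn), Ordinal cn).
have vA (i : 'I_4 * box n) : \sum_j rule_mx i.1 j.1 i.2 j.2 * v j = 0.
  have [acc|nacc] := boolP (accepts n0 n1 n2).
    by rewrite big1// => j _; rewrite /v acc mulr0.
  apply: (rule_mx_walk_eqs v).2; apply: walk_walk_eqs => // s a b c s3.
  by rewrite v_ext// (negPf nacc).
have kerA (f : 'I_3 * box n -> rat) :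
    (forall i : 'I_4 * box n, \sum_j rule_mx i.1 j.1 i.2 j.2 * f j = 0) ->
    exists c, forall j, f j = c * v j.
  move=> fA; have /walk_eqs_sol : walk_eqs n0 n1 n2 (ext f).
    by apply/rule_mx_walk_eqs => i r; exact: (fA (i, r)).
  move=> /(_ n0_gt0 n1_gt0 n2_gt0 (@ext_out _ _ _ f)) [acc0 fE].
  exists (ext f 0%N 0%N 0%N 0%N) => -[s p].
  rewrite -(ext_in f) fE// /v /=.
  by case: ifP => // acc; rewrite acc0// mul0r.
have [u [w [Au us uw tru]]] := kernel_split vA kerA.
exists u, w; split => //; rewrite tru; congr ((nat_of_bool _)%:R).
apply/existsP/idP => [[j]|nacc]; first by rewrite /v; case: ifP; rewrite ?eqxx.
(* The walk has amplitude 1 at its start cell. *)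
exists (ord0, ((Ordinal n0_gt0, Ordinal n1_gt0), Ordinal n2_gt0)).
by rewrite /v (negPf nacc).
Qed.

End RuleMx.

(** * The group algebra *)

Section GroupAlgebra.
Variable G : groupType.
Implicit Types (f h : QG G) (g : G) (c : rat).

Definition qg_scale c f : QG G := [fsfun x in finsupp f => c * f x].

Lemma qg_scaleE c f x : qg_scale c f x = c * f x.
Proof. by rewrite fsfunE; case: finsuppP => // _; rewrite mulr0. Qed.

Lemma qg_scaleA c1 c2 f : qg_scale c1 (qg_scale c2 f) = qg_scale (c1 * c2) f.
Proof. by apply/fsfunP => x; rewrite !qg_scaleE mulrA. Qed.

Lemma qg_scale1 : left_id 1 qg_scale.
Proof. by move=> f; apply/fsfunP => x; rewrite qg_scaleE mul1r. Qed.

Lemma qg_scaleDr : right_distributive qg_scale +%R.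
Proof. by move=> c f h; apply/fsfunP => x; rewrite !(qg_scaleE, qg_addE) mulrDr. Qed.

Lemma qg_scaleDl f : {morph qg_scale^~ f : c1 c2 / c1 + c2}.
Proof. by move=> c1 c2; apply/fsfunP => x; rewrite !(qg_scaleE, qg_addE) mulrDl. Qed.

HB.instance Definition _ := GRing.Zmodule_isLmodule.Build rat (QG G)
  qg_scaleA qg_scale1 qg_scaleDr qg_scaleDl.

Lemma qgDE f h x : (f + h) x = f x + h x. Proof. exact: qg_addE. Qed.
Lemma qgNE f x : (- f) x = - f x. Proof. exact: qg_oppE. Qed.
Lemma qgZE c f x : (c *: f) x = c * f x. Proof. exact: qg_scaleE. Qed.
Lemma qg1E x : (1 : QG G) x = (x == 1%g)%:R. Proof. exact: qg_oneE. Qed.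
Lemma qg0E x : (0 : QG G) x = 0. Proof. exact: fsfun0E. Qed.
Lemma qgME f h x : (f * h) x = \sum_(y <- finsupp f) f y * h (y^-1 * x)%g.
Proof. exact: qg_mulE. Qed.

Lemma qg_sumE (I : Type) (r : seq I) (P : pred I) (F : I -> QG G) x :
  (\sum_(i <- r | P i) F i) x = \sum_(i <- r | P i) F i x.
Proof.
by apply: (big_morph (fun f : QG G => f x)) => [f h|]; rewrite ?qgDE ?qg0E.
Qed.

Lemma qg_finsuppZ c f : (finsupp (c *: f) `<=` finsupp f)%fset.
Proof. exact: finsupp_sub. Qed.

Lemma qg_scaleAl c f h : c *: (f * h) = c *: f * h.
Proof.
apply/fsfunP => x; rewrite qgZE !qgME (qg_sum_incl _ (qg_finsuppZ c f)) mulr_sumr.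
by apply: eq_bigr => y _; rewrite qgZE mulrA.
Qed.

HB.instance Definition _ := GRing.Lmodule_isLalgebra.Build rat (QG G) qg_scaleAl.

Lemma qg_scaleAr c f h : c *: (f * h) = f * (c *: h).
Proof.
apply/fsfunP => x; rewrite qgZE !qgME mulr_sumr.
by apply: eq_bigr => y _; rewrite qgZE mulrCA.
Qed.

HB.instance Definition _ := GRing.Lalgebra_isAlgebra.Build rat (QG G) qg_scaleAr.

Definition delta g : QG G := [fsfun x in [fset g]%fset => 1].

Lemma deltaE g x : delta g x = (x == g)%:R.
Proof. by rewrite fsfunE inE; case: eqP. Qed.

Lemma delta1 : delta 1%g = 1.
Proof. by []. Qed.

Lemma delta_mulE g f x : (delta g * f) x = f (g^-1 * x)%g.
Proof.
have sS : (finsupp (delta g) `<=` [fset g])%fset by exact: finsupp_sub.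
by rewrite qgME (qg_sum_incl _ sS) big_seq_fset1 deltaE eqxx mul1r.
Qed.

Lemma deltaM (x y : G) : delta x * delta y = delta (x * y)%g.
Proof.
apply/fsfunP => v; rewrite delta_mulE !deltaE; congr ((nat_of_bool _)%:R).
by apply/eqP/eqP => [<-|->]; rewrite mulgA ?mulgV ?mulVg mul1g.
Qed.

Lemma qg_decomp f : f = \sum_(y <- finsupp f) f y *: delta y.
Proof.
apply/fsfunP => x; rewrite qg_sumE.
under eq_bigr do rewrite qgZE deltaE.
have [xf|xf] := boolP (x \in finsupp f).
  rewrite (big_fsetD1 x)//= eqxx mulr1 big_seq big1 ?addr0// => y.
  by rewrite !inE eq_sym => /andP[/negPf -> _]; rewrite mulr0.
rewrite fsfun_dflt// big_seq big1// => y yf.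
by case: eqP => [xy|_]; [rewrite xy yf in xf|rewrite mulr0].
Qed.

Definition tau f : rat := f 1%g.

Lemma tauD f h : tau (f + h) = tau f + tau h. Proof. exact: qgDE. Qed.
Lemma tauN f : tau (- f) = - tau f. Proof. exact: qgNE. Qed.
Lemma tauZ c f : tau (c *: f) = c * tau f. Proof. exact: qgZE. Qed.
Lemma tau_sum (I : Type) (r : seq I) (P : pred I) (F : I -> QG G) :
  tau (\sum_(i <- r | P i) F i) = \sum_(i <- r | P i) tau (F i).
Proof. exact: qg_sumE. Qed.

Lemma tau_delta_mul g f : tau (delta g * f) = f g^-1%g.
Proof. by rewrite /tau delta_mulE mulg1. Qed.

Lemma mulg_eq1 (x y : G) : (x * y == 1)%g = (x == y^-1)%g.
Proof.
by apply/eqP/eqP => [xy|->]; [rewrite -[x]mulg1 -(mulgV y) mulgA xy mul1g|rewrite mulVg].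
Qed.

Lemma tau_mul_delta g f : tau (f * delta g) = f g^-1%g.
Proof.
have := congr1 (fun F : QG G => F g^-1%g) (qg_decomp f); rewrite qg_sumE => ->.
rewrite {1}(qg_decomp f) mulr_suml tau_sum.
apply: eq_bigr => y _; rewrite -scalerAl tauZ qgZE deltaM /tau !deltaE; congr (_ * _).
by rewrite eq_sym mulg_eq1 eq_sym.
Qed.

Lemma tauC f h : tau (f * h) = tau (h * f).
Proof.
rewrite (qg_decomp f) mulr_suml mulr_sumr !tau_sum; apply: eq_bigr => y _.
by rewrite -scalerAl -scalerAr !tauZ tau_delta_mul tau_mul_delta.
Qed.

Lemma starD f h : qg_star (f + h) = qg_star f + qg_star h.
Proof. by apply/fsfunP => x; rewrite qgDE !qg_starE qgDE. Qed.

Lemma starN f : qg_star (- f) = - qg_star f.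
Proof. by apply/fsfunP => x; rewrite qgNE !qg_starE qgNE. Qed.

Lemma starZ c f : qg_star (c *: f) = c *: qg_star f.
Proof. by apply/fsfunP => x; rewrite qgZE !qg_starE qgZE. Qed.

Lemma star0 : qg_star (0 : QG G) = 0.
Proof. by apply/fsfunP => x; rewrite qg_starE !qg0E. Qed.

Lemma star_sum (I : Type) (r : seq I) (P : pred I) (F : I -> QG G) :
  qg_star (\sum_(i <- r | P i) F i) = \sum_(i <- r | P i) qg_star (F i).
Proof. by apply: (big_morph (@qg_star G)); [exact: starD|exact: star0]. Qed.

Lemma star_delta g : qg_star (delta g) = delta g^-1%g.
Proof.
apply/fsfunP => x; rewrite qg_starE !deltaE; congr ((nat_of_bool _)%:R).
by apply/eqP/eqP => [<-|->]; rewrite invgK.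
Qed.

Lemma starM f h : qg_star (f * h) = qg_star h * qg_star f.
Proof.
rewrite (qg_decomp f) mulr_suml !star_sum mulr_sumr; apply: eq_bigr => y _.
rewrite -scalerAl !starZ -scalerAr; congr (_ *: _).
rewrite (qg_decomp h) mulr_sumr !star_sum mulr_suml; apply: eq_bigr => x _.
by rewrite -scalerAr !starZ -scalerAl deltaM !star_delta deltaM invgM.
Qed.

Lemma star1 : qg_star (1 : QG G) = 1.
Proof. by rewrite -delta1 star_delta invg1. Qed.

Lemma starK : involutive (@qg_star G).
Proof. by move=> f; apply/fsfunP => x; rewrite !qg_starE invgK. Qed.

End GroupAlgebra.

(** * The group *)

Section Lamps.
Variables (G : groupType) (a t s : G).
Local Open Scope group_scope.

Definition lamp (j : nat) : G := a ^ (t ^+ j).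

Hypotheses (ts : t * s = s * t) (at1 : commute a (a ^ t)) (sas : a ^ s = a * a ^ t).

Lemma commuteJ (x y g : G) : commute x y -> commute (x ^ g) (y ^ g).
Proof. by move=> xy; rewrite /commute -!conjMg xy. Qed.

Lemma lampJ j i : lamp j ^ (t ^+ i) = lamp (j + i).
Proof. by rewrite /lamp -conjgM -expgnDr. Qed.

Lemma lamp_sJ j : lamp j ^ s = lamp j * lamp j.+1.
Proof.
have tsX : t ^+ j * s = s * t ^+ j by apply/commute_sym/commuteX/commute_sym.
by rewrite /lamp -conjgM tsX conjgM sas conjMg -conjgM -expgS.
Qed.

Lemma commute_cancel (u v w y : G) : commute v w -> commute v y -> commute u w ->
  commute (u * v) (w * y) -> commute u y.
Proof.
move=> vw vy uw; rewrite /commute -(mulgA u) (mulgA v) vw -(mulgA w) vy !mulgA uw.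
by move=> /mulIg; rewrite -!mulgA => /mulgI.
Qed.

(* Conjugating [commute a (lamp n.+1)] by [s] gives
   [commute (a * lamp 1) (lamp n.+1 * lamp n.+2)]; all other pairs commute already. *)
Lemma lamp0C j : commute a (lamp j).
Proof.
elim/ltn_ind: j => -[|[|n]] IH; first by rewrite /lamp expg0 conjg1; exact: commute_refl.
  by rewrite /lamp expg1.
have lampC' i j : (j < n.+2)%N -> commute (lamp i) (lamp (j + i)).
  move=> jn; rewrite -[lamp i]/(a ^ (t ^+ i)) -lampJ.
  by apply: commuteJ; exact: IH.
have c1n : commute (lamp 1) (lamp n.+1) by have := lampC' 1%N n; rewrite addn1; exact.
have c1n' : commute (lamp 1) (lamp n.+2) by have := lampC' 1%N n.+1; rewrite addn1; exact.
have c0n := IH n.+1 (ltnSn _).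
apply: (commute_cancel c1n c1n' c0n).
by have := commuteJ s c0n; rewrite sas lamp_sJ.
Qed.

Lemma lampC i j : commute (lamp i) (lamp j).
Proof.
wlog ij : i j / (i <= j)%N => [H|].
  by case/orP: (leq_total i j) => ij; [exact: H|apply/commute_sym/H].
rewrite -[lamp i]/(a ^ (t ^+ i)) -(subnK ij) -lampJ.
exact/commuteJ/lamp0C.
Qed.

End Lamps.

Lemma commute_of_wcomm (G : groupType) (u v : G) :
  (u^-1 * (v^-1 * (u * v)) = 1)%g -> commute u v.
Proof.
rewrite mulgA -invgM => /eqP; rewrite mulg_eq1 => /eqP/invg_inj/esym; exact.
Qed.

Section GrpGenerators.
Local Open Scope group_scope.

Definition gen_a : grp := pcls grp_rels grp_a.
Definition gen_t : grp := pcls grp_rels grp_t.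
Definition gen_s : grp := pcls grp_rels grp_s.

Lemma pclsM (u v : word 'I_3) : pcls grp_rels (u ++ v) = pcls grp_rels u * pcls grp_rels v :> grp.
Proof. exact/esym/pmul_cls. Qed.

Lemma pclsV (u : word 'I_3) : pcls grp_rels (winv u) = (pcls grp_rels u)^-1 :> grp.
Proof.
apply/eqP; rewrite -mulg_eq1; apply/eqP; rewrite -pclsM.
by apply/pclsP; exact: pres_winvl.
Qed.

Lemma pcls_rel (u v : word 'I_3) : (u, v) \in grp_rels ->
  pcls grp_rels u = pcls grp_rels v.
Proof. by move=> uv; apply/pclsP; exact: pres_rel. Qed.

Lemma gen_aa : gen_a * gen_a = 1.
Proof. by rewrite -pclsM; apply: pcls_rel; rewrite inE eqxx. Qed.

Lemma gen_ts : gen_t * gen_s = gen_s * gen_t.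
Proof.
have : pcls grp_rels (wcomm grp_t grp_s) = 1 :> grp.
  by apply: pcls_rel; rewrite !inE eqxx ?orbT.
by rewrite /wcomm !pclsM !pclsV; exact: commute_of_wcomm.
Qed.

Lemma gen_sas : gen_a ^ gen_s = gen_a * gen_a ^ gen_t.
Proof.
have : pcls grp_rels (winv grp_s ++ grp_a ++ grp_s) =
  pcls grp_rels (grp_a ++ winv grp_t ++ grp_a ++ grp_t).
  by apply: pcls_rel; rewrite !inE eqxx ?orbT.
by rewrite !pclsM !pclsV.
Qed.

Lemma gen_at1 : commute gen_a (gen_a ^ gen_t).
Proof.
have : pcls grp_rels (wcomm (winv grp_t ++ grp_a ++ grp_t) grp_a) = 1 :> grp.
  by apply: pcls_rel; rewrite !inE eqxx ?orbT.
rewrite /wcomm; do 3![rewrite pclsM]; rewrite !pclsV !pclsM !pclsV => E.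
exact/commute_sym/commute_of_wcomm.
Qed.

End GrpGenerators.

(** * An affine action that separates the lamps *)

Section WordAction.
Variables (K : fieldType) (x : K).
Hypotheses (K2 : forall y : K, y + y = 0) (x0 : x != 0) (x10 : 1 + x != 0).

(** Adding 1 is an involution in characteristic two, so both letters of [a] act alike. *)
Definition letter_act (i : 'I_3) (b : bool) (y : K) : K :=
  match val i with
  | 0 => y + 1
  | 1 => if b then x * y else y / x
  | _ => if b then (1 + x) * y else y / (1 + x)
  end.

Definition word_act (w : word 'I_3) (y : K) : K :=
  foldr (fun l y => letter_act l.1 l.2 y) y w.

Lemma word_act_cat u v y : word_act (u ++ v) y = word_act u (word_act v y).
Proof. exact: foldr_cat. Qed.

Lemma pres_eq_act u v : pres_eq grp_rels u v -> word_act u =1 word_act v.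
Proof.
elim=> {u v} [//|u v _ uv y|u v w _ uv _ vw y|u u' v v' _ uu' _ vv' y|i b y|u v].
- by rewrite uv.
- by rewrite uv vw.
- by rewrite !word_act_cat vv' uu'.
- rewrite /word_act /letter_act /=; case: i => -[|[|m]] mi /=.
  + by rewrite -addrA K2 addr0.
  + by case: b => /=; field.
  + by case: b => /=; field.
rewrite !inE => /or4P[]/eqP[-> ->] y;
  rewrite /wcomm /winv /grp_a /grp_t /grp_s /wgen /word_act /letter_act /=
    !inordK//=.
- by rewrite -addrA K2 addr0.
- by field; rewrite x0 x10.
(* The commutator of the lamps at 0 and 1 translates twice by 1 and twice by [x], which cancels in
   characteristic two. *)
- transitivity (y + (x + 1 + (x + 1))); first by field.
  by rewrite K2 addr0.
- by field; rewrite x0 x10.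
Qed.

End WordAction.

Section Action.
Local Notation K := {fraction {poly 'F_2}}.
Let x : K := tofrac 'X.

Lemma fracX_neq0 : x != 0. Proof. by rewrite tofrac_eq0 polyX_eq0. Qed.

Lemma frac1X_neq0 : 1 + x != 0.
Proof.
rewrite -tofrac1 -tofracD tofrac_eq0 addrC.
by rewrite -size_poly_eq0 -[1]opprK -polyC1 -polyCN size_XsubC.
Qed.

Lemma K2 (y : K) : y + y = 0.
Proof.
have h : (1 + 1 : K) = 0.
  rewrite -tofrac1 -tofracD -polyC1 -polyCD; apply/eqP; rewrite tofrac_eq0 polyC_eq0.
  by apply/eqP/val_inj.
by rewrite -[y]mul1r -mulrDl h mul0r.
Qed.

Definition act (g : grp) (y : K) : K := word_act x (repr g) y.

Lemma act_pcls w : act (pcls grp_rels w) =1 word_act x w.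
Proof. exact/(pres_eq_act K2 fracX_neq0 frac1X_neq0)/repr_pcls. Qed.

Lemma actM (g h : grp) y : act (g * h)%g y = act g (act h y).
Proof. by rewrite -[(g * h)%g]/(pmul g h) act_pcls word_act_cat. Qed.

Lemma act1 y : act 1%g y = y.
Proof. by rewrite -[1%g]/(pcls grp_rels [::]) act_pcls. Qed.

Lemma act_ga y : act gen_a y = y + 1.
Proof. by rewrite act_pcls /word_act /grp_a /grp_t /wgen /letter_act /= inordK. Qed.

Lemma act_gtX j y : act (gen_t ^+ j)%g y = y / x ^+ j.
Proof.
elim: j y => [|j IH] y; first by rewrite expg0 act1 divr1.
rewrite expgS actM IH act_pcls /word_act /grp_a /grp_t /wgen /letter_act /= inordK//=.
by rewrite exprSr invfM mulrA.
Qed.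

Lemma act_gtXV j y : act ((gen_t ^+ j)^-1)%g y = y * x ^+ j.
Proof.
have xj0 : x ^+ j != 0 by rewrite expf_neq0// fracX_neq0.
have := act_gtX j (y * x ^+ j); rewrite mulfK// => E.
by rewrite -{1}E -actM mulVg act1.
Qed.

Lemma act_lamp j y : act (lamp gen_a gen_t j) y = y + x ^+ j.
Proof.
have xj0 : x ^+ j != 0 by rewrite expf_neq0// fracX_neq0.
by rewrite /lamp conjgE !actM act_gtXV act_ga act_gtX mulrDl divfK// mul1r.
Qed.

(** Elements acting as translation by a polynomial of degree below [m]; they contain all products of
    the lamps at positions below [m]. *)
Definition low_shift (m : nat) (g : grp) :=
  exists2 q : {poly 'F_2}, (size q <= m)%N & forall y, act g y = y + tofrac q.

Lemma low_shift1 m : low_shift m 1%g.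
Proof. by exists 0; [rewrite size_poly0|move=> y; rewrite act1 tofrac0 addr0]. Qed.

Lemma low_shiftM m g h : low_shift m g -> low_shift m h -> low_shift m (g * h)%g.
Proof.
move=> [q qm gq] [r rm hr]; exists (q + r).
  by rewrite (leq_trans (size_polyD _ _))// geq_max qm.
by move=> y; rewrite actM gq hr tofracD -addrA (addrC (tofrac r)).
Qed.

Lemma low_shiftW m m' g : (m <= m')%N -> low_shift m g -> low_shift m' g.
Proof. by move=> mm' [q qm gq]; exists q => //; exact: leq_trans mm'. Qed.

Lemma low_shift_lamp j : low_shift j.+1 (lamp gen_a gen_t j).
Proof. by exists 'X^j => [|y]; rewrite ?size_polyXn// act_lamp tofracXn. Qed.

(** This is the independence of the lamps: at 0 the lamp [j] takes the value [X^j], whose degree is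
    too large, and polynomials embed into their fractions. *)
Lemma low_shiftN_lamp j : ~ low_shift j (lamp gen_a gen_t j).
Proof.
move=> [q qj /(_ 0)]; rewrite act_lamp !add0r -tofracXn => /eqP.
by rewrite tofrac_eq => /eqP E; rewrite -E size_polyXn ltnn in qj.
Qed.

Lemma lampV j : ((lamp gen_a gen_t j)^-1 = lamp gen_a gen_t j)%g.
Proof. by apply: mulg1_eq; rewrite /lamp -conjMg gen_aa conj1g. Qed.

End Action.

(** * Tapes in the group algebra *)

Section Tapes.
Local Notation Gam := (grp ^ 3)%type.
Local Notation Q := (QG Gam).

Definition embed (i : 'I_3) (g : grp) : Gam := [ffun j => if j == i then g else 1%g].

Lemma embedM i g h : embed i (g * h)%g = (embed i g * embed i h)%g.
Proof. by apply/ffunP => j; rewrite !ffunE; case: eqP => // _; rewrite mulg1. Qed.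

Lemma embed1 i : embed i 1%g = 1%g.
Proof. by apply/ffunP => j; rewrite !ffunE; case: eqP. Qed.

Lemma embedV i g : (embed i g^-1 = (embed i g)^-1)%g.
Proof. by apply/ffunP => j; rewrite !ffunE; case: eqP => // _; rewrite invg1. Qed.

Lemma embedC i j g h : i != j -> (embed i g * embed j h = embed j h * embed i g)%g.
Proof.
move=> ij; apply/ffunP => k; rewrite !ffunE.
case: (eqVneq k i) => [->|_]; first by rewrite (negPf ij) mulg1 mul1g.
by rewrite mul1g mulg1.
Qed.

Definition tape_t i : Q := delta (embed i gen_t).
Definition tape_t' i : Q := delta (embed i gen_t^-1)%g.
(** The projection on the eigenvalue 1 of the involution [a]. On the dual of the lamp group it is
    the indicator of the characters trivial on this lamp, the blanks; the trace becomes Haar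
    measure, which makes the bits fair coins. *)
Definition tape_z i : Q := 2^-1 *: (1 + delta (embed i gen_a)).

Lemma tape_tK' i : tape_t i * tape_t' i = 1.
Proof. by rewrite /tape_t /tape_t' deltaM -embedM mulgV embed1. Qed.

Lemma tape_t'K i : tape_t' i * tape_t i = 1.
Proof. by rewrite /tape_t /tape_t' deltaM -embedM mulVg embed1. Qed.

Lemma tape_z_id i : tape_z i * tape_z i = tape_z i.
Proof.
rewrite /tape_z -scalerAl -scalerAr scalerA mulrDl mul1r mulrDr mulr1 deltaM -embedM gen_aa.
rewrite embed1 delta1 (addrC (delta _)) -mulr2n -scaler_nat scalerA; congr (_ *: _).
Qed.

Lemma tape_tX i j : tape_t i ^+ j = delta (embed i (gen_t ^+ j)%g).
Proof.
elim: j => [|j IH]; first by rewrite expg0 embed1.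
by rewrite exprS IH /tape_t deltaM -embedM expgS.
Qed.

Lemma tape_t'X i j : tape_t' i ^+ j = delta (embed i (gen_t ^- j)%g).
Proof.
elim: j => [|j IH]; first by rewrite expg0 invg1 embed1.
by rewrite exprS IH /tape_t' deltaM -embedM -invgM -expgSr.
Qed.

Lemma tape_zatE i j : zat (tape_t i) (tape_t' i) (tape_z i) j = 2^-1 *: (1 + delta (embed i (lamp gen_a gen_t j))).
Proof.
rewrite /zat -lock /tape_z -scalerAr -scalerAl mulrDr mulrDl mulr1; congr (_ *: (_ + _)).
  by rewrite tape_tX tape_t'X deltaM -embedM mulVg embed1.
by rewrite tape_tX tape_t'X !deltaM -!embedM /lamp conjgE mulgA.
Qed.

Lemma tape_zatC i j k : zat (tape_t i) (tape_t' i) (tape_z i) j * zat (tape_t i) (tape_t' i) (tape_z i) k =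
  zat (tape_t i) (tape_t' i) (tape_z i) k * zat (tape_t i) (tape_t' i) (tape_z i) j.
Proof.
rewrite !tape_zatE -!scalerAl -!scalerAr; congr (_ *: (_ *: _)).
apply: commrD; first exact: commr1.
apply/commr_sym/commrD; first exact: commr1.
rewrite /GRing.comm !deltaM -!embedM; congr (delta (embed i _)).
exact: (lampC gen_ts gen_at1 gen_sas).
Qed.

Lemma comm_delta i j g h : i != j -> GRing.comm (delta (embed i g)) (delta (embed j h)).
Proof. by move=> ij; rewrite /GRing.comm !deltaM embedC. Qed.

Lemma comm_scale (c : rat) (x y : Q) : GRing.comm x y -> GRing.comm x (c *: y).
Proof. by move=> xy; rewrite /GRing.comm -scalerAr -scalerAl xy. Qed.

Lemma tape_ttC i j : i != j -> GRing.comm (tape_t i) (tape_t j).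
Proof. exact: comm_delta. Qed.

Lemma tape_tzC i j : i != j -> GRing.comm (tape_t i) (tape_z j).
Proof.
move=> ij; apply: comm_scale; apply: commrD; first exact: commr1.
exact: comm_delta.
Qed.

Lemma tape_zzC i j : i != j -> GRing.comm (tape_z i) (tape_z j).
Proof.
move=> ij; apply: comm_scale; apply: commrD; first exact: commr1.
apply/commr_sym/comm_scale/commrD; first exact: commr1.
by apply: comm_delta; rewrite eq_sym.
Qed.

Lemma star_tape_t i : qg_star (tape_t i) = tape_t' i.
Proof. by rewrite /tape_t' embedV; exact: star_delta. Qed.

Lemma star_tape_t' i : qg_star (tape_t' i) = tape_t i.
Proof. by rewrite -star_tape_t starK. Qed.

Lemma star_tape_z i : qg_star (tape_z i) = tape_z i.
Proof.
by rewrite /tape_z starZ starD star1 star_delta -embedV (mulg1_eq gen_aa).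
Qed.

(* [f] is supported on the elements whose [i]-th coordinate only involves lamps at
   the positions [0, ..., m - 1]. *)
Definition low_supp i m (f : Q) := forall g, f g != 0 -> low_shift m (g i).

Lemma low_suppD i m f h : low_supp i m f -> low_supp i m h -> low_supp i m (f + h).
Proof.
move=> fS hS g; rewrite qgDE; have [f0|/fS //] := eqVneq (f g) 0.
by rewrite f0 add0r; exact: hS.
Qed.

Lemma low_suppZ i m c f : low_supp i m f -> low_supp i m (c *: f).
Proof. by move=> fS g; rewrite qgZE mulf_eq0 negb_or => /andP[_]; exact: fS. Qed.

Lemma low_supp_delta i m (g : Gam) : low_shift m (g i) -> low_supp i m (delta g).
Proof. by move=> gS h; rewrite deltaE; case: (eqVneq h g) => [->|_]; rewrite ?eqxx. Qed.

Lemma low_supp1 i m : low_supp i m 1.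
Proof. by rewrite -delta1; apply: low_supp_delta; rewrite ffunE; exact: low_shift1. Qed.

Lemma low_suppM i m f h : low_supp i m f -> low_supp i m h -> low_supp i m (f * h).
Proof.
move=> fS hS g; rewrite qgME => fh.
have [y [fy hy]] : exists y, f y != 0 /\ h (y^-1 * g)%g != 0.
  apply: contrapT => nex; move: fh; rewrite big1 ?eqxx// => y _.
  apply/eqP; rewrite mulf_eq0; apply/negPn/negP; rewrite negb_or => /andP[fy hy].
  by apply: nex; exists y.
have -> : g = (y * (y^-1 * g))%g by rewrite mulgA mulgV mul1g.
by rewrite ffunE; apply: low_shiftM; [exact: fS|exact: hS].
Qed.

Lemma low_suppX i m f j : low_supp i m f -> low_supp i m (f ^+ j).
Proof.
by move=> fS; elim: j => [|j IH]; [exact: low_supp1|rewrite exprS; exact: low_suppM].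
Qed.

Lemma low_suppB i m f h : low_supp i m f -> low_supp i m h -> low_supp i m (f - h).
Proof. by move=> fS hS; rewrite -scaleN1r; apply/low_suppD => //; exact: low_suppZ. Qed.

Lemma low_suppW i m m' f : (m <= m')%N -> low_supp i m f -> low_supp i m' f.
Proof. by move=> mm' fS g /fS; exact: low_shiftW. Qed.

Lemma low_supp_embed i j m g : j != i -> low_supp i m (delta (embed j g)).
Proof.
by move=> ji; apply: low_supp_delta; rewrite ffunE eq_sym (negPf ji); exact: low_shift1.
Qed.

Local Notation zt i := (zat (tape_t i) (tape_t' i) (tape_z i)).
Local Notation ot i := (oat (tape_t i) (tape_t' i) (tape_z i)).
Local Notation bt i := (blk (tape_t i) (tape_t' i) (tape_z i)).
Local Notation et i := (unt (tape_t i) (tape_t' i) (tape_z i)).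

Lemma low_supp_zat i j : low_supp i j.+1 (zt i j).
Proof.
rewrite tape_zatE; apply/low_suppZ/low_suppD; first exact: low_supp1.
by apply: low_supp_delta; rewrite ffunE eqxx; exact: low_shift_lamp.
Qed.

Lemma low_supp_oat i j : low_supp i j.+1 (ot i j).
Proof. by apply: low_suppB; [exact: low_supp1|exact: low_supp_zat]. Qed.

Lemma low_supp_zat_neq i j k m : k != i -> low_supp i m (zt k j).
Proof.
move=> ki; rewrite tape_zatE; apply/low_suppZ/low_suppD; first exact: low_supp1.
exact: low_supp_embed.
Qed.

Lemma low_supp_oat_neq i j k m : k != i -> low_supp i m (ot k j).
Proof. by move=> ki; apply: low_suppB; [exact: low_supp1|exact: low_supp_zat_neq]. Qed.

Lemma low_supp_blk_neq i n k m : k != i -> low_supp i m (bt k n).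
Proof.
move=> ki; rewrite /blk -lock; apply: low_suppM; last exact: low_supp_zat_neq.
apply: low_suppM; first exact: low_supp_zat_neq.
apply: (big_ind (low_supp i m)); [exact: low_supp1|exact: low_suppM|].
by move=> j _; exact: low_supp_oat_neq.
Qed.

Lemma low_supp_unt_neq i n p q k m : k != i -> low_supp i m (et k n p q).
Proof.
move=> ki; rewrite /unt -lock; apply: low_suppM; last exact/low_suppX/low_supp_embed.
by apply: low_suppM; [exact/low_suppX/low_supp_embed|exact: low_supp_blk_neq].
Qed.

(** A fresh bit is independent of the lower ones: the lamp [j] lies outside the support of [f], so
    its term contributes nothing to the trace and only the factor 1/2 remains. *)
Lemma tau_zat i j f : low_supp i j f -> tau (zt i j * f) = 2^-1 * tau f.
Proof.
move=> fS; rewrite tape_zatE -scalerAl tauZ mulrDl mul1r tauD tau_delta_mul.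
have [->|/fS] := eqVneq (f (embed i (lamp gen_a gen_t j))^-1%g) 0; first by rewrite addr0.
by rewrite -embedV lampV ffunE eqxx => /low_shiftN_lamp.
Qed.

Lemma tau_oat i j f : low_supp i j f -> tau (ot i j * f) = 2^-1 * tau f.
Proof.
move=> fS; rewrite mulrBl mul1r tauD tauN tau_zat//.
by rewrite -{1}[tau f]mul1r -mulrBl.
Qed.

(** The [n.+2] bits of the pattern are read in increasing order, and each of them halves the trace.
    Support level 0 means that the [i]-th coordinates in the support of [f] act trivially. *)
Lemma tau_blk i n f : low_supp i 0 f -> tau (bt i n * f) = 2^-1 ^+ n.+2 * tau f.
Proof.
move=> fS; pose pr m := zt i 0 * \prod_(j < m) ot i j.+1.
have zprC k m : zt i k * pr m = pr m * zt i k.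
  apply: commrM; first exact: tape_zatC.
  by apply: commr_prod => j _; apply: commrB; [exact: commr1|exact: tape_zatC].
have prS m : low_supp i m.+1 (pr m * f) /\ tau (pr m * f) = 2^-1 ^+ m.+1 * tau f.
  elim: m => [|m [IH1 IH2]].
    rewrite /pr big_ord0 mulr1 expr1; split; last exact: tau_zat.
    by apply: low_suppM; [exact: low_supp_zat|exact: low_suppW fS].
  have -> : pr m.+1 = ot i m.+1 * pr m.
    by rewrite /pr big_ord_recr/= mulrA -/(pr m) /oat mulrBl mulrBr mulr1 mul1r zprC.
  rewrite -mulrA; split; last by rewrite tau_oat// IH2 mulrA -exprS.
  apply: low_suppM; first exact: low_supp_oat.
  exact: low_suppW IH1.
have -> : bt i n = zt i n.+1 * pr n by rewrite zprC /blk -lock.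
by have [prn prt] := prS n; rewrite -mulrA tau_zat// prt mulrA -exprS.
Qed.

(** By cyclicity of the trace the outer shifts meet and cancel. *)
Lemma tau_unt i n p f : GRing.comm (tape_t i) f ->
  tau (et i n p p * f) = tau (bt i n * f).
Proof.
move=> tf; rewrite /unt -lock -!mulrA tauC -!mulrA; congr (tau (_ * _)).
have -> : f * tape_t i ^+ p.+1 = tape_t i ^+ p.+1 * f by apply/commr_sym/commr_sym/commrX/commr_sym.
by rewrite mulrA (ttXV (tape_t'K i)) mul1r.
Qed.

Local Notation Utt := (Unt tape_t tape_t' tape_z).

Lemma tau_Unt n (p q : box n) :
  tau (Utt p q) = (p == q)%:R * 2^-1 ^+ (n.1.1 + n.1.2 + n.2 + 6).
Proof.
have [<-|pq] := eqVneq p q; last first.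
  (* Off the diagonal, moving the factor [Utt q q] to the front by cyclicity gives a zero
     product. *)
  have -> : Utt p q = Utt p q * Utt q q.
    rewrite (UntM tape_tK' tape_t'K tape_z_id tape_zatC tape_ttC tape_tzC tape_zzC).
    by rewrite eqxx scale1r.
  rewrite tauC (UntM tape_tK' tape_t'K tape_z_id tape_zatC tape_ttC tape_tzC tape_zzC).
  by rewrite eq_sym (negPf pq) tauZ !mul0r.
have ct i j m r s : i != j -> GRing.comm (tape_t i) (et j m r s).
  move=> ij; apply: comm_unt; first exact: tape_ttC.
    exact/comm_delta.
  exact: tape_tzC.
have neq i j : i != j -> j != i by rewrite eq_sym.
rewrite /Unt -mulrA tau_unt; last by apply: commrM; apply: ct; rewrite ?i01 ?i02.
rewrite tau_blk; last by apply: low_suppM; apply/low_supp_unt_neq/neq; rewrite ?i01 ?i02.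
rewrite tau_unt; last by apply: ct; rewrite i12.
rewrite tau_blk; last by apply/low_supp_unt_neq/neq; rewrite i12.
rewrite -[et i2 _ _ _]mulr1 tau_unt; last exact: commr1.
rewrite tau_blk; last exact: low_supp1.
rewrite /tau qg1E eqxx mulr1 mul1r -!exprD; congr (_ ^+ _); lia.
Qed.

Definition all_alive : Q := ot i0 0 * ot i1 0 * ot i2 0.

Lemma tau_all_alive : tau all_alive = 2^-1 ^+ 3.
Proof.
have neq i j : i != j -> j != i by rewrite eq_sym.
rewrite /all_alive -mulrA tau_oat; last first.
  by apply: low_suppM; apply/low_supp_oat_neq/neq; rewrite ?i01 ?i02.
rewrite tau_oat; last by apply/low_supp_oat_neq/neq; rewrite i12.
rewrite -[ot i2 0]mulr1 tau_oat; last exact: low_supp1.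
by rewrite /tau qg1E eqxx mulr1 -expr2 -exprS.
Qed.

End Tapes.

Local Open Scope classical_set_scope.

(** * Projections onto closed subspaces *)

Lemma discr_le (R : realType) (e b q : R) : 0 <= e -> 0 <= q ->
  (forall t, 0 <= e - 2 * t * b + t ^+ 2 * q) -> b ^+ 2 <= e * q.
Proof.
move=> e0 q0 H; have [q00|q00] := eqVneq q 0.
  rewrite q00 mulr0; have [->|b0] := eqVneq b 0; first by rewrite expr0n.
  (* For [q = 0] the expression is linear in [t]; at this [t] it would be -1. *)
  have := H ((e + 1) / (2 * b)); rewrite q00 mulr0 addr0.
  have -> : 2 * ((e + 1) / (2 * b)) * b = e + 1 by field.
  by lra.
have qp : 0 < q by rewrite lt_neqAle eq_sym q00.
have := H (b / q); have -> : e - 2 * (b / q) * b + (b / q) ^+ 2 * q = (e * q - b ^+ 2) / q.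
  by field.
by rewrite pmulr_lge0 ?invr_gt0// subr_ge0.
Qed.

Section Projection.
Variables (R : realType) (E : lmodType R) (H V : set E) (ip : E -> E -> R).
Hypotheses (HD : forall f h, H f -> H h -> H (f + h)) (HZ : forall c f, H f -> H (c *: f)).
Hypotheses (VH : V `<=` H) (V0 : V 0) (VD : forall f h, V f -> V h -> V (f + h)).
Hypothesis VZ : forall c f, V f -> V (c *: f).
Hypothesis ipC : forall f h, ip f h = ip h f.
Hypothesis ipD : forall f g h, H f -> H g -> H h -> ip (f + g) h = ip f h + ip g h.
Hypothesis ipZ : forall c f h, H f -> H h -> ip (c *: f) h = c * ip f h.
Hypothesis ip_ge0 : forall f, H f -> 0 <= ip f f.
Hypothesis complete : forall v : nat -> E, (forall n, V (v n)) ->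
  (forall e : R, 0 < e -> exists N, forall m n, (N <= m)%N -> (N <= n)%N ->
     ip (v m - v n) (v m - v n) <= e) ->
  exists2 w, V w & forall e : R, 0 < e -> exists N, forall n, (N <= n)%N ->
     ip (v n - w) (v n - w) <= e.

Let q f := ip f f.

Let HN f : H f -> H (- f). Proof. by move=> Hf; rewrite -scaleN1r; exact: HZ. Qed.
Let HB f h : H f -> H h -> H (f - h). Proof. by move=> Hf Hh; exact/HD/HN. Qed.

Lemma ipB f g h : H f -> H g -> H h -> ip (f - g) h = ip f h - ip g h.
Proof.
by move=> Hf Hg Hh; rewrite ipD//; [rewrite -scaleN1r ipZ// mulN1r|exact: HN].
Qed.

Lemma ip_sqBZ f h t : H f -> H h ->
  q (f - t *: h) = q f - 2 * t * ip f h + t ^+ 2 * q h.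
Proof.
move=> Hf Hh; have Hth : H (t *: h) by exact: HZ.
rewrite /q ipB ?ipZ//; try exact: HB.
rewrite ![ip _ (f - _)]ipC !ipB// !(ipZ _ _ _)// (ipC h f).
by ring.
Qed.

Lemma ip_CS f h : H f -> H h -> ip f h ^+ 2 <= q f * q h.
Proof.
move=> Hf Hh; apply: discr_le => [||t]; try exact: ip_ge0.
by rewrite -ip_sqBZ//; apply: ip_ge0; exact/HB/HZ.
Qed.

Lemma ip_sqB f h : H f -> H h -> q (f - h) = q f - 2 * ip f h + q h.
Proof. by move=> Hf Hh; rewrite -[h in LHS]scale1r ip_sqBZ// mulr1 expr1n mul1r. Qed.

Lemma parallelogram f u v : H f -> H u -> H v ->
  q (u - v) = 2 * q (f - u) + 2 * q (f - v) - 4 * q (f - 2^-1 *: (u + v)).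
Proof.
move=> Hf Hu Hv; have Huv := HD Hu Hv.
rewrite ip_sqBZ// !ip_sqB// (ipC f (u + v)) /q !ipD// !(ipC _ (u + v)) !ipD//.
by rewrite !(ipC _ f) (ipC v u); field.
Qed.

(** The classical argument: a minimizing sequence for the distance is Cauchy by the parallelogram
    law, since midpoints stay in [V], and its limit is orthogonal. *)
Lemma projection_exists f : H f ->
  exists2 p, V p & forall h, V h -> ip (f - p) h = 0.
Proof.
move=> Hf; pose D := [set q (f - v) | v in V].
have D0 : D !=set0 by exists (q (f - 0)); exists 0.
have Dlb : has_lbound D.
  by exists 0 => _ [v Vv <-]; apply: ip_ge0; exact/HB/VH.
have Dinf : has_inf D by split.
pose d := inf D.
have dle v : V v -> d <= q (f - v) by move=> Vv; apply: ge_inf => //; exists v.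
have /choice[v vP] (n : nat) : exists v, V v /\ q (f - v) < d + n.+1%:R^-1.
  have [_ [v Vv <-] vd] := inf_adherent (ltac:(by rewrite invr_gt0) : 0 < n.+1%:R^-1 :> R) Dinf.
  by exists v.
have small (e : R) : 0 < e -> exists N, forall n, (N <= n)%N -> n.+1%:R^-1 <= e :> R.
  move=> e0; exists (Num.truncn e^-1) => n Nn.
  rewrite -[leRHS]invrK lef_pV2 ?posrE ?invr_gt0//.
  by rewrite (le_trans (ltW (truncnS_gt _)))// ler_nat.
have [w Vw vw] : exists2 w, V w & forall e : R, 0 < e -> exists N, forall n, (N <= n)%N ->
     ip (v n - w) (v n - w) <= e.
  apply: complete => [n|e e0]; first by have [] := vP n.
  have [N NP] := small (e / 4) (ltac:(by rewrite divr_gt0) : 0 < e / 4).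
  exists N => m n Nm Nn; have [Vm dm] := vP m; have [Vn dn] := vP n.
  move: (dle _ (VZ 2^-1 (VD Vm Vn))).
  rewrite -[X in _ -> X <= e]/(q (v m - v n)) (parallelogram Hf (VH Vm) (VH Vn)).
  move: (NP m Nm) (NP n Nn) dm dn.
  move: (q (f - v m)) (q (f - v n)) (q (f - _)) (m.+1%:R^-1) (n.+1%:R^-1) => x1 x2 x3 y1 y2.
  by move: (q _) => x4; lra.
exists w => // h Vh.
have Hh := VH Vh; have qh0 := ip_ge0 Hh; rewrite -/(q h) in qh0.
(* Instead of continuity of [ip], the error is split at [v n]: one part is controlled by
   near-minimality, the other by Cauchy-Schwarz. Each square is at most [e * q h], so the square of
   the sum is at most four times that. *)
have key (e : R) : 0 < e -> ip (f - w) h ^+ 2 <= 4 * e * q h.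
  move=> e0; have [N1 NP1] := small e e0; have [N2 NP2] := vw e e0.
  pose n := maxn N1 N2; have [Vn dn] := vP n.
  have e1 := NP1 n (leq_maxl _ _); have e2 := NP2 n (leq_maxr _ _).
  have Hvn := VH Vn; have Hw := VH Vw.
  have b1 : ip (f - v n) h ^+ 2 <= e * q h.
    (* Comparing [v n] with its competitors [v n + t h] gives a quadratic in [t] that is
       nonnegative. *)
    apply: discr_le => // [|t]; first exact: ltW.
    have := dle _ (VD Vn (VZ t Vh)); rewrite opprD addrA ip_sqBZ//; last exact: HB.
    move: e1 dn; move: (q (f - v n)) (n.+1%:R^-1) (ip _ _) => x1 y1 b.
    by rewrite -/(q h); move: (t ^+ 2 * q h) => y2; lra.
  have b2 : ip (v n - w) h ^+ 2 <= e * q h.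
    by apply: (le_trans (ip_CS _ _)) => //; [exact: HB|exact: ler_wpM2r].
  have -> : f - w = (f - v n) + (v n - w) by rewrite addrA subrK.
  rewrite ipD//; try exact: HB.
  have := sqr_ge0 (ip (f - v n) h - ip (v n - w) h).
  rewrite sqrrB sqrrD; lra.
apply/eqP; rewrite -sqrf_eq0 eq_le sqr_ge0 andbT.
apply/ler_addgt0Pl => e e0; rewrite addr0.
have [qh00|qh00] := eqVneq (q h) 0; first by have := key 1 ltr01; rewrite qh00; lra.
have qhp : 0 < q h by rewrite lt_neqAle eq_sym qh00.
have := key (e / (4 * q h)) (ltac:(by rewrite divr_gt0// mulr_gt0)).
by have -> : 4 * (e / (4 * q h)) * q h = e by field.
Qed.

End Projection.

(** * Summable families *)

(** One inequality holds for every positive factor; applied to the inverse of [c] it yields the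
    other. *)
Lemma esumZ (R : realType) (T : choiceType) (c : R) (a : T -> \bar R) : 0 <= c ->
  (forall x, (0 <= a x)%E) ->
  (\esum_(x in [set: T]) (c%:E * a x) = c%:E * \esum_(x in [set: T]) a x)%E.
Proof.
move=> c0 a0; have [->|cn0] := eqVneq c 0.
  by rewrite mul0e esum1// => x _; rewrite mul0e.
have {c0 cn0} c0 : 0 < c by rewrite lt_neqAle eq_sym cn0.
have le_cesum (d : R) (b : T -> \bar R) : 0 < d -> (forall x, (0 <= b x)%E) ->
    (\esum_(x in [set: T]) (d%:E * b x) <= d%:E * \esum_(x in [set: T]) b x)%E.
  move=> d0 b0; apply: ge_ereal_sup => _ [X [finX _] <-].
  rewrite -ge0_mule_fsumr//; apply: lee_wpmul2l; first by rewrite lee_fin ltW.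
  by apply: ereal_sup_ubound; exists X.
apply/eqP; rewrite eq_le le_cesum//= -lee_pdivlMl//.
have := @le_cesum c^-1 (fun x => c%:E * a x)%E.
under eq_esum => x _ do rewrite muleA -EFinM mulVf ?gt_eqF// mul1e.
apply; first by rewrite invr_gt0.
by move=> x; rewrite mule_ge0// lee_fin ltW.
Qed.

Lemma max0B (R : realDomainType) (y : R) : Order.max y 0 = Order.max (- y) 0 + y.
Proof.
have [y0|y0] := lerP 0 y; first by rewrite max_r ?oppr_le0// add0r.
by rewrite max_l ?addNr// oppr_ge0 ltW.
Qed.

Section RealSums.
Variables (R : realType) (G : groupType).
Implicit Types a b f h : G -> R.

Definition sm f := summable [set: G] (fun x => (f x)%:E).
Definition psum f : R := fine (\esum_(x in [set: G]) (f x)%:E)%E.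

Lemma sm_le a b : (forall x, `|a x| <= b x) -> sm b -> sm a.
Proof.
move=> ab; apply: le_lt_trans; apply: le_esum => x _ /=.
by rewrite lee_fin (le_trans (ab x))// ler_norm.
Qed.

Lemma smD f h : sm f -> sm h -> sm (fun x => f x + h x).
Proof. by move=> sf sh; have := summableD sf sh. Qed.

Lemma smN f : sm f -> sm (fun x => - f x).
Proof. by rewrite /sm summableN. Qed.

Lemma smB f h : sm f -> sm h -> sm (fun x => f x - h x).
Proof. by move=> sf sh; apply: smD => //; exact: smN. Qed.

Lemma smZ c f : sm f -> sm (fun x => c * f x).
Proof.
move=> sf; rewrite /sm /summable.
have -> : (\esum_(x in [set: G]) `|(c * f x)%:E| =
    `|c|%:E * \esum_(x in [set: G]) `|(f x)%:E|)%E.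
  by rewrite -esumZ//; apply: eq_esum => x _ /=; rewrite normrM EFinM.
by apply: lte_mul_pinfty => //; rewrite lee_fin.
Qed.

Lemma sm0 : sm (fun=> 0).
Proof. by rewrite /sm /summable esum1// => x _; rewrite abse0. Qed.

Lemma sm_norm f : sm f -> sm (fun x => `|f x|).
Proof.
rewrite /sm /summable => sf; apply: le_lt_trans sf; apply: le_esum => x _ /=.
by rewrite normr_id.
Qed.

Lemma psum_fin f : (forall x, 0 <= f x) -> sm f ->
  (\esum_(x in [set: G]) (f x)%:E = (psum f)%:E)%E.
Proof.
move=> f0; rewrite /sm summableE /psum => sf.
suff E : (\esum_(x in [set: G]) (f x)%:E = \esum_(x in [set: G]) `|(f x)%:E|)%E.
  by rewrite fineK// E.
by apply: eq_esum => x _ /=; rewrite ger0_norm.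
Qed.

Lemma psumD f h : (forall x, 0 <= f x) -> (forall x, 0 <= h x) -> sm f -> sm h ->
  psum (fun x => f x + h x) = psum f + psum h.
Proof.
move=> f0 h0 sf sh; apply: EFin_inj; rewrite EFinD -!psum_fin//.
- by rewrite -esumD// => x _; rewrite lee_fin.
- by move=> x; rewrite addr_ge0.
- exact: smD.
Qed.

Lemma psumZ c f : 0 <= c -> (forall x, 0 <= f x) -> sm f ->
  psum (fun x => c * f x) = c * psum f.
Proof.
move=> c0 f0 sf; apply: EFin_inj; rewrite EFinM -!psum_fin//.
- by rewrite -esumZ// => x; rewrite lee_fin.
- by move=> x; rewrite mulr_ge0.
- exact: smZ.
Qed.

Lemma psum_ge0 f : (forall x, 0 <= f x) -> 0 <= psum f.
Proof. by move=> f0; apply: fine_ge0; apply: esum_ge0 => x _; rewrite lee_fin. Qed.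

Lemma psum_ge f x : (forall x, 0 <= f x) -> sm f -> f x <= psum f.
Proof.
move=> f0 sf; rewrite -lee_fin -psum_fin//; apply: esum_ge.
by exists [set x]; [split => //|rewrite fsbig_set1].
Qed.

Lemma psum_le_bound f (B : R) : (forall x, 0 <= f x) ->
  (forall X : {fset G}, \sum_(x <- X) f x <= B) -> sm f /\ psum f <= B.
Proof.
move=> f0 fB.
have le : (\esum_(x in [set: G]) (f x)%:E <= B%:E)%E.
  apply: ge_ereal_sup => _ [X [finX _] <-].
  by rewrite fsumEFin// lee_fin fsbig_finite.
have sf : sm f.
  rewrite /sm /summable (_ : (\esum_(x in _) _ = \esum_(x in [set: G]) (f x)%:E)%E).
    exact: le_lt_trans le (ltry _).
  by apply: eq_esum => x _ /=; rewrite ger0_norm.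
by split => //; rewrite -lee_fin -psum_fin.
Qed.

Lemma psum_fset f (X : {fset G}) : (forall x, 0 <= f x) -> sm f ->
  \sum_(x <- X) f x <= psum f.
Proof.
move=> f0 sf; rewrite -lee_fin -psum_fin//; apply: esum_ge.
by exists [set` X] => //; rewrite fsumEFin// fsbig_finite//= set_fsetK.
Qed.

(** Two decompositions of a family into nonnegative parts have equal cross sums, so the value does
    not depend on the decomposition. Linearity of [rsum] is deduced from this. *)
Lemma rsum_sub f h : (forall x, 0 <= f x) -> (forall x, 0 <= h x) -> sm f -> sm h ->
  rsum (fun x => f x - h x) = psum f - psum h.
Proof.
move=> f0 h0 sf sh; rewrite -[rsum _]/(psum (fun x => Order.max (f x - h x) 0) -
  psum (fun x => Order.max (- (f x - h x)) 0)).
have sfh := smB sf sh.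
have max_norm (y : R) : `|Order.max y 0| <= `|y|.
  by rewrite /Order.max; case: ifP => // _; rewrite normr0.
have sp : sm (fun x => Order.max (f x - h x) 0).
  by apply: sm_le (sm_norm sfh) => x.
have sn : sm (fun x => Order.max (- (f x - h x)) 0).
  by apply: sm_le (sm_norm sfh) => x; rewrite -(normrN (f x - h x)).
have p0 x : 0 <= Order.max (f x - h x) 0 by rewrite le_max lexx orbT.
have n0 x : 0 <= Order.max (- (f x - h x)) 0 by rewrite le_max lexx orbT.
have : psum (fun x => Order.max (f x - h x) 0) + psum h =
  psum (fun x => Order.max (- (f x - h x)) 0) + psum f.
  rewrite -!psumD//; congr psum; apply/funext => x.
  by rewrite max0B; ring.
by move: (psum f) (psum h) (psum _) (psum _) => u v p n ?; lra.
Qed.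

Lemma rsumE f : sm f -> exists p n : G -> R,
  [/\ forall x, 0 <= p x, forall x, 0 <= n x, sm p, sm n & forall x, f x = p x - n x].
Proof.
move=> sf; exists (fun x => Order.max (f x) 0), (fun x => Order.max (- f x) 0).
have sa := sm_norm sf.
split.
- by move=> x; rewrite le_max lexx orbT.
- by move=> x; rewrite le_max lexx orbT.
- by apply: sm_le sa => x; rewrite /Order.max; case: ifP => // _; rewrite normr0.
- apply: sm_le sa => x; rewrite -(normrN (f x)) /Order.max.
  by case: ifP => // _; rewrite normr0.
- by move=> x; rewrite max0B addrAC subrr add0r.
Qed.

Lemma rsumD f h : sm f -> sm h -> rsum (fun x => f x + h x) = rsum f + rsum h.
Proof.
move=> /rsumE[p [n [p0 n0 sp sn fE]]] /rsumE[p' [n' [p'0 n'0 sp' sn' hE]]].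
have -> : f = fun x => p x - n x by apply/funext.
have -> : h = fun x => p' x - n' x by apply/funext.
rewrite !rsum_sub// (_ : (fun x => _) = (fun x => (p x + p' x) - (n x + n' x))); last first.
  by apply/funext => x; ring.
rewrite rsum_sub//; try by [move=> x; rewrite addr_ge0|exact: smD].
by rewrite !psumD//; ring.
Qed.

Lemma rsumN f : sm f -> rsum (fun x => - f x) = - rsum f.
Proof.
move=> /rsumE[p [n [p0 n0 sp sn fE]]].
have -> : f = fun x => p x - n x by apply/funext.
rewrite rsum_sub// (_ : (fun x => _) = (fun x => n x - p x)); last first.
  by apply/funext => x; ring.
by rewrite rsum_sub//; ring.
Qed.

Lemma rsumZ c f : sm f -> rsum (fun x => c * f x) = c * rsum f.
Proof.
wlog c0 : c / 0 <= c => [H|] sf.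
  have [|c0] := leP 0 c; first by move=> /H; exact.
  have := H (- c); rewrite oppr_ge0 => /(_ (ltW c0) sf).
  rewrite (_ : (fun x => - c * f x) = (fun x => - (c * f x))); last first.
    by apply/funext => x; rewrite mulNr.
  by rewrite rsumN ?mulNr; [move=> /oppr_inj|exact: smZ].
move: sf => /rsumE[p [n [p0 n0 sp sn fE]]].
have -> : f = fun x => p x - n x by apply/funext.
rewrite rsum_sub// (_ : (fun x => _) = (fun x => c * p x - c * n x)); last first.
  by apply/funext => x; ring.
rewrite rsum_sub//; try by [move=> x; rewrite mulr_ge0|exact: smZ].
by rewrite !psumZ//; ring.
Qed.

Lemma rsum0 : rsum (fun _ : G => 0 : R) = 0.
Proof.
have E : (fun _ : G => 0 : R) = fun x => 0 * 0 by apply/funext => x; rewrite mul0r.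
by rewrite [in LHS]E rsumZ ?mul0r//; exact: sm0.
Qed.

Lemma rsum_ge0E f : (forall x, 0 <= f x) -> sm f -> rsum f = psum f.
Proof.
move=> f0 sf; transitivity (rsum (fun x => f x - 0)).
  by congr rsum; apply/funext => x; rewrite subr0.
rewrite rsum_sub//; last exact: sm0.
by rewrite [X in _ - X](_ : _ = 0) ?subr0// /psum esum1.
Qed.

Lemma rsum_unit f y : sm (fun x => f x * (x == y)%:R) /\
  rsum (fun x => f x * (x == y)%:R) = f y.
Proof.
have aux (c : R) : 0 <= c -> sm (fun x => c * (x == y)%:R) /\
    psum (fun x => c * (x == y)%:R) = c.
  move=> c0; have E : (\esum_(x in [set: G]) (c * (x == y)%:R)%:E = c%:E)%E.
    rewrite -[RHS](@esum_set1 R G y (fun=> c%:E)) ?lee_fin// [RHS]esum_mkcond.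
    apply: eq_esum => x _; rewrite (_ : (x \in [set y]) = (x == y)); last first.
      by apply/idP/eqP; rewrite inE.
    by case: eqP; rewrite ?mulr1 ?mulr0.
  split; last by rewrite /psum E.
  rewrite /sm /summable (_ : (\esum_(x in _) _ = c%:E)%E) ?ltry//.
  rewrite -[RHS]E; apply: eq_esum => x _ /=.
  by rewrite ger0_norm// mulr_ge0.
have [s1 p1] := aux 1 ler01.
have E : (fun x => f x * (x == y)%:R) = (fun x => f y * (1 * (x == y)%:R)).
  by apply/funext => x; rewrite mul1r; case: eqP => [->//|_]; rewrite !mulr0.
rewrite E; split; first exact: smZ.
by rewrite rsumZ// rsum_ge0E// ?p1 ?mulr1// => x; rewrite mul1r.
Qed.

Lemma sm_reindex (e e' : G -> G) f : cancel e e' -> cancel e' e -> sm f ->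
  sm (fun x => f (e x)) /\ rsum (fun x => f (e x)) = rsum f.
Proof.
move=> ee' e'e sf.
have bij : set_bij [set: G] [set: G] e.
  by split => // [x y _ _ /(congr1 e')|x _]; [rewrite !ee'|exists (e' x)].
have E (F : G -> \bar R) : (\esum_(x in [set: G]) F (e x) = \esum_(x in [set: G]) F x)%E.
  exact/esym/(@reindex_esum R G G _ _ _ F bij).
split; first by rewrite /sm /summable (E (fun x => `|(f x)%:E|)%E).
rewrite /rsum (E (fun x => (Order.max (f x) 0)%:E)).
by rewrite (E (fun x => (Order.max (- f x) 0)%:E)).
Qed.

End RealSums.

(** * Square-summable families *)

Local Notation Re := complex.Re.
Local Notation Im := complex.Im.

Lemma cauchy_lim (R : realType) (u : nat -> R) :
  (forall e : R, 0 < e -> exists N, forall m n, (N <= m)%N -> (N <= n)%N ->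
     `|u m - u n| <= e) ->
  exists l : R, u n @[n --> \oo] --> l.
Proof.
move=> uC; suff /cvg_ex[l ul] : cvg (u n @[n --> \oo]) by exists l.
apply/cauchy_cvgP/cauchy_exP => e e0.
have [N NP] := uC (e / 2) (ltac:(by rewrite divr_gt0)).
exists (u N); exists N => // n /= Nn; rewrite /ball /=.
by apply: (le_lt_trans (NP _ _ (leqnn N) Nn)); lra.
Qed.

Lemma cvg_bigD (R : realType) (I : Type) (r : seq I) (u : I -> nat -> R) (l : I -> R) :
  (forall i, u i n @[n --> \oo] --> l i) ->
  \sum_(i <- r) u i n @[n --> \oo] --> \sum_(i <- r) l i.
Proof.
move=> ul; elim: r => [|i r IH].
  by rewrite big_nil; under eq_cvg do rewrite big_nil; exact: cvg_cst.
rewrite big_cons; under eq_cvg do rewrite big_cons.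
exact: cvgD.
Qed.

Section L2.
Variables (R : realType) (G : groupType).
Local Notation C := R[i].

Lemma ReD (x y : C) : Re (x + y) = Re x + Re y. Proof. by case: x y => [? ?] []. Qed.
Lemma ImD (x y : C) : Im (x + y) = Im x + Im y. Proof. by case: x y => [? ?] []. Qed.
Lemma ReB (x y : C) : Re (x - y) = Re x - Re y. Proof. by case: x y => [? ?] []. Qed.
Lemma ImB (x y : C) : Im (x - y) = Im x - Im y. Proof. by case: x y => [? ?] []. Qed.
Lemma ReZ (c : R) (x : C) : Re (c%:C%C * x) = c * Re x.
Proof. by case: x => a b /=; ring. Qed.
Lemma ImZ (c : R) (x : C) : Im (c%:C%C * x) = c * Im x.
Proof. by case: x => a b /=; ring. Qed.
Lemma Re_sum (I : Type) (r : seq I) (F : I -> C) :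
  Re (\sum_(i <- r) F i) = \sum_(i <- r) Re (F i).
Proof. exact: (big_morph _ ReD). Qed.
Lemma Im_sum (I : Type) (r : seq I) (F : I -> C) :
  Im (\sum_(i <- r) F i) = \sum_(i <- r) Im (F i).
Proof. exact: (big_morph _ ImD). Qed.
Lemma eq_ReIm (x y : C) : Re x = Re y -> Im x = Im y -> x = y.
Proof. by case: x y => [? ?] [? ?] /= -> ->. Qed.

Definition nsq (f : G -> C) (x : G) : R := Re (f x) ^+ 2 + Im (f x) ^+ 2.
(** The real part of the hermitian product: the projection theorem is used over the reals, and
    [l2n_dotE] recovers the complex product. *)
Definition sdot (f h : G -> C) : R :=
  rsum (fun x => Re (f x) * Re (h x) + Im (f x) * Im (h x)).

Section Sdot.
Implicit Types f g h : G -> C.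

Lemma nsq_ge0 f x : 0 <= nsq f x.
Proof. by rewrite addr_ge0 ?sqr_ge0. Qed.

Lemma l2P f : l2 f <-> sm (nsq f).
Proof.
rewrite /l2 /sm /= (_ : (fun x => (_ ^+ 2)%:E) = (fun x => (nsq f x)%:E))//.
apply/funext => x; congr EFin; rewrite /nsq; case: (f x) => a b /=.
by rewrite sqr_sqrtr// addr_ge0 ?sqr_ge0.
Qed.

Lemma sm_prod f h : l2 f -> l2 h ->
  sm (fun x => Re (f x) * Re (h x) + Im (f x) * Im (h x)).
Proof.
move=> /l2P sf /l2P sh; apply: sm_le (smD sf sh) => x; rewrite /nsq ler_norml.
move: (Re (f x)) (Im (f x)) (Re (h x)) (Im (h x)) => a b c d.
have := sqr_ge0 (a + c); have := sqr_ge0 (a - c).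
have := sqr_ge0 (b + d); have := sqr_ge0 (b - d).
have := sqr_ge0 a; have := sqr_ge0 b; have := sqr_ge0 c; have := sqr_ge0 d.
by move=> *; apply/andP; split; lra.
Qed.

Lemma l2D f h : l2 f -> l2 h -> l2 (fun x => f x + h x).
Proof.
move=> /l2P sf /l2P sh; apply/l2P; apply: sm_le (smZ 2 (smD sf sh)) => x.
rewrite ger0_norm ?nsq_ge0// /nsq ReD ImD.
move: (Re (f x)) (Im (f x)) (Re (h x)) (Im (h x)) => a b c d.
have := sqr_ge0 (a - c); have := sqr_ge0 (b - d).
by move=> *; lra.
Qed.

Lemma l2Z (c : C) f : l2 f -> l2 (fun x => c * f x).
Proof.
move=> /l2P sf; apply/l2P; apply: sm_le (smZ (Re c ^+ 2 + Im c ^+ 2) sf) => x.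
rewrite ger0_norm ?nsq_ge0// /nsq.
by case: c (f x) => [c d] [a b] /=; rewrite le_eqVlt; apply/orP; left; apply/eqP; ring.
Qed.

Lemma l2_0 : l2 (fun _ : G => 0 : C).
Proof.
apply/l2P; apply: (sm_le _ (@sm0 R G)) => x.
by rewrite /nsq /= expr0n addr0 normr0.
Qed.

Lemma sdotC f h : sdot f h = sdot h f.
Proof. by congr rsum; apply/funext => x; rewrite mulrC [X in _ + X]mulrC. Qed.

Lemma sdotD f g h : l2 f -> l2 g -> l2 h ->
  sdot (fun x => f x + g x) h = sdot f h + sdot g h.
Proof.
move=> lf lg lh; rewrite /sdot -rsumD; try exact: sm_prod.
by congr rsum; apply/funext => x; rewrite ReD ImD; ring.
Qed.

Lemma sdotZ (c : R) f h : l2 f -> l2 h ->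
  sdot (fun x => c%:C%C * f x) h = c * sdot f h.
Proof.
move=> lf lh; rewrite /sdot -rsumZ; last exact: sm_prod.
by congr rsum; apply/funext => x; rewrite ReZ ImZ; ring.
Qed.

Lemma sdot_psum f : l2 f -> sdot f f = psum (nsq f).
Proof.
move=> lf; rewrite /sdot rsum_ge0E; last exact: sm_prod.
  by congr psum; apply/funext => x; rewrite /nsq !expr2.
by move=> x; rewrite -!expr2; exact: nsq_ge0.
Qed.

Lemma sdot_ge0 f : l2 f -> 0 <= sdot f f.
Proof. by move=> lf; rewrite sdot_psum//; apply: psum_ge0; exact: nsq_ge0. Qed.

Lemma nsq_le f x : l2 f -> nsq f x <= sdot f f.
Proof.
move=> lf; rewrite sdot_psum//; apply: psum_ge; first exact: nsq_ge0.
exact: (l2P f).1 lf.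
Qed.

End Sdot.

Definition cfun k := 'I_k -> G -> R[i].
HB.instance Definition _ k := GRing.Zmodule.copy (cfun k) ('I_k -> G -> R[i]).
Definition cscale k (c : R) (f : cfun k) : cfun k := fun i x => c%:C%C * f i x.

Lemma cscaleA k a b (v : cfun k) : cscale a (cscale b v) = cscale (a * b) v.
Proof. by apply/funext => i; apply/funext => x; rewrite /cscale mulrA -rmorphM. Qed.
Lemma cscale1 k : left_id 1 (@cscale k).
Proof. by move=> f; apply/funext => i; apply/funext => x; rewrite /cscale mul1r. Qed.
Lemma cscaleDr k : right_distributive (@cscale k) +%R.
Proof. by move=> c f h; apply/funext => i; apply/funext => x; rewrite /cscale mulrDr. Qed.
Lemma cscaleDl k v : {morph (@cscale k)^~ v : a b / a + b}.
Proof.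
by move=> c d; apply/funext => i; apply/funext => x; rewrite /cscale rmorphD mulrDl.
Qed.
HB.instance Definition _ k := GRing.Zmodule_isLmodule.Build R (cfun k)
  (@cscaleA k) (@cscale1 k) (@cscaleDr k) (@cscaleDl k).

Definition rip k (f h : cfun k) : R := \sum_(i < k) sdot (f i) (h i).

Section Rip.
Variable k : nat.
Implicit Types f g h : cfun k.

Lemma l2nD f h : l2n f -> l2n h -> l2n (f + h).
Proof. by move=> lf lh i; exact: l2D. Qed.
Lemma l2nZ c f : l2n f -> l2n (c *: f).
Proof. by move=> lf i; exact: l2Z. Qed.
Lemma l2n0 : l2n (0 : cfun k).
Proof. by move=> i; exact: l2_0. Qed.
Lemma l2nN f : l2n f -> l2n (- f).
Proof. by move=> lf; rewrite -scaleN1r; exact: l2nZ. Qed.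
Lemma l2nB f h : l2n f -> l2n h -> l2n (f - h).
Proof. by move=> lf lh; apply: l2nD => //; exact: l2nN. Qed.
Lemma ripC f h : rip f h = rip h f.
Proof. by apply: eq_bigr => i _; exact: sdotC. Qed.
Lemma ripD f g h : l2n f -> l2n g -> l2n h -> rip (f + g) h = rip f h + rip g h.
Proof. by move=> lf lg lh; rewrite -big_split; apply: eq_bigr => i _; exact: sdotD. Qed.
Lemma ripZ c f h : l2n f -> l2n h -> rip (c *: f) h = c * rip f h.
Proof. by move=> lf lh; rewrite mulr_sumr; apply: eq_bigr => i _; exact: sdotZ. Qed.
Lemma rip_ge0 f : l2n f -> 0 <= rip f f.
Proof. by move=> lf; apply: sumr_ge0 => i _; exact: sdot_ge0. Qed.
Lemma nsq_le_rip f i x : l2n f -> nsq (f i) x <= rip f f.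
Proof.
move=> lf; apply: (le_trans (nsq_le x (lf i))).
by rewrite /rip (bigD1 i)//= lerDl; apply: sumr_ge0 => j _; exact: sdot_ge0.
Qed.

Lemma rip_eq0 f : l2n f -> rip f f = 0 -> f = 0.
Proof.
move=> lf f0; apply/funext => i; apply/funext => x.
have := nsq_le_rip i x lf; rewrite f0 /nsq.
move=> H; have := sqr_ge0 (Re (f i x)); have := sqr_ge0 (Im (f i x)) => b a.
by apply: eq_ReIm => /=; apply/eqP; rewrite -sqrf_eq0 eq_le sqr_ge0 andbT; lra.
Qed.

End Rip.
End L2.

(** * The action of the group ring *)

Section GroupRingAction.
Variables (R : realType) (G : groupType).
Local Notation C := R[i].
Implicit Types (f h : G -> C) (a b : QG G).

Lemma ratrC (q : rat) : (ratr q : C) = (ratr q : R)%:C%C.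
Proof. by rewrite -(fmorph_rat (real_complex R)). Qed.

Lemma qg_act_incl a f x (S : {fset G}) : (finsupp a `<=` S)%fset ->
  qg_act a f x = \sum_(y <- S) ratr (a y) * f (y^-1 * x)%g.
Proof.
move=> aS; apply: big_fset_incl => // y yS ya.
by rewrite fsfun_dflt// rmorph0 mul0r.
Qed.

Lemma qg_actD a b f x : qg_act (a + b) f x = qg_act a f x + qg_act b f x.
Proof.
pose S := (finsupp a `|` finsupp b)%fset.
have s1 : (finsupp (a + b)%R `<=` S)%fset by exact: finsupp_sub.
rewrite (qg_act_incl _ _ s1) (qg_act_incl _ _ (fsubsetUl _ (finsupp b))).
rewrite (qg_act_incl _ _ (fsubsetUr (finsupp a) _)) -big_split/=.
by apply: eq_bigr => y _; rewrite qgDE rmorphD mulrDl.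
Qed.

Lemma qg_actZ (c : rat) a f x : qg_act (c *: a) f x = ratr c * qg_act a f x.
Proof.
rewrite (qg_act_incl _ _ (qg_finsuppZ c a)) mulr_sumr.
by apply: eq_bigr => y _; rewrite qgZE rmorphM mulrA.
Qed.

Lemma qg_act_delta g f x : qg_act (delta g) f x = f (g^-1 * x)%g.
Proof.
have sS : (finsupp (delta g) `<=` [fset g])%fset by exact: finsupp_sub.
by rewrite (qg_act_incl _ _ sS) big_seq_fset1 deltaE eqxx rmorph1 mul1r.
Qed.

Lemma qg_act_rel (P : QG G -> Prop) : P 0 -> (forall a b, P a -> P b -> P (a + b)) ->
  (forall c a, P a -> P (c *: a)) -> (forall g, P (delta g)) -> forall a, P a.
Proof.
move=> P0 PD PZ Pd a; rewrite (qg_decomp a); apply: (big_ind P) => // y _.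
exact/PZ/Pd.
Qed.

Lemma qg_act0 f x : qg_act 0 f x = 0.
Proof. by rewrite -(scale0r 0) qg_actZ rmorph0 mul0r. Qed.

Lemma qg_actDr a f h x : qg_act a (fun x => f x + h x) x = qg_act a f x + qg_act a h x.
Proof. by rewrite -big_split; apply: eq_bigr => y _; rewrite mulrDr. Qed.

Lemma qg_act_sumr (I : Type) (r : seq I) a (F : I -> G -> C) x :
  qg_act a (fun x => \sum_(i <- r) F i x) x = \sum_(i <- r) qg_act a (F i) x.
Proof. by rewrite exchange_big; apply: eq_bigr => y _; rewrite mulr_sumr. Qed.

Lemma qg_act_suml (I : Type) (r : seq I) (F : I -> QG G) f x :
  qg_act (\sum_(i <- r) F i) f x = \sum_(i <- r) qg_act (F i) f x.
Proof.
apply: (big_morph (fun a => qg_act a f x)) => [a b|]; first exact: qg_actD.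
exact: qg_act0.
Qed.

Lemma qg_actM a b f x : qg_act (a * b) f x = qg_act a (qg_act b f) x.
Proof.
elim/qg_act_rel: a x => [|a c IHa IHc|c a IHa|g] x; first by rewrite mul0r !qg_act0.
- by rewrite mulrDl !qg_actD IHa IHc.
- by rewrite -scalerAl !qg_actZ IHa.
rewrite qg_act_delta; elim/qg_act_rel: b x => [|b c IHb IHc|c b IHb|h] x.
- by rewrite mulr0 !qg_act0.
- by rewrite mulrDr !qg_actD IHb IHc.
- by rewrite -scalerAr !qg_actZ IHb.
- by rewrite deltaM !qg_act_delta invgM mulgA.
Qed.

Lemma qg_act_unit a x : qg_act a (fun x => (x == 1%g)%:R : C) x = ratr (a x).
Proof.
elim/qg_act_rel: a => [|a b IHa IHb|c a IHa|g].
- by rewrite qg_act0 qg0E rmorph0.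
- by rewrite qg_actD qgDE rmorphD IHa IHb.
- by rewrite qg_actZ qgZE rmorphM IHa.
- rewrite qg_act_delta deltaE rmorph_nat; congr ((nat_of_bool _)%:R).
  by apply/eqP/eqP => [E|->]; [rewrite -(mulVKg g x) E mulg1|rewrite mulVg].
Qed.

Lemma l2_translate g f : l2 f -> l2 (fun x => f (g * x)%g).
Proof.
move=> /l2P sf; apply/l2P.
by have [] := sm_reindex (mulKg g) (mulVKg g) sf.
Qed.

Lemma qg_actDE a b f : qg_act (a + b) f = fun x => qg_act a f x + qg_act b f x.
Proof. by apply/funext => x; rewrite qg_actD. Qed.

Lemma qg_actZE c a f : qg_act (c *: a) f = fun x => (ratr c : R)%:C%C * qg_act a f x.
Proof. by apply/funext => x; rewrite qg_actZ ratrC. Qed.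

Lemma qg_act0E f : qg_act 0 f = fun=> 0.
Proof. by apply/funext => x; rewrite qg_act0. Qed.

Lemma qg_act_deltaE g f : qg_act (delta g) f = fun x => f (g^-1 * x)%g.
Proof. by apply/funext => x; rewrite qg_act_delta. Qed.

Lemma l2_qg_act a f : l2 f -> l2 (qg_act a f).
Proof.
move=> lf; elim/qg_act_rel: a => [|a b la lb|c a la|g].
- by rewrite qg_act0E; exact: l2_0.
- by rewrite qg_actDE; exact: l2D.
- by rewrite qg_actZE; exact: l2Z.
- by rewrite qg_act_deltaE; exact: l2_translate.
Qed.

Lemma sdot0 h : sdot (fun=> 0) h = 0.
Proof. by rewrite /sdot -[RHS](@rsum0 R G); congr rsum; apply/funext => x /=; ring. Qed.

Lemma qg_act_adj a f h : l2 f -> l2 h -> sdot (qg_act a f) h = sdot f (qg_act (qg_star a) h).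
Proof.
move=> lf lh; have lfA b := l2_qg_act b lf; have lhA b := l2_qg_act b lh.
elim/qg_act_rel: a => [|a b IHa IHb|c a IHa|g].
- by rewrite star0 !qg_act0E sdot0 sdotC sdot0.
- rewrite starD !qg_actDE (sdotD (lfA a) (lfA b) lh) IHa IHb.
  by rewrite [RHS]sdotC (sdotD (lhA _) (lhA _) lf) ![sdot (qg_act _ h) f]sdotC.
- rewrite starZ !qg_actZE (sdotZ _ (lfA a) lh) IHa.
  by rewrite [RHS]sdotC (sdotZ _ (lhA _) lf) [sdot (qg_act _ h) f]sdotC.
rewrite star_delta !qg_act_deltaE invgK.
have lgh := l2_translate g lh.
have [_ E] := sm_reindex (mulVKg g) (mulKg g) (sm_prod lf lgh).
apply: etrans E; rewrite /sdot; congr rsum.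
by apply/funext => x; rewrite mulVKg.
Qed.

Lemma sdot_sum (I : Type) (r : seq I) (F : I -> G -> C) h : (forall i, l2 (F i)) -> l2 h ->
  l2 (fun x => \sum_(i <- r) F i x) /\
  sdot (fun x => \sum_(i <- r) F i x) h = \sum_(i <- r) sdot (F i) h.
Proof.
move=> lF lh; elim: r => [|i r [IH1 IH2]].
  have -> : (fun x => \sum_(i <- [::]) F i x) = (fun=> 0) by apply/funext => x; rewrite big_nil.
  by rewrite big_nil sdot0; split => //; exact: l2_0.
have -> : (fun x => \sum_(j <- i :: r) F j x) = (fun x => F i x + \sum_(j <- r) F j x).
  by apply/funext => x; rewrite big_cons.
by rewrite sdotD// IH2 big_cons; split => //; exact: l2D.
Qed.

Definition mact m k (A : 'M[QG G]_(m, k)) (f : cfun R G k) : cfun R G m :=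
  fun i x => \sum_j qg_act (A i j) (f j) x.

Definition astar m k (A : 'M[QG G]_(m, k)) : 'M[QG G]_(k, m) := map_mx (@qg_star G) A^T.

Lemma l2n_mact m k (A : 'M[QG G]_(m, k)) (f : cfun R G k) : l2n f -> l2n (mact A f).
Proof.
move=> lf i.
by have [] := @sdot_sum _ (index_enum _) (fun j => qg_act (A i j) (f j)) _
  (fun j => l2_qg_act _ (lf j)) (l2_0 R G).
Qed.

Lemma rip_adj m k (A : 'M[QG G]_(m, k)) (f : cfun R G k) (h : cfun R G m) : l2n f -> l2n h ->
  rip (mact A f) h = rip f (mact (astar A) h).
Proof.
move=> lf lh; rewrite /rip.
under eq_bigr => i _ do rewrite (sdot_sum _ (fun j => l2_qg_act (A i j) (lf j)) (lh i)).2.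
rewrite exchange_big; apply: eq_bigr => j _.
rewrite sdotC (sdot_sum _ (fun i => l2_qg_act (astar A j i) (lh i)) (lf j)).2.
by apply: eq_bigr => i _; rewrite qg_act_adj// [RHS]sdotC !mxE.
Qed.

Lemma mactM m k l (A : 'M[QG G]_(m, k)) (B : 'M[QG G]_(k, l)) (f : cfun R G l) :
  mact (A *m B) f = mact A (mact B f).
Proof.
apply/funext => i; apply/funext => x; rewrite /mact.
under [RHS]eq_bigr do rewrite qg_act_sumr.
rewrite exchange_big; apply: eq_bigr => j _.
rewrite mxE qg_act_suml; apply: eq_bigr => n _; exact: qg_actM.
Qed.

Lemma mactD m k (A B : 'M[QG G]_(m, k)) (f : cfun R G k) : mact (A + B) f = mact A f + mact B f.
Proof.
apply/funext => i; apply/funext => x.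
rewrite -[RHS]/(mact A f i x + mact B f i x) -big_split; apply: eq_bigr => j _.
by rewrite mxE qg_actD.
Qed.

Lemma mact0 m k (f : cfun R G k) : mact (0 : 'M[QG G]_(m, k)) f = 0.
Proof.
apply/funext => i; apply/funext => x; rewrite /mact big1// => j _.
by rewrite mxE qg_act0.
Qed.

Lemma mactr0 m k (A : 'M[QG G]_(m, k)) : mact A 0 = 0.
Proof.
apply/funext => i; apply/funext => x; rewrite /mact big1// => j _.
by rewrite /qg_act big1// => y _; rewrite mulr0.
Qed.

Lemma mact_zeta m k (U : 'M[QG G]_(m, k)) i j x :
  mact U (zeta R i) j x = ratr (U j i x).
Proof.
rewrite /mact (bigD1 i)//= big1 ?addr0 => [|l li].
  rewrite -qg_act_unit; congr (qg_act _ _ _); apply/funext => y.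
  by rewrite /zeta eqxx.
rewrite /qg_act big1// => y _; rewrite /zeta (negPf li).
by rewrite mulr0.
Qed.

Lemma mact1_zeta k i : mact (1%:M : 'M[QG G]_k) (zeta R i) = zeta R i :> cfun R G k.
Proof.
apply/funext => j; apply/funext => x; rewrite mact_zeta mxE /zeta.
by case: eqP => _ /=; rewrite ?mulr1n ?mulr0n ?qg1E ?qg0E ?rmorph0 ?rmorph_nat.
Qed.

Lemma l2n_zeta k (i : 'I_k) : l2n (zeta R i : cfun R G k).
Proof.
move=> j; apply/l2P; have [s1 _] := @rsum_unit R G (fun=> 1) 1%g.
apply: sm_le s1 => x; rewrite mul1r ger0_norm ?nsq_ge0// /nsq /zeta.
by case: eqP; case: eqP => /= _ _; rewrite expr0n ?expr1n ?addr0.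
Qed.

Lemma l2n_dot_zeta k (f : cfun R G k) i : l2n_dot f (zeta R i) = f i 1%g.
Proof.
rewrite /l2n_dot (bigD1 i)//= big1 ?addr0 => [|j ji].
  rewrite /csum; apply: eq_ReIm => /=.
    rewrite -[RHS](rsum_unit (fun x => Re (f i x)) 1%g).2; congr rsum.
    apply/funext => x; rewrite /zeta eqxx /=.
    by case: (f i x) => a b; case: eqP => _ /=; rewrite ?oppr0 ?mulr0 ?subr0 ?mulr1.
  rewrite -[RHS](rsum_unit (fun x => Im (f i x)) 1%g).2; congr rsum.
  apply/funext => x; rewrite /zeta eqxx /=.
  by case: (f i x) => a b; case: eqP => _ /=; rewrite ?oppr0 ?mulr0 ?add0r ?mulr1.
rewrite /csum; apply: eq_ReIm => /=; rewrite -[RHS](@rsum0 R G); congr rsum;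
  apply/funext => x; rewrite /zeta (negPf ji) /= conjC0 mulr0//.
Qed.

Lemma rip_zeta k (f : cfun R G k) i : rip f (zeta R i) = Re (f i 1%g).
Proof.
rewrite -l2n_dot_zeta /l2n_dot Re_sum; apply: eq_bigr => j _; rewrite /csum /=.
congr rsum; apply/funext => x.
by case: (f j x) (zeta R i j x) => [a b] [c d] /=; ring.
Qed.

(** The imaginary part is the real product with [i h]. Real orthogonality to a complex subspace is
    therefore complex orthogonality. *)
Lemma l2n_dotE k (f h : cfun R G k) : l2n_dot f h =
  (rip f h +i* rip f (fun i x => (0 +i* 1) * h i x))%C.
Proof.
apply: eq_ReIm; rewrite /l2n_dot ?Re_sum ?Im_sum; apply: eq_bigr => j _; rewrite /csum /=;
  congr rsum; apply/funext => x;
  by case: (f j x) (h j x) => [a b] [c d] /=; ring.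
Qed.

End GroupRingAction.

(** * Von Neumann dimension of kernels *)

Lemma cvg_sqr_small (R : realType) (u e : nat -> R) :
  (forall n, u n ^+ 2 <= e n) -> e n @[n --> \oo] --> 0 -> u n @[n --> \oo] --> 0.
Proof.
move=> ue /cvgrPdist_lt e0; apply/cvgrPdist_lt => d d0.
have := e0 (d ^+ 2) (ltac:(by rewrite exprn_gt0)); apply: filterS => n.
rewrite !sub0r !normrN => en; rewrite -(ltr_pXn2r (n := 2))// ?nnegrE ?ltW// real_normK ?num_real//.
by apply: le_lt_trans (ue n) (le_lt_trans (ler_norm _) en).
Qed.

Section Kernel.
Variables (R : realType) (G : groupType) (m k : nat) (A : 'M[QG G]_(m, k)).
Local Notation C := R[i].
Local Notation H := (@l2n R G k).

Definition kerA : set (cfun R G k) := [set f | l2n f /\ mact A f = 0].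

Lemma Re_qg_act a (f : G -> C) x :
  Re (qg_act a f x) = \sum_(y <- finsupp a) ratr (a y) * Re (f (y^-1 * x)%g).
Proof. by rewrite Re_sum; apply: eq_bigr => y _; rewrite ratrC ReZ. Qed.

Lemma Im_qg_act a (f : G -> C) x :
  Im (qg_act a f x) = \sum_(y <- finsupp a) ratr (a y) * Im (f (y^-1 * x)%g).
Proof. by rewrite Im_sum; apply: eq_bigr => y _; rewrite ratrC ImZ. Qed.

(** The limit is taken pointwise. Finite partial sums inherit the Cauchy bound, as in Fatou's lemma,
    which gives square summability and convergence in norm. *)
Lemma kerA_complete (v : nat -> cfun R G k) : (forall n, kerA (v n)) ->
  (forall e : R, 0 < e -> exists N, forall m n, (N <= m)%N -> (N <= n)%N ->
     rip (v m - v n) (v m - v n) <= e) ->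
  exists2 w, kerA w & forall e : R, 0 < e -> exists N, forall n, (N <= n)%N ->
     rip (v n - w) (v n - w) <= e.
Proof.
move=> vV vC.
have Hv n : H (v n) by have [] := vV n.
have nsq_v m' n i x : nsq ((v m' - v n) i) x =
    (Re (v m' i x) - Re (v n i x)) ^+ 2 + (Im (v m' i x) - Im (v n i x)) ^+ 2.
  by rewrite /nsq -[(v m' - v n) i x]/(v m' i x - v n i x) ReB ImB.
have sq_le (x y e : R) : 0 < e -> x ^+ 2 + y ^+ 2 <= e ^+ 2 -> `|x| <= e /\ `|y| <= e.
  move=> e0 xy; split; rewrite -(ler_pXn2r (n := 2)) ?nnegrE ?normr_ge0 ?(ltW e0)//;
    rewrite real_normK ?num_real//; apply: le_trans xy; rewrite ?lerDl ?lerDr; exact: sqr_ge0.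
have pw (e : R) : 0 < e -> exists N, forall m' n, (N <= m')%N -> (N <= n)%N ->
    forall i x, `|Re (v m' i x) - Re (v n i x)| <= e /\ `|Im (v m' i x) - Im (v n i x)| <= e.
  move=> e0; have [N NP] := vC (e ^+ 2) (ltac:(by rewrite exprn_gt0)).
  exists N => m' n Nm Nn i x; apply: sq_le => //; rewrite -nsq_v.
  by apply: le_trans (NP _ _ Nm Nn); apply: nsq_le_rip; exact: l2nB.
have /choice[l lP] (ix : 'I_k * G) : exists l : R * R,
    (Re (v n ix.1 ix.2) @[n --> \oo] --> l.1) /\ (Im (v n ix.1 ix.2) @[n --> \oo] --> l.2).
  have [l1 l1P] : exists l : R, Re (v n ix.1 ix.2) @[n --> \oo] --> l.
    apply: cauchy_lim => e /pw[N NP]; exists N => m' n Nm Nn.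
    by have [] := NP _ _ Nm Nn ix.1 ix.2.
  have [l2 l2P] : exists l : R, Im (v n ix.1 ix.2) @[n --> \oo] --> l.
    apply: cauchy_lim => e /pw[N NP]; exists N => m' n Nm Nn.
    by have [] := NP _ _ Nm Nn ix.1 ix.2.
  by exists (l1, l2).
pose w : cfun R G k := fun i x => ((l (i, x)).1 +i* (l (i, x)).2)%C.
have Rew i x : Re (v n i x) @[n --> \oo] --> Re (w i x) by have [] := lP (i, x).
have Imw i x : Im (v n i x) @[n --> \oo] --> Im (w i x) by have [] := lP (i, x).
have lim_le (e : R) : 0 < e -> exists N, forall n, (N <= n)%N ->
    H (v n - w) /\ rip (v n - w) (v n - w) <= e.
  (* Each of the [k] components is bounded by this share of [e]; dividing by [k.+1] covers
     [k = 0]. *)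
  move=> e0; have k0 : 0 < e / k.+1%:R by rewrite divr_gt0.
  have [N NP] := vC _ k0; exists N => n Nn.
  have comp i : sm (nsq ((v n - w) i)) /\ psum (nsq ((v n - w) i)) <= e / k.+1%:R.
    apply: psum_le_bound => [x|X]; first exact: nsq_ge0.
    have cv : \sum_(x <- X) nsq ((v n - v p) i) x @[p --> \oo] -->
        \sum_(x <- X) nsq ((v n - w) i) x.
      apply: cvg_bigD => x; under eq_cvg do rewrite nsq_v.
      rewrite /nsq -[(v n - w) i x]/(v n i x - w i x) ReB ImB.
      by apply: cvgD; apply: cvgM; apply: cvgB; (exact: cvg_cst || exact: Rew || exact: Imw).
    apply: (cvgr_to_le cv); exists N => // p /= Np.
    apply: le_trans (NP _ _ Nn Np).
    have ls := l2nB (Hv n) (Hv p).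
    have -> : rip (v n - v p) (v n - v p) =
      \sum_(j < k) psum (nsq ((v n - v p) j)).
      by apply: eq_bigr => j _; rewrite sdot_psum//; exact: ls.
    rewrite (bigD1 i)//=; apply: ler_wpDr.
      by apply: sumr_ge0 => j _; apply: psum_ge0; exact: nsq_ge0.
    by apply: psum_fset; [exact: nsq_ge0|exact: (l2P _).1 (ls i)].
  have Hvw : H (v n - w) by move=> i; apply/l2P; exact: (comp i).1.
  split => //; have -> : rip (v n - w) (v n - w) = \sum_(j < k) psum (nsq ((v n - w) j)).
    by apply: eq_bigr => j _; rewrite sdot_psum//; exact: Hvw.
  apply: (@le_trans _ _ (\sum_(j < k) (e / k.+1%:R))).
    by apply: ler_sum => j _; exact: (comp j).2.
  rewrite sumr_const card_ord -[_ *+ k]mulr_natr -mulrA.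
  apply: ler_piMr; first exact: ltW.
  by rewrite mulrC ler_pdivrMr ?ltr0n// mul1r ler_nat.
have Hw : H w.
  have [N /(_ N (leqnn N))[Hvw _]] := lim_le 1 ltr01.
  have -> : w = v N - (v N - w) by rewrite opprB addrC subrK.
  exact: l2nB.
exists w; last by move=> e /lim_le[N NP]; exists N => n /NP[].
split => //; apply/funext => i; apply/funext => x.
have z n : mact A (v n) i x = 0 by have [_ ->] := vV n.
apply: eq_ReIm.
(* One value of the image involves finitely many values of the argument, so pointwise convergence
   suffices. *)
- have c1 : Re (mact A (v n) i x) @[n --> \oo] --> Re (mact A w i x).
    rewrite /mact Re_sum; under eq_cvg do rewrite Re_sum.
    apply: cvg_bigD => j; rewrite Re_qg_act; under eq_cvg do rewrite Re_qg_act.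
    by apply: cvg_bigD => y; apply: cvgMr; exact: Rew.
  have c2 : Re (mact A (v n) i x) @[n --> \oo] --> (0 : R).
    by under eq_cvg do rewrite z; exact: cvg_cst.
  by rewrite (cvg_unique _ c1 c2).
- have c1 : Im (mact A (v n) i x) @[n --> \oo] --> Im (mact A w i x).
    rewrite /mact Im_sum; under eq_cvg do rewrite Im_sum.
    apply: cvg_bigD => j; rewrite Im_qg_act; under eq_cvg do rewrite Im_qg_act.
    by apply: cvg_bigD => y; apply: cvgMr; exact: Imw.
  have c2 : Im (mact A (v n) i x) @[n --> \oo] --> (0 : R).
    by under eq_cvg do rewrite z; exact: cvg_cst.
  by rewrite (cvg_unique _ c1 c2).
Qed.

End Kernel.

Lemma sub_add3 (Z : zmodType) (u w e p : Z) : u + w + e - (u + p) = w + (e - p).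
Proof. by rewrite -(addrA u) opprD addrACA subrr add0r addrA. Qed.

Section DimKer.
Variables (R : realType) (G : groupType) (m k : nat) (A : 'M[QG G]_(m, k)).
Local Notation C := R[i].
Local Notation V := (@kerA R G m k A).

Lemma mactDr n p (B : 'M[QG G]_(n, p)) (f h : cfun R G p) :
  mact B (f + h) = mact B f + mact B h.
Proof.
apply/funext => i; apply/funext => x.
rewrite -[RHS]/(mact B f i x + mact B h i x) -big_split; apply: eq_bigr => j _.
by rewrite -[RHS]qg_actDr.
Qed.

Lemma mactZr n p (B : 'M[QG G]_(n, p)) (c : C) (f : cfun R G p) :
  mact B (fun i x => c * f i x) = fun i x => c * mact B f i x.
Proof.
apply/funext => i; apply/funext => x; rewrite mulr_sumr; apply: eq_bigr => j _.
by rewrite mulr_sumr; apply: eq_bigr => y _; rewrite mulrCA.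
Qed.

Lemma rip_le_add (d p : cfun R G k) : l2n d -> l2n p -> rip d p = 0 ->
  rip p p <= rip (d + p) (d + p).
Proof.
move=> ld lp d0; have ldp := l2nD ld lp.
rewrite (ripD ld lp ldp) (ripC d) (ripC p (d + p)) (ripD ld lp ld) (ripD ld lp lp).
by rewrite (ripC p d) d0 addr0 add0r lerDr; exact: rip_ge0.
Qed.

Lemma kerA_D f h : V f -> V h -> V (f + h).
Proof.
move=> [lf f0] [lh h0]; split; first exact: l2nD.
by rewrite mactDr f0 h0 addr0.
Qed.

Lemma kerA_Z (c : C) (f : cfun R G k) : V f -> V (fun i x => c * f i x).
Proof.
move=> [lf f0]; split; first by move=> i; exact: l2Z.
by rewrite mactZr f0; apply/funext => i; apply/funext => x; rewrite mulr0.
Qed.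

Lemma kerA_0 : V 0.
Proof. by split; [exact: l2n0|exact: mactr0]. Qed.

Lemma kerA_projection (f : cfun R G k) : l2n f ->
  exists2 p, V p & forall h, V h -> rip (f - p) h = 0.
Proof.
apply: (@projection_exists R (cfun R G k) (@l2n R G k) V (@rip R G k)).
- exact: l2nD.
- exact: l2nZ.
- by move=> h [].
- exact: kerA_0.
- exact: kerA_D.
- by move=> c h Vh; exact: kerA_Z.
- exact: ripC.
- exact: ripD.
- exact: ripZ.
- exact: rip_ge0.
- exact: kerA_complete.
Qed.

Lemma mact_ker (S : 'M[QG G]_k) : mx_ker (R := R) S = [set f | l2n f /\ mact S f = 0].
Proof.
apply/seteqP; split => f [lf f0]; split => //.
  by apply/funext => i; apply/funext => x; exact: f0.
by move=> i x; rewrite -[LHS]/(mact S f i x) f0.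
Qed.

Lemma ker_gram n p (B : 'M[QG G]_(n, p)) (f : cfun R G p) : l2n f ->
  mact (astar B *m B) f = 0 -> mact B f = 0.
Proof.
move=> lf f0; apply: rip_eq0; first exact: l2n_mact.
by rewrite rip_adj//; [rewrite -mactM f0 ripC /rip big1// => i _; exact: sdot0|exact: l2n_mact].
Qed.

Let T : 'M[QG G]_k := astar A *m A.

(** Betti numbers need square matrices, so [A] is replaced by [T = astar A *m A]. The definition of
    the dimension squares once more, hence [ker_gram] is used twice. *)
Lemma ker_T : mx_ker (R := R) (mx_star T *m T) = V.
Proof.
rewrite mact_ker; apply/seteqP; split => f [lf f0]; split => //.
  by apply: ker_gram => //; apply: ker_gram.
by rewrite mactM /T mactM f0 !mactr0.
Qed.

(** Apply [U + W A + E = 1] to [zeta]: the first term lies in the kernel, the second is orthogonal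
    to it. So [P zeta] is [U zeta + P (E zeta)], and since [P] does not increase norms, the diagonal
    entries of [U] converge to those of [P]. *)
Lemma dim_ker_approx (U : nat -> 'M[QG G]_k) (W : nat -> 'M[QG G]_(k, m))
    (E : nat -> QG G) (r : R) :
  (forall n, A *m U n = 0) -> (forall n, astar (U n) = U n) ->
  (forall n, qg_star (E n) = E n) ->
  (forall n, U n + W n *m A = (1 - E n)%:M) ->
  (ratr (tau (E n * E n)) : R) @[n --> \oo] --> (0 : R) ->
  (\sum_i ratr (tau (U n i i)) : R) @[n --> \oo] --> r ->
  dim_ker T r.
Proof.
move=> AU sU sE UWA E0 Ur.
have /choice[P PP] (f : cfun R G k) : exists p, l2n f ->
    V p /\ forall h, V h -> rip (f - p) h = 0.
  have [lf|nlf] := pselect (l2n f); last by exists 0.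
  by have [p Vp pf] := kerA_projection lf; exists p.
exists P.
  move=> f lf; rewrite ker_T; have [VP fP] := PP f lf; split => // h Vh.
  rewrite -[fun i x => f i x - P f i x]/(f - P f) l2n_dotE !fP//.
  exact: kerA_Z.
pose e n i : cfun R G k := mact (E n)%:M (zeta R i).
have le n i : l2n (e n i) by apply: l2n_mact; exact: l2n_zeta.
have norm_e n i : rip (e n i) (e n i) = ratr (tau (E n * E n)).
  rewrite rip_adj//; last exact: l2n_zeta.
  rewrite ripC -mactM rip_zeta mact_zeta ratrC /=.
  suff -> : astar (E n)%:M *m (E n)%:M = (E n * E n)%:M :> 'M[QG G]_k by rewrite mxE eqxx.
  have -> : astar (E n)%:M = (E n)%:M :> 'M[QG G]_k.
    apply/matrixP => a b; rewrite !mxE eq_sym; case: eqP => _; rewrite ?mulr1n ?mulr0n//.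
    exact: star0.
  by rewrite -scalar_mxM.
have dec n i : P (zeta R i) = mact (U n) (zeta R i) + P (e n i).
  have lz := @l2n_zeta R G k i; have [VPz zP] := PP _ lz; have [VPe eP] := PP _ (le n i).
  have Vu : V (mact (U n) (zeta R i)).
    by split; [exact: l2n_mact|rewrite -mactM AU mact0].
  pose q := mact (U n) (zeta R i) + P (e n i).
  have Vq : V q by exact: kerA_D.
  have qP h : V h -> rip (zeta R i - q) h = 0.
    move=> Vh; have [lh h0] := Vh.
    have zE : zeta R i = mact (U n) (zeta R i) + mact (W n *m A) (zeta R i) + e n i :> cfun R G k.
      by rewrite -mactD UWA -mactD -raddfD /= subrK mact1_zeta.
    have -> : zeta R i - q = mact (W n *m A) (zeta R i) + (e n i - P (e n i)) :> cfun R G k.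
      by rewrite [X in X - _]zE /q; exact: sub_add3.
    have lWA : l2n (mact (W n *m A) (zeta R i)) by exact: l2n_mact.
    have leP : l2n (e n i - P (e n i)) by exact: l2nB (le n i) VPe.1.
    rewrite (ripD lWA leP lh) eP// addr0.
    rewrite rip_adj//.
    (* Self-adjoint as a difference of self-adjoint matrices, so its range is orthogonal to the
       kernel of [A]. *)
    have -> : astar (W n *m A) = W n *m A.
      have -> : W n *m A = (1 - E n)%:M - U n by rewrite -(UWA n) addrAC subrr add0r.
      have sB (X Y : 'M[QG G]_k) : astar (X - Y) = astar X - astar Y.
        by apply/matrixP => a b; rewrite !mxE starD starN.
      rewrite sB sU; congr (_ - _); apply/matrixP => a b.
      rewrite !mxE eq_sym; case: eqP => _; rewrite ?mulr1n ?mulr0n ?star0//.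
      by rewrite starD starN star1 sE.
    by rewrite mactM h0 mactr0 ripC /rip big1// => j _; exact: sdot0.
  apply/eqP; rewrite -subr_eq0; apply/eqP; apply: rip_eq0.
    exact: l2nB VPz.1 Vq.1.
  have Vd : V (P (zeta R i) - q).
    apply: kerA_D => //; have := kerA_Z (-1) Vq.
    by congr (V _); apply/funext => a; apply/funext => b; rewrite mulN1r.
  have ld : l2n (P (zeta R i) - q) := Vd.1.
  have := qP _ Vd; have -> : zeta R i - q = (zeta R i - P (zeta R i)) + (P (zeta R i) - q) :> cfun R G k.
    by rewrite addrA subrK.
  have lzP : l2n (zeta R i - P (zeta R i)) by exact: l2nB lz VPz.1.
  by rewrite (ripD lzP ld ld) zP// add0r.
have small n i : Re (P (e n i) i 1%g) ^+ 2 + Im (P (e n i) i 1%g) ^+ 2 <= ratr (tau (E n * E n)).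
  have [VPe eP] := PP _ (le n i); have lPe : l2n (P (e n i)) := VPe.1.
  have lr : l2n (e n i - P (e n i)) by exact: l2nB (le n i) lPe.
  apply: (le_trans (nsq_le_rip i 1%g lPe)).
  rewrite -(norm_e n i).
  have d0 : rip (e n i - P (e n i)) (P (e n i)) = 0 by exact: eP.
  by have := rip_le_add lr lPe d0; rewrite subrK.
have Re_lim i : (ratr (tau (U n i i)) : R) @[n --> \oo] --> Re (P (zeta R i) i 1%g).
  apply/subr_cvg0; rewrite /=.
  apply: (cvg_sqr_small (e := fun n => ratr (tau (E n * E n)))) => // n.
  rewrite (dec n i) -[(_ + _) i 1%g]/(mact (U n) (zeta R i) i 1%g + P (e n i) i 1%g).
  rewrite mact_zeta ReD ratrC /= -/(tau (U n i i)) opprD addrA subrr add0r sqrrN.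
  by apply: le_trans (small n i); rewrite lerDl sqr_ge0.
(* The entries of [U] are rational, so the imaginary part comes from the error term alone. *)
have Im_0 i : Im (P (zeta R i) i 1%g) = 0.
  apply/eqP; rewrite -sqrf_eq0 eq_le sqr_ge0 andbT.
  apply: (cvgr_to_ge E0); near=> n.
  rewrite (dec n i) -[(_ + _) i 1%g]/(mact (U n) (zeta R i) i 1%g + P (e n i) i 1%g).
  rewrite mact_zeta ImD ratrC /= add0r.
  by apply: le_trans (small n i); rewrite lerDr sqr_ge0.
rewrite /vN_trace; under eq_bigr do rewrite l2n_dot_zeta.
apply: eq_ReIm => /=; rewrite ?Re_sum ?Im_sum; last by rewrite big1.
apply: (cvg_unique _ _ Ur) => //.
by apply: cvg_bigD.
Unshelve. all: by end_near.
Qed.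

End DimKer.

(** * The walk operator *)

Section Operator.
Local Notation Gam := (grp ^ 3)%type.
Local Notation Q := (QG Gam).
Local Notation zt i := (zat (tape_t i) (tape_t' i) (tape_z i)).
Local Notation ot i := (oat (tape_t i) (tape_t' i) (tape_z i)).
Local Notation bt i := (blk (tape_t i) (tape_t' i) (tape_z i)).
Local Notation et i := (unt (tape_t i) (tape_t' i) (tape_z i)).
Local Notation Utt := (Unt tape_t tape_t' tape_z).
Local Notation bone := (box_one tape_t tape_t' tape_z).
Local Notation bmx := (blockmx tape_t tape_t' tape_z).

Definition elt (i : 'I_3) (g : move) : Q :=
  match g with
  | Stay => alive (tape_z i)
  | Start => at_start (tape_t i) (tape_t' i) (tape_z i)
  | End => at_end (tape_t i) (tape_t' i) (tape_z i)
  | Start' => at_start' (tape_t i) (tape_t' i) (tape_z i)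
  | End' => at_end' (tape_t i) (tape_t' i) (tape_z i)
  | Forth => forth (tape_t i) (tape_z i)
  | Back => back (tape_t' i) (tape_z i)
  end.

Definition mono (m : move * move * move) : Q := elt i0 m.1.1 * elt i1 m.1.2 * elt i2 m.2.

Definition walk_op : 'M[Q]_(4, 3) :=
  \matrix_(i, j) ((i == j :> nat)%:R - \sum_(m <- rules i j) mono m).

Lemma loc1_ext (i : 'I_3) x M N : loc1 (tape_t i) (tape_t' i) (tape_z i) x M ->
  (forall n r p, (r < n)%N -> (p < n)%N -> M n r p = N n r p) ->
  loc1 (tape_t i) (tape_t' i) (tape_z i) x N.
Proof.
move=> xM MN n p q pn qn; have [-> ->] := xM n p q pn qn.
by split; apply: eq_bigr => r _; rewrite MN.
Qed.

Lemma cond_source (c : nat -> bool) r p :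
  ((if c r then Some r else None) == Some p) = (r == p) && c p.
Proof.
have [->|rp] := eqVneq r p; first by case: (c p); rewrite ?eqxx.
by case: (c r) => //=; rewrite (inj_eq Some_inj) (negPf rp).
Qed.

Lemma elt_loc1 i g : loc1 (tape_t i) (tape_t' i) (tape_z i) (elt i g)
  (fun n r p => (source g n r == Some p)%:R).
Proof.
have t1 := tape_tK' i; have t2 := tape_t'K i; have zz := tape_z_id i; have zC := tape_zatC i.
case: g => /=.
- by apply: (loc1_ext (loc1_alive t1 zz zC)).
- apply: (loc1_ext (loc1_start t1 t2 zz zC)) => n r p _ _.
  by rewrite (cond_source (fun r => r == 0%N)).
- apply: (loc1_ext (loc1_end t1 t2 zz zC)) => n r p _ _.
  by rewrite (cond_source (fun r => r.+1 == n)).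
- apply: (loc1_ext (loc1_start' t1 t2 zz zC)) => n r p _ _.
  by rewrite (cond_source (fun r => (r == 0%N) && (r.+1 != n))).
- apply: (loc1_ext (loc1_end' t1 t2 zz zC)) => n r p _ _.
  by rewrite (cond_source (fun r => (r.+1 == n) && (r != 0%N))).
- apply: (loc1_ext (loc1_forth t1 t2 zz zC)) => n r p _ _.
  by case: r.
- by apply: (loc1_ext (loc1_back t1 t2 zz zC)).
Qed.

Lemma tape_elt_elt i g : tape_elt tape_t tape_t' tape_z i (elt i g).
Proof.
have [[Ta Ts Te Ts' Te'] [Tf Tb]] := tape_gens tape_t tape_t' tape_z i.
by case: g; [exact: Ta|exact: Ts|exact: Te|exact: Ts'|exact: Te'|exact: Tf|exact: Tb].
Qed.

Lemma alive_elt i g : alive (tape_z i) * elt i g = elt i g.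
Proof.
have zz := tape_z_id i.
have [[Es Ee Es' Ee'] [Ef Eb]] := alive_gens (tape_t i) (tape_t' i) zz.
by case: g; [exact: alive_id zz|exact: Es|exact: Ee|exact: Es'|exact: Ee'|exact: Ef|exact: Eb].
Qed.

Lemma all_aliveE : all_alive = elt i0 Stay * elt i1 Stay * elt i2 Stay.
Proof. by rewrite /all_alive /oat !zat0. Qed.

Lemma all_alive_mono m : all_alive * mono m = mono m.
Proof.
rewrite all_aliveE (tape_mul3 tape_tK' tape_t'K tape_ttC tape_tzC tape_zzC); try exact: tape_elt_elt.
by rewrite !alive_elt.
Qed.

Lemma all_alive_id : all_alive * all_alive = all_alive.
Proof. by rewrite [X in _ * X = X]all_aliveE; exact: (all_alive_mono (Stay, Stay, Stay)). Qed.

Lemma all_alive_Unt n (p q : box n) : all_alive * Utt p q = Utt p q.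
Proof.
rewrite all_aliveE (tape_mul3 tape_tK' tape_t'K tape_ttC tape_tzC tape_zzC); try exact: tape_elt_elt;
  try exact: tape_unt.
by rewrite /= !alive_unt//; exact: tape_z_id || exact: tape_tK' || exact: tape_zatC.
Qed.

Lemma Unt_all_alive n (p q : box n) : Utt p q * all_alive = Utt p q.
Proof.
rewrite all_aliveE (tape_mul3 tape_tK' tape_t'K tape_ttC tape_tzC tape_zzC); try exact: tape_elt_elt;
  try exact: tape_unt.
by rewrite /= !unt_alive//; exact: tape_z_id || exact: tape_tK' || exact: tape_zatC.
Qed.

Lemma loc_ext (x : Q) M N : loc tape_t tape_t' tape_z x M ->
  (forall n r p, M n r p = N n r p) -> loc tape_t tape_t' tape_z x N.
Proof.
move=> xM MN n p q; have [-> ->] := xM n p q.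
by split; apply: eq_bigr => r _; rewrite MN.
Qed.

Lemma mono_loc m : loc tape_t tape_t' tape_z (mono m) (mono_mx m).
Proof.
exact: (loc_mono tape_tK' tape_t'K tape_ttC tape_tzC tape_zzC (@tape_elt_elt _ _) (@tape_elt_elt _ _)
  (@tape_elt_elt _ _) (@elt_loc1 i0 m.1.1) (@elt_loc1 i1 m.1.2) (@elt_loc1 i2 m.2)).
Qed.

Lemma loc_one : loc tape_t tape_t' tape_z 1 (fun n r p => (r == p)%:R).
Proof.
move=> n p q; rewrite mul1r mulr1 (bigD1 p)//= eqxx scale1r big1 ?addr0; last first.
  by move=> r /negPf ->; rewrite scale0r.
rewrite (bigD1 q)//= eqxx scale1r big1 ?addr0// => r.
by rewrite eq_sym => /negPf ->; rewrite scale0r.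
Qed.

Lemma walk_op_loc i j : loc tape_t tape_t' tape_z (walk_op i j) (@rule_mx i j).
Proof.
rewrite mxE; apply: locD.
  case: eqP => _; first exact: loc_one.
  by apply: (loc_ext (loc0 tape_t tape_t' tape_z)).
apply: locN; elim: (rules i j) => [|m r IH].
  by rewrite big_nil; apply: (loc_ext (loc0 tape_t tape_t' tape_z)) => n r p; rewrite big_nil.
rewrite big_cons; apply: (loc_ext (locD (mono_loc m) IH)) => n s p.
by rewrite big_cons.
Qed.

(* Cells with a head on a blank belong to no box: there [walk_op] is the identity, so
   that they do not contribute to the kernel. *)
Definition dead_mx : 'M[Q]_(3, 4) := \matrix_(i, j) ((1 - all_alive) *+ (i == j :> nat)).

Lemma dead_walk_op : dead_mx *m walk_op = (1 - all_alive)%:M.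
Proof.
apply/matrixP => i k; rewrite !mxE.
have i4 : (i < 4)%N by rewrite (ltn_trans (ltn_ord i)).
rewrite (bigD1 (Ordinal i4))//= big1 ?addr0; last first.
  by move=> j; rewrite mxE -val_eqE eq_sym /= => /negPf ->; rewrite mulr0n mul0r.
rewrite !mxE eqxx mulr1n mulrBr mulr_sumr big1 ?subr0; last first.
  by move=> m _; rewrite mulrBl mul1r all_alive_mono subrr.
by rewrite mulr_natr.
Qed.

End Operator.

Lemma mul3_rev (A : pzRingType) (x y w : A) : GRing.comm x y -> GRing.comm x w ->
  GRing.comm y w -> w * (y * x) = x * y * w.
Proof. by move=> xy xw yw; rewrite -xy mulrA -xw -mulrA -yw mulrA. Qed.

Section Approximants.
Local Notation Gam := (grp ^ 3)%type.
Local Notation Q := (QG Gam).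
Local Notation zt i := (zat (tape_t i) (tape_t' i) (tape_z i)).
Local Notation ot i := (oat (tape_t i) (tape_t' i) (tape_z i)).
Local Notation bt i := (blk (tape_t i) (tape_t' i) (tape_z i)).
Local Notation et i := (unt (tape_t i) (tape_t' i) (tape_z i)).
Local Notation Utt := (Unt tape_t tape_t' tape_z).
Local Notation bone := (box_one tape_t tape_t' tape_z).
Local Notation bmx := (blockmx tape_t tape_t' tape_z).

Lemma starX (x : Q) j : qg_star (x ^+ j) = qg_star x ^+ j.
Proof. by elim: j => [|j IH]; rewrite ?star1// exprS starM IH -exprSr. Qed.

Lemma star_zat i j : qg_star (zt i j) = zt i j.
Proof. by rewrite /zat -lock !starM !starX star_tape_t star_tape_t' star_tape_z mulrA. Qed.

Lemma star_oat i j : qg_star (ot i j) = ot i j.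
Proof. by rewrite /oat starD starN star1 star_zat. Qed.

Lemma star_blk i n : qg_star (bt i n) = bt i n.
Proof.
have zpC j m : zt i j * \prod_(k < m) ot i k.+1 = \prod_(k < m) ot i k.+1 * zt i j.
  by apply: commr_prod => k _; apply: commrB; [exact: commr1|exact: tape_zatC].
have sp m : qg_star (\prod_(k < m) ot i k.+1) = \prod_(k < m) ot i k.+1.
  elim: m => [|m IH]; first by rewrite big_ord0 star1.
  rewrite big_ord_recr/= starM IH star_oat.
  by rewrite /oat mulrBl mulrBr mul1r mulr1 zpC.
rewrite /blk -lock !starM !star_zat sp mulrA (zpC n.+1).
by rewrite -[LHS]mulrA tape_zatC mulrA (zpC 0%N).
Qed.

Lemma star_unt i n p q : qg_star (et i n p q) = et i n q p.
Proof. by rewrite /unt -!lock !starM !starX star_tape_t star_tape_t' star_blk mulrA. Qed.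

Lemma commU i j n p q m r s : i != j -> GRing.comm (et i n p q) (et j m r s).
Proof.
move=> ij; apply: (tape_comm tape_tK' tape_t'K tape_ttC tape_tzC tape_zzC ij); exact: tape_unt.
Qed.

Lemma star_Unt n (p q : box n) : qg_star (Utt p q) = Utt q p.
Proof.
rewrite /Unt !starM !star_unt.
by apply: mul3_rev; apply: commU; rewrite ?i01 ?i02 ?i12.
Qed.

Lemma comm_oat i j : i != j -> GRing.comm (ot i 0) (ot j 0).
Proof.
move=> ij; rewrite /oat !zat0; apply: commrB; first exact: commr1.
by apply/commr_sym/commrB; [exact: commr1|apply/commr_sym; exact: tape_zzC].
Qed.

Lemma star_all_alive : qg_star all_alive = all_alive.
Proof.
rewrite /all_alive !starM !star_oat.
by apply: mul3_rev; apply: comm_oat; rewrite ?i01 ?i02 ?i12.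
Qed.

Definition weight (n : nat * nat * nat) : rat := 2^-1 ^+ (n.1.1 + n.1.2 + n.2 + 6).
Definition volume (n : nat * nat * nat) : nat := n.1.1 * n.1.2 * n.2.

Lemma star_box_one n : qg_star (bone n) = bone n.
Proof. by rewrite star_sum; apply: eq_bigr => p _; exact: star_Unt. Qed.

Lemma tau_box_one n : tau (bone n) = (volume n)%:R * weight n.
Proof.
rewrite tau_sum; under eq_bigr do rewrite tau_Unt eqxx mul1r.
by rewrite sumr_const -[_ *+ _]mulr_natl !card_prod !card_ord.
Qed.

Lemma box_oneM n m : bone n * bone m = if n == m then bone n else 0.
Proof.
case: eqP => [<-|/eqP nm].
  rewrite mulr_suml; apply: eq_bigr => p _; rewrite mulr_sumr (bigD1 p)//= big1 ?addr0.
    rewrite (UntM tape_tK' tape_t'K tape_z_id tape_zatC tape_ttC tape_tzC tape_zzC) eqxx scale1r//.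
  move=> q qp; rewrite (UntM tape_tK' tape_t'K tape_z_id tape_zatC tape_ttC tape_tzC tape_zzC) eq_sym (negPf qp).
  by rewrite scale0r.
rewrite mulr_suml big1// => p _; rewrite mulr_sumr big1// => q _.
exact: (UntM_neq tape_tK' tape_t'K tape_z_id tape_zatC tape_ttC tape_tzC tape_zzC).
Qed.

(** The event that all heads are on marks, but in none of the listed boxes. The complementary event
    of a head on a blank is handled by [dead_mx]. *)
Definition remainder (s : seq (nat * nat * nat)) : Q := all_alive - \sum_(n <- s) bone n.

Lemma star_remainder s : qg_star (remainder s) = remainder s.
Proof.
rewrite starD starN star_all_alive star_sum; congr (_ - _).
by apply: eq_bigr => n _; exact: star_box_one.
Qed.

Lemma tau_remainder s : tau (remainder s) = 2^-1 ^+ 3 - \sum_(n <- s) (volume n)%:R * weight n.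
Proof.
rewrite tauD tauN tau_all_alive tau_sum; congr (_ - _).
by apply: eq_bigr => n _; exact: tau_box_one.
Qed.

Lemma remainder_id s : uniq s -> remainder s * remainder s = remainder s.
Proof.
move=> us; rewrite /remainder; set b := \sum_(n <- s) _.
have ab : all_alive * b = b.
  rewrite /b mulr_sumr; apply: eq_bigr => n _; rewrite /box_one mulr_sumr.
  by apply: eq_bigr => p _; exact: all_alive_Unt.
have ba : b * all_alive = b.
  rewrite /b mulr_suml; apply: eq_bigr => n _; rewrite /box_one mulr_suml.
  by apply: eq_bigr => p _; exact: Unt_all_alive.
have bb : b * b = b.
  rewrite /b mulr_suml !big_seq; apply: eq_bigr => n ns.
  rewrite -big_seq mulr_sumr (bigD1_seq n)//= box_oneM eqxx big1 ?addr0// => m mn.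
  by rewrite box_oneM eq_sym (negPf mn).
by rewrite mulrBl !mulrBr all_alive_id ab ba bb subrr subr0.
Qed.

Lemma approximants (s : seq (nat * nat * nat)) :
  (forall n, n \in s -> [&& 0 < n.1.1, 0 < n.1.2 & 0 < n.2]%N) ->
  exists (U : 'M[Q]_3) (W : 'M[Q]_(3, 4)),
    [/\ walk_op *m U = 0, astar U = U,
        U + W *m walk_op = (1 - remainder s)%:M
      & \sum_i tau (U i i) = \sum_(n <- s) (~~ accepts n.1.1 n.1.2 n.2)%:R * weight n].
Proof.
(* The dead cells are split off first; with the sum of the boxes on the right-hand side the claim is
   additive in [s]. *)
move=> s_gt0; suff [U [W [AU sU UWA trU]]] : exists (U : 'M[Q]_3) (W : 'M[Q]_(3, 4)),
    [/\ walk_op *m U = 0, astar U = U, U + W *m walk_op = (\sum_(n <- s) bone n)%:M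
      & \sum_i tau (U i i) = \sum_(n <- s) (~~ accepts n.1.1 n.1.2 n.2)%:R * weight n].
  exists U, (dead_mx + W); split => //.
  rewrite mulmxDl dead_walk_op addrCA UWA -raddfD /=; congr (_%:M).
  by rewrite /remainder opprB (addrC (\sum_(n <- s) _)) addrA.
elim: s s_gt0 => [|n s IH] s_gt0.
  exists 0, 0; split; rewrite ?mulmx0 ?mul0mx ?big_nil ?addr0//.
  - by apply/matrixP => i j; rewrite !mxE star0.
  - by rewrite raddf0.
  - by rewrite big1// => i _; rewrite mxE; exact: qg0E.
have [|U [W [AU sU UWA trU]]] := IH.
  by move=> m ms; apply: s_gt0; rewrite inE ms orbT.
have /and3P[n0 n1 n2] := s_gt0 n (mem_head _ _).
case: n n0 n1 n2 {s_gt0} => [[n0 n1] n2] /= p0 p1 p2.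
have [u [w [Mu us uw tru]]] := walk_split p0 p1 p2.
exists (bmx u + U), (bmx w + W); split.
- rewrite mulmxDr AU addr0 (mul_blockmx _ walk_op_loc).
  by rewrite (eq_blockmx _ _ _ Mu) blockmx0.
- apply/matrixP => i j; have /matrixP /(_ i j) := sU; rewrite !mxE => sUij.
  rewrite starD sUij; congr (_ + _); rewrite star_sum exchange_big/=.
  apply: eq_bigr => p _; rewrite star_sum; apply: eq_bigr => q _.
  by rewrite starZ star_Unt us.
- rewrite mulmxDl addrACA UWA (blockmx_mul _ walk_op_loc) blockmxD.
  by rewrite (eq_blockmx _ _ _ uw) blockmx1 -raddfD big_cons.
- rewrite big_cons -trU; under eq_bigr do rewrite mxE tauD.
  rewrite big_split/=; congr (_ + _); rewrite -tru mulr_suml.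
  transitivity (\sum_i \sum_p u (i, p) (i, p) * weight (n0, n1, n2)); last first.
    by rewrite pair_bigA; apply: eq_bigr => -[].
  apply: eq_bigr => i _; rewrite mxE tau_sum; apply: eq_bigr => p _.
  rewrite tau_sum (bigD1 p)//= big1 ?addr0.
    by rewrite tauZ tau_Unt eqxx mul1r.
  by move=> q qp; rewrite tauZ tau_Unt eq_sym (negPf qp) mul0r mulr0.
Qed.

End Approximants.

(** * Numerical series *)

(** The third side runs up to [N * N], so that all accepted boxes with base side at most [N] are
    included. *)
Definition grid (N : nat) : seq (nat * nat * nat) :=
  [seq (ab, c) | ab <- [seq (a, b) | a <- iota 1 N, b <- iota 1 N], c <- iota 1 (N * N)%N].

Lemma grid_uniq N : uniq (grid N).
Proof.
apply: allpairs_uniq; rewrite ?iota_uniq//; last by move=> [? ?] [? ?].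
by apply: allpairs_uniq; rewrite ?iota_uniq// => -[? ?] [? ?].
Qed.

Lemma grid_gt0 N n : n \in grid N -> [&& 0 < n.1.1, 0 < n.1.2 & 0 < n.2]%N.
Proof.
move=> /allpairsP[[ab c]] /= [/allpairsP[[a b]] /= [+ + ->] + ->] /=.
by rewrite !mem_iota => /andP[-> _] /andP[-> _] /andP[-> _].
Qed.

Lemma grid_sum (V : nmodType) N (F : nat -> nat -> nat -> V) :
  \sum_(n <- grid N) F n.1.1 n.1.2 n.2 =
  \sum_(a <- iota 1 N) \sum_(b <- iota 1 N) \sum_(c <- iota 1 (N * N)%N) F a b c.
Proof. by rewrite /grid !big_allpairs. Qed.

Lemma grid_sum_prod N (f : nat -> rat) :
  \sum_(n <- grid N) f n.1.1 * f n.1.2 * f n.2 =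
  (\sum_(a <- iota 1 N) f a) ^+ 2 * \sum_(c <- iota 1 (N * N)%N) f c.
Proof.
rewrite (grid_sum N (fun a b c => f a * f b * f c)).
rewrite expr2 -mulrA [RHS]mulr_suml; apply: eq_bigr => a _ /=.
rewrite [in RHS]mulr_suml [RHS]mulr_sumr; apply: eq_bigr => b _.
by rewrite mulrA mulr_sumr.
Qed.

Lemma iota1S N : iota 1 N.+1 = rcons (iota 1 N) N.+1.
Proof. by rewrite -[in LHS](addn1 N) iotaD cats1 add1n. Qed.

Lemma sum_geom N : \sum_(a <- iota 1 N) 2^-1 ^+ a.+2 = 4^-1 - 2^-1 ^+ N.+2 :> rat.
Proof.
elim: N => [|N IH]; first by rewrite big_nil.
by rewrite iota1S -cats1 big_cat big_seq1 IH (exprS _ N.+2) /=; field.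
Qed.

Lemma sum_arith_geom N :
  \sum_(a <- iota 1 N) a%:R * 2^-1 ^+ a.+2 = 2^-1 - N.+2%:R * 2^-1 ^+ N.+2 :> rat.
Proof.
elim: N => [|N IH]; first by rewrite big_nil.
rewrite iota1S -cats1 big_cat big_seq1 IH (exprS _ N.+2) /= -(natr1 N.+2) -(natr1 N.+1).
by move: (N.+1%:R) (2^-1 ^+ N.+2) => x y; field.
Qed.

Lemma sum_pick (V : nmodType) (s : seq nat) (x : nat) (F : nat -> V) : uniq s -> x \in s ->
  (forall y, y != x -> F y = 0) -> \sum_(y <- s) F y = F x.
Proof.
move=> us xs F0; rewrite (bigD1_seq x)//= big1 ?addr0//.
Qed.

Lemma weight_prod n : weight n = 2^-1 ^+ n.1.1.+2 * 2^-1 ^+ n.1.2.+2 * 2^-1 ^+ n.2.+2.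
Proof. by rewrite /weight -!exprD; congr (_ ^+ _); lia. Qed.

(** An accepted box is given by its base side [a > 1]; with [a = k + 1] the exponent a^2+2a+6 of its
    weight becomes k^2+4k+9. *)
Lemma sum_accepts N :
  \sum_(n <- grid N) (accepts n.1.1 n.1.2 n.2)%:R * weight n =
  \sum_(1 <= k < N) 2^-1 ^+ (k ^ 2 + 4 * k + 9) :> rat.
Proof.
rewrite (grid_sum N (fun a b c => (accepts a b c)%:R * weight (a, b, c))).
transitivity (\sum_(a <- iota 1 N) (if (1 < a)%N then weight (a, a, a * a)%N else 0)).
  rewrite !big_seq; apply: eq_bigr => a; rewrite mem_iota => /andP[a1 aN].
  rewrite (@sum_pick _ _ a) ?iota_uniq ?mem_iota ?a1//; last first.
    by move=> b ba; rewrite big1// => c _; rewrite /accepts eq_sym (negPf ba) mul0r.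
  rewrite (@sum_pick _ _ (a * a)%N) ?iota_uniq//.
  - by rewrite /accepts !eqxx /= andbT; case: ifP; rewrite ?mul1r ?mul0r.
  - by rewrite mem_iota muln_gt0 a1 /= add1n ltnS leq_mul//; lia.
  - by move=> c ca; rewrite /accepts (negPf ca) andbF mul0r.
elim: N => [|[|N] IH]; first by rewrite big_nil big_geq.
  by rewrite big_cons big_nil big_geq// addr0.
rewrite iota1S -cats1 big_cat big_seq1 IH [RHS]big_nat_recr//=; congr (_ + _).
by rewrite /weight; congr (_ ^+ _) => /=; rewrite !expnS; nia.
Qed.

Lemma sum_not_accepts N :
  \sum_(n <- grid N) (~~ accepts n.1.1 n.1.2 n.2)%:R * weight n =
  (4^-1 - 2^-1 ^+ N.+2) ^+ 2 * (4^-1 - 2^-1 ^+ (N * N).+2) -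
  \sum_(1 <= k < N) 2^-1 ^+ (k ^ 2 + 4 * k + 9) :> rat.
Proof.
rewrite -sum_accepts -!sum_geom -grid_sum_prod.
apply/eqP; rewrite eq_sym subr_eq -big_split/=; apply/eqP/eq_bigr => n _.
by rewrite -weight_prod -mulrDl; case: accepts; rewrite ?add0r ?addr0 mul1r.
Qed.

(** The cells in listed boxes are counted by the third power of a sum tending to 1/2, so the
    difference tends to 0: almost surely a run is finite. *)
Lemma tau_remainder_grid N : tau (remainder (grid N) * remainder (grid N)) =
  2^-1 ^+ 3 - (2^-1 - N.+2%:R * 2^-1 ^+ N.+2) ^+ 2 *
              (2^-1 - (N * N).+2%:R * 2^-1 ^+ (N * N).+2).
Proof.
rewrite remainder_id ?grid_uniq// tau_remainder -!sum_arith_geom -grid_sum_prod.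
congr (_ - _); apply: eq_bigr => n _; rewrite weight_prod /volume !natrM.
by ring.
Qed.

Section Limits.
Variable R : realType.

Lemma sqr_le_exp2 m : (m ^ 2 <= 2 ^ m.+1)%N.
Proof.
have [|m4] := ltnP m 4; first by case: m => [|[|[|[|]]]].
elim: m m4 => // m IH; rewrite leq_eqVlt => /orP[/eqP <- //|m4].
by have := IH m4; rewrite (expnS _ m.+1) => /(leq_mul (leqnn 2)); apply: leq_trans; nia.
Qed.

Lemma mul_exp_le m : (0 < m)%N -> m%:R * 2^-1 ^+ m <= 2 / m%:R :> R.
Proof.
move=> m0; rewrite exprVn ler_pdivlMr ?ltr0n// mulrAC ler_pdivrMr ?exprn_gt0//.
by rewrite -exprS -expr2 -!natrX ler_nat sqr_le_exp2.
Qed.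

Lemma cvg_squeeze0 (u : nat -> R) : (forall n, 0 <= u n <= 2 * harmonic n) ->
  u n @[n --> \oo] --> 0.
Proof.
move=> uh; apply: (squeeze_cvgr (f := fun=> 0) (h := fun n => 2 * harmonic n)).
- by near=> n.
- exact: cvg_cst.
- by rewrite -(mulr0 2); apply: cvgMr; exact: cvg_harmonic.
Unshelve. all: by end_near.
Qed.

Lemma cvg_mul_exp (g : nat -> nat) : (forall n, n < g n)%N ->
  (g n)%:R * 2^-1 ^+ (g n) @[n --> \oo] --> (0 : R).
Proof.
move=> ng; apply: cvg_squeeze0 => n; have gn : (0 < g n)%N by rewrite (leq_ltn_trans _ (ng n)).
apply/andP; split; first by rewrite mulr_ge0// exprn_ge0.
apply: (le_trans (mul_exp_le gn)); rewrite ler_pM2l// /harmonic.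
by rewrite lef_pV2 ?posrE ?ltr0n// ler_nat.
Qed.

Lemma cvg_exp (g : nat -> nat) : (forall n, n < g n)%N ->
  2^-1 ^+ (g n) @[n --> \oo] --> (0 : R).
Proof.
move=> ng; apply: (squeeze_cvgr (f := fun=> 0) (h := fun n => (g n)%:R * 2^-1 ^+ (g n))).
- near=> n; rewrite exprn_ge0//= ler_peMl ?exprn_ge0// ler1n.
  by rewrite (leq_ltn_trans _ (ng n)).
- exact: cvg_cst.
- exact: cvg_mul_exp.
Unshelve. all: by end_near.
Qed.

Lemma cvg_theta : cvg ((\sum_(1 <= k < n) 1 / 2 ^+ (k ^ 2 + 4 * k + 6)%N : R) @[n --> \oo]).
Proof.
apply: nondecreasing_is_cvgn.
  apply/nondecreasing_seqP => -[|n]; first by rewrite !big_geq.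
  by rewrite [leRHS]big_nat_recr//= lerDl divr_ge0// exprn_ge0.
exists 1 => _ [n _ <-].
(* The term of index [N.+1] is at most 2^-(N+1), so the bound telescopes. *)
have aux N : \sum_(1 <= k < N.+1) 1 / 2 ^+ (k ^ 2 + 4 * k + 6)%N <= 1 - 2^-1 ^+ N :> R.
  elim: N => [|N IH]; first by rewrite big_geq// subrr.
  rewrite big_nat_recr//=; apply: (le_trans (lerD IH (_ : _ <= 2^-1 ^+ N.+1))).
    rewrite mul1r -exprVn ler_wiXn2l//; first by rewrite invf_le1 ?ler1n.
    by nia.
  by rewrite exprS; lra.
case: n => [|n]; first by rewrite big_geq.
by apply: le_trans (aux n) _; rewrite gerBl exprn_ge0.
Qed.

End Limits.

Theorem corollary1p2 (R : realType) :
  @l2_betti R (grp ^ 3)%type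
    (1 / 64 - 1 / 8 *
       lim ((\sum_(1 <= k < n) 1 / 2 ^+ (k ^ 2 + 4 * k + 6)%N : R)
              @[n --> \oo])).
Proof.
have /choice[U /choice[W UW]] N := approximants (@grid_gt0 N).
have ratr_half k : ratr (2^-1 ^+ k : rat) = 2^-1 ^+ k :> R.
  by rewrite rmorphXn fmorphV rmorph_nat.
have sq_gt n : (n < (n * n).+2)%N by nia.
exists 3%N, (astar walk_op *m walk_op).
apply: (@dim_ker_approx R _ 4 3 walk_op U W (fun N => remainder (grid N))).
- by move=> N; have [] := UW N.
- by move=> N; have [] := UW N.
- by move=> N; exact: star_remainder.
- by move=> N; have [] := UW N.
- have e0 N : ratr (tau (remainder (grid N) * remainder (grid N))) =
      2^-1 ^+ 3 - (2^-1 - N.+2%:R * 2^-1 ^+ N.+2) ^+ 2 *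
        (2^-1 - (N * N).+2%:R * 2^-1 ^+ (N * N).+2) :> R.
    by rewrite tau_remainder_grid !(rmorphB, rmorphXn, rmorphM) /= !fmorphV !rmorph_nat.
  under eq_cvg do rewrite e0 expr2.
  have d0 := @cvg_mul_exp R (fun n => n.+2) (fun n => leqW (ltnSn n)).
  have d1 := @cvg_mul_exp R (fun n => (n * n).+2) sq_gt.
  have c : 2^-1 ^+ 3 - (2^-1 - N.+2%:R * 2^-1 ^+ N.+2) * (2^-1 - N.+2%:R * 2^-1 ^+ N.+2) *
        (2^-1 - (N * N).+2%:R * 2^-1 ^+ (N * N).+2) @[N --> \oo] -->
      (2^-1 ^+ 3 - (2^-1 - 0) * (2^-1 - 0) * (2^-1 - 0) : R).
    apply: cvgB; first exact: cvg_cst.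
    apply: cvgM; last by apply: cvgB; [exact: cvg_cst|exact: d1].
    by apply: cvgM; apply: cvgB; (exact: cvg_cst || exact: d0).
  have z : 2^-1 ^+ 3 - (2^-1 - 0) * (2^-1 - 0) * (2^-1 - 0) = 0 :> R by field.
  by rewrite z in c.
have e1 N : \sum_i ratr (tau (U N i i)) =
    (4^-1 - 2^-1 ^+ N.+2) ^+ 2 * (4^-1 - 2^-1 ^+ (N * N).+2) -
    \sum_(1 <= k < N) 2^-1 ^+ (k ^ 2 + 4 * k + 9) :> R.
  have [_ _ _ trU] := UW N; rewrite -rmorph_sum trU sum_not_accepts.
  rewrite rmorphB; congr (_ - _).
    by rewrite rmorphM rmorphXn !rmorphB !rmorphXn !fmorphV !rmorph_nat.
  by rewrite rmorph_sum; apply: eq_bigr => k _; exact: ratr_half.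
under eq_cvg do rewrite e1 expr2.
set L := lim _.
have cL : (\sum_(1 <= k < n) 1 / 2 ^+ (k ^ 2 + 4 * k + 6)%N : R) @[n --> \oo] --> L.
  exact: cvg_theta.
have d0 := @cvg_exp R (fun n => n.+2) (fun n => leqW (ltnSn n)).
have d1 := @cvg_exp R (fun n => (n * n).+2) sq_gt.
(* The value 1/64 is (1/4)^3, the total weight of all boxes, from which the accepted ones are
   subtracted. *)
have z : (4^-1 - 0) * (4^-1 - 0) * (4^-1 - 0) - 1 / 8 * L = 1 / 64 - 1 / 8 * L by field.
rewrite -z.
apply: cvgB.
  apply: cvgM; last by apply: cvgB; [exact: cvg_cst|exact: d1].
  by apply: cvgM; apply: cvgB; (exact: cvg_cst || exact: d0).
under eq_cvg => N.
  rewrite (_ : \sum_(1 <= k < N) _ =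
    1 / 8 * \sum_(1 <= k < N) 1 / 2 ^+ (k ^ 2 + 4 * k + 6)); last first.
    rewrite mulr_sumr; apply: eq_bigr => k _.
    rewrite (_ : k ^ 2 + 4 * k + 9 = 3 + (k ^ 2 + 4 * k + 6))%N; last by lia.
    by rewrite exprD exprVn (exprVn _ (_ + 6)%N) !mul1r; congr (_^-1 * _); ring.
  over.
by apply: cvgMr.
Qed.
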